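(* Let $n\ge 2$ and let $\mathcal{S}=\{s_i\}$ be a sequence of slits in a bounded open box $I\subset\mathbb{R}^n$ which is uniformly relatively separated and occurs on all locations and scales in $I$. Then, for every $p\ge1$, $$\mathrm{mod}_p\,\Gamma_{\mathcal{S}}=\mathrm{mod}_p(\hat\Gamma_{\mathcal{S}})=\mathrm{mod}_p(\Gamma_{nv})=0,$$ where $\Gamma_{nv}$ is the family of non-vertical curves in $M(\mathcal{S})$ or in $DM(\mathcal{S})$ (the equality holds in both cases).
   Context: Slits. Let $I=(a_1,b_1)\times\cdots\times(a_n,b_n)\subset\mathbb{R}^n$, $n\ge2$, be a bounded open box. A slit in $I$ is a set $s=\{x\}\times[c_2,d_2]\times\cdots\times[c_n,d_n]\subset I$ with $d_2-c_2=\dots=d_n-c_n=:l(s)>0$; slits in a sequence $\mathcal{S}=\{s_i\}_{i\ge1}$ are pairwise disjoint. $\mathcal{S}$ is uniformly relatively separated in $I$ if there is $\sigma>0$ with $\Delta(s_i,s_j)\ge\sigma$ and $\Delta(s_i,\partial I)\ge\sigma$ for all $i\ne j$, where $\Delta(E,F)=\mathrm{dist}(E,F)/\min(\mathrm{diam}\,E,\mathrm{diam}\,F)$. $\mathcal{S}$ occurs on all locations and scales in $I$ if there is $C\ge1$ such that for every ball $B(x,r)\subset I$ there is a slit $s_i\subset B(x,r)$ with $\mathrm{diam}\,s_i\ge r/C$. (Standing assumptions: also $\mathrm{diam}(s_i)\to0$ and $\bigcup_i s_i$ is dense in $I$.) Slit Sierpi\'nski space. Put $S_0=I$, $S_i=I\setminus\bigcup_{j\le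 i}s_j$, and let $(\overline{M}_i,d_{\overline{M}_i})$ be the completion of $S_i$ in its inner (path) metric (infimum of Euclidean lengths of curves in $S_i$), $\overline{M}_0=\overline I$. For $i\le j$ let $\tau_{i,j}:\overline{M}_j\to\overline{M}_i$ be the $1$-Lipschitz extension of the inclusion $S_j\subset S_i$. $M(\mathcal{S})=\varprojlim(\overline{M}_i,\tau_{i,j})$ with metric $d_{\mathcal{S}}(p,q)=\lim_i d_{\overline{M}_i}(p_i,q_i)$; $\tau_0:M(\mathcal{S})\to\overline I$, $p\mapsto p_0$. The outer boundary is $\tau_0^{-1}(\partial I)$. The double $DM(\mathcal{S})$ is obtained by gluing two copies of $M(\mathcal{S})$ along their outer boundaries by the identity, with the induced gluing path metric (equal to $d_{\mathcal{S}}$ on each copy, and to $\inf_z(d_{\mathcal{S}}(p,z)+d_{\mathcal{S}}(z,q))$ over $z$ in the outer boundary if $p,q$ are in different copies); $\tau_0$ extends to $DM(\mathcal{S})$ in the obvious way. Both are equipped with the Hausdorff measure $\mathcal{H}^n$. Curve families. Let $L=\{a_1\}\times(a_2,b_2)\times\cdots\times(a_n,b_n)$, $R=\{b_1\}\times(a_2,b_2)\times\cdots\times(a_n,b_n)$, $\mathcal{L}=\tau_0^{-1}(L)$, $\mathcal{R}=\tau_0^{-1}(R)$. A curve $\gamma:(0,1)\to X$ connects $E$ and $F$ if $E\cup F\cup\overline\gamma$ is connected. $\Gamma_{\mathcal{S}}$ is the family of curves in $I\setminus\bigcup_i s_i$ connecting $L$ and $R$ in $\overline I$. $\hat\Gamma_{\mathcal{S}}=\{\tau_0(\gamma):\gamma\subset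 M(\mathcal{S}),\ \gamma\text{ connects }\mathcal{L}\text{ and }\mathcal{R}\}$. A curve $\gamma$ in $M(\mathcal{S})$ or $DM(\mathcal{S})$ is vertical if $\pi_1(\tau_0(\gamma))$ is a single point, where $\pi_1$ is the first coordinate, and non-vertical otherwise. Modulus. $\mathrm{mod}_p\Gamma=\inf_\rho\int_X\rho^p\,d\mu$ over all Borel $\rho:X\to[0,\infty)$ with $\int_\gamma\rho\,ds\ge1$ for every locally rectifiable $\gamma\in\Gamma$; here $\mu=\mathcal{H}^n$, with $X=\mathbb{R}^n$ for $\Gamma_{\mathcal{S}}$ and $\hat\Gamma_{\mathcal{S}}$ and $X=M(\mathcal{S})$ or $DM(\mathcal{S})$ for $\Gamma_{nv}$. *)

(* Defs.v *)
From HB Require Import structures.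
From mathcomp Require Import all_boot all_order all_algebra generic_quotient.
From mathcomp Require Import all_classical all_reals all_analysis.
From mathcomp Require Import ring lra.

Set Implicit Arguments.
Unset Strict Implicit.
Unset Printing Implicit Defensive.

Import Order.TTheory GRing.Theory Num.Theory.
Import numFieldNormedType.Exports.

Local Open Scope classical_set_scope.
Local Open Scope ring_scope.

(* A \bar R-valued distance d makes a type into a pseudoMetricType with balls
   [set y | d x y < e], and the library's edist then gives back d
   (edist_ballE). Path metrics are defined as infima of lengths of curves, so a
   priori they take the value +oo. *)
HB.factory Record isExtendedDistance (R : realType) (M : Type) & Choice M := {
  ed : M -> M -> \bar R ;
  ed_ge0 : forall x y, (0 <= ed x y)%E ;
  edxx : forall x, ed x x = 0%E ;
  ed_sym : forall x y, ed x y = ed y x ;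
  ed_triangle : forall y x z, (ed x z <= ed x y + ed y z)%E
}.

HB.builders Context R M & isExtendedDistance R M.

Let ball (x : M) (e : R) : set M := [set y | (ed x y < e%:E)%E].

Let ent : set_system (M * M) := entourage_ ball.

Let nbhs (x : M) : set_system M := nbhs_ ent x.

Let nbhsE : nbhs = nbhs_ ent. Proof. by []. Qed.

HB.instance Definition _ := hasNbhs.Build M nbhs.

Let ball_center x (e : R) : 0 < e -> ball x e x.
Proof. by move=> e0; rewrite /ball/= edxx lte_fin. Qed.

Let ball_sym x y (e : R) : ball x e y -> ball y e x.
Proof. by rewrite /ball/= ed_sym. Qed.

Let ball_triangle x y z e1 e2 : ball x e1 y -> ball y e2 z ->
  ball x (e1 + e2) z.
Proof.
rewrite /ball/= => h1 h2; rewrite (le_lt_trans (ed_triangle y _ _))// EFinD.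
by rewrite lteD.
Qed.

Let entourageE : ent = entourage_ ball. Proof. by []. Qed.

HB.instance Definition _ := @Nbhs_isPseudoMetric.Build R M
  ent nbhsE ball ball_center ball_sym ball_triangle entourageE.

HB.end.

Lemma edist_ballE (R : realType) (X : pseudoMetricType R) (d : X -> X -> \bar R)
    (d0 : forall x y, (0 <= d x y)%E)
    (dE : forall x e, ball x e = [set y | (d x y < e%:E)%E]) (x y : X) :
  edist (x, y) = d x y.
Proof.
rewrite /edist; apply/eqP; rewrite eq_le; apply/andP; split.
- apply/lee_addgt0Pr => e e0.
  case h : (d x y) (d0 x y) => [r| |] //= r0; last first.
    by rewrite addye// leey.
  apply: ereal_inf_lbound; exists (r + e) => //; split.
    by rewrite ltr_wpDl.
  by rewrite dE /= h lte_fin ltrDl.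
- apply: le_ereal_inf_tmp => _ [r [r0]] + <-; rewrite dE /= => /ltW//.
Qed.

(* Row vectors with the Euclidean distance; the metric that the library puts on
   'rV[R]_n comes from the sup norm. *)
Definition euclid (R : realType) (n : nat) : Type := 'rV[R]_n.

Section Euclid.
Context {R : realType} {n : nat}.

Definition coord (x : euclid R n) (i : 'I_n) : R := (x : 'rV[R]_n) ord0 i.

Definition euclid_dist (x y : euclid R n) : R :=
  Num.sqrt (\sum_(i < n) (coord x i - coord y i) ^+ 2).

Lemma euclid_distxx x : euclid_dist x x = 0.
Proof.
by rewrite /euclid_dist big1 ?sqrtr0// => i _; rewrite subrr expr0n.
Qed.

Lemma euclid_dist_positivity x y : euclid_dist x y = 0 -> x = y.
Proof.
move=> /eqP; rewrite sqrtr_eq0 => h; apply/rowP => i; apply/eqP.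
rewrite -subr_eq0 -sqrf_eq0 eq_le sqr_ge0 andbT; apply: le_trans h.
by rewrite (bigD1 i)//= lerDl sumr_ge0// => j _; exact: sqr_ge0.
Qed.

Lemma euclid_dist_sym x y : euclid_dist x y = euclid_dist y x.
Proof.
by congr Num.sqrt; apply: eq_bigr => i _; rewrite -sqrrN opprB.
Qed.

Let CS (a b : 'I_n -> R) :
  (\sum_i a i * b i) ^+ 2 <= (\sum_i a i ^+ 2) * (\sum_i b i ^+ 2).
Proof.
rewrite -subr_ge0 -(pmulr_rge0 _ (@ltr0n R 2)).
suff -> : 2%:R * ((\sum_i a i ^+ 2) * (\sum_i b i ^+ 2) - (\sum_i a i * b i) ^+ 2)
    = \sum_i \sum_j (a i * b j - a j * b i) ^+ 2.
  by apply: sumr_ge0 => i _; apply: sumr_ge0 => j _; exact: sqr_ge0.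
transitivity (\sum_i \sum_j
    (a i ^+ 2 * b j ^+ 2 + a j ^+ 2 * b i ^+ 2 - 2 * (a i * b i) * (a j * b j))).
  transitivity ((\sum_i \sum_j (a i ^+ 2 * b j ^+ 2))
     + (\sum_i \sum_j (a j ^+ 2 * b i ^+ 2))
     - 2 * (\sum_i \sum_j ((a i * b i) * (a j * b j)))).
    rewrite [X in _ + X - _]exchange_big/=.
    by rewrite -!big_distrlr/=; ring.
  rewrite mulr_sumr -big_split/= -sumrB; apply: eq_bigr => i _.
  rewrite mulr_sumr -big_split/= -sumrB; apply: eq_bigr => j _.
  by rewrite mulrA.
by apply: eq_bigr => i _; apply: eq_bigr => j _; ring.
Qed.

Lemma euclid_dist_triangle y x z :
  euclid_dist x z <= euclid_dist x y + euclid_dist y z.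
Proof.
rewrite /euclid_dist.
set a := fun i => coord x i - coord y i; set b := fun i => coord y i - coord z i.
rewrite (eq_bigr (fun i => (a i + b i) ^+ 2)); last first.
  by move=> i _; rewrite /a /b; congr (_ ^+ 2); ring.
rewrite -/(a _) -/(b _).
set A := \sum_(i < n) a i ^+ 2; set B := \sum_(i < n) b i ^+ 2.
have A0 : 0 <= A by apply: sumr_ge0 => i _; exact: sqr_ge0.
have B0 : 0 <= B by apply: sumr_ge0 => i _; exact: sqr_ge0.
rewrite -(@ler_pXn2r _ 2)// ?nnegrE ?addr_ge0 ?sqrtr_ge0//.
rewrite sqr_sqrtr; last by apply: sumr_ge0 => i _; exact: sqr_ge0.
rewrite sqrrD !sqr_sqrtr//.
have -> : \sum_i (a i + b i) ^+ 2 = A + (\sum_i a i * b i) *+ 2 + B.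
  rewrite -sumrMnl -!big_split/=; apply: eq_bigr => i _; exact: sqrrD.
rewrite lerD2r lerD2l lerMn2r/= -sqrtrM//.
by rewrite (le_trans (ler_norm _))// -sqrtr_sqr ler_sqrt ?mulr_ge0// CS.
Qed.

End Euclid.

HB.instance Definition _ (R : realType) n := Choice.copy (euclid R n) 'rV[R]_n.
HB.instance Definition _ (R : realType) n := isMetric.Build R (euclid R n)
  euclid_distxx euclid_dist_positivity euclid_dist_sym euclid_dist_triangle.
HB.instance Definition _ (R : realType) n :=
  isPointed.Build (euclid R n) (0 : 'rV[R]_n).

Lemma edist_euclidE (R : realType) n (x y : euclid R n) :
  edist (x, y) = (euclid_dist x y)%:E.
Proof.
rewrite (@edist_ballE _ _ (fun x y => (euclid_dist x y)%:E))// => ? ?.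
by rewrite lee_fin sqrtr_ge0.
Qed.

Lemma le_ereal_infD (R : realType) (A B : set (\bar R)) (m : \bar R) :
  (forall u, A u -> 0 <= u)%E -> (forall v, B v -> 0 <= v)%E ->
  (forall u v, A u -> B v -> m <= u + v)%E ->
  (m <= ereal_inf A + ereal_inf B)%E.
Proof.
move=> A0 B0 H.
have iA : (0 <= ereal_inf A)%E by apply: le_ereal_inf_tmp => u /A0.
have iB : (0 <= ereal_inf B)%E by apply: le_ereal_inf_tmp => v /B0.
case EA : (ereal_inf A) (iA) => [r| |]// r0; last first.
  by rewrite addye ?leey// gt_eqF// (lt_le_trans _ iB)// ltNyr.
case EB : (ereal_inf B) (iB) => [q| |]// q0; last by rewrite addey ?leey.
apply/lee_addgt0Pr => e e0; have e2 : 0 < e / 2 by rewrite divr_gt0.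
have fA : ereal_inf A \is a fin_num by rewrite EA.
have fB : ereal_inf B \is a fin_num by rewrite EB.
have [u Au ur] := lb_ereal_inf_adherent e2 fA.
have [v Bv vq] := lb_ereal_inf_adherent e2 fB.
apply: (le_trans (H u v Au Bv)); apply: (le_trans (leeD (ltW ur) (ltW vq))).
by rewrite EA EB -!EFinD lee_fin addrACA -splitr.
Qed.

Section CurveLength.
Context {R : realType} {X : pseudoMetricType R}.
Implicit Types (g : R -> X) (a b c : R) (s t : seq R).
Local Open Scope ereal_scope.

Definition curve_variation g a b s : \bar R :=
  let F := g \o nth b (a :: s) in
  \sum_(0 <= k < size s) edist (F k, F k.+1).

Definition curve_length g a b : \bar R :=
  ereal_sup [set curve_variation g a b s | s in itv_partition a b].

(* Auxiliary recursive form of curve_variation, see curve_variationE. *)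
Fixpoint seq_variation g a s : \bar R :=
  if s is x :: s' then edist (g a, g x) + seq_variation g x s' else 0.

Lemma curve_variationE g a b s : curve_variation g a b s = seq_variation g a s.
Proof.
elim: s a => [|x s ih] a; rewrite /curve_variation/= ?big_nil//.
by rewrite big_nat_recl//=; congr +%E; rewrite -ih.
Qed.

Lemma seq_variation_ge0 g a s : 0 <= seq_variation g a s.
Proof. by elim: s a => //= x s ih a; rewrite adde_ge0// edist_ge0. Qed.

Lemma le_curve_length g a b s : itv_partition a b s ->
  seq_variation g a s <= curve_length g a b.
Proof.
by move=> abs; apply: ereal_sup_ubound; exists s => //; rewrite curve_variationE.
Qed.

Lemma curve_length_le g a b M :
  (forall s, itv_partition a b s -> seq_variation g a s <= M) ->
  curve_length g a b <= M.
Proof.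
by move=> h; apply: ge_ereal_sup => _ [s abs <-]; rewrite curve_variationE h.
Qed.

Lemma curve_length_ge0 g a b : (a <= b)%R -> 0 <= curve_length g a b.
Proof.
rewrite le_eqVlt => /predU1P[<-|ab].
  by apply: (@le_curve_length _ _ _ [::]); split=> /=.
by apply: (le_trans _ (le_curve_length g (itv_partition1 ab))); exact: seq_variation_ge0.
Qed.

Lemma edist_le_curve_length g a b : (a <= b)%R ->
  edist (g a, g b) <= curve_length g a b.
Proof.
rewrite le_eqVlt => /predU1P[<-|ab].
  have /edist_closeP -> : close (g a) (g a) by [].
  by apply: curve_length_ge0.
by apply: (le_trans _ (le_curve_length g (itv_partition1 ab))); rewrite /= adde0.
Qed.

Lemma curve_length_cons g a x c : (a < x)%R -> (x <= c)%R ->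
  edist (g a, g x) + curve_length g x c <= curve_length g a c.
Proof.
move=> ax xc.
have H s : itv_partition x c s ->
    edist (g a, g x) + seq_variation g x s <= curve_length g a c.
  move=> [xs lx]; apply: (@le_curve_length _ _ _ (x :: s)).
  by split => //=; rewrite ax.
case E : (edist (g a, g x)) (edist_ge0 (g a, g x)) => [r| |]// _; last first.
  have [s xcs] : exists s, itv_partition x c s.
    move: xc; rewrite le_eqVlt => /predU1P[<-|xc]; first by exists [::]; split=> /=.
    by exists [:: c]; exact: itv_partition1.
  have := H _ xcs; rewrite E addye; last first.
    by rewrite gt_eqF// (lt_le_trans _ (seq_variation_ge0 _ _ _))// ltNyr.
  by rewrite leye_eq => /eqP ->; rewrite leey.
rewrite -leeBrDl//; apply: curve_length_le => s /H.
by rewrite E -leeBrDl.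
Qed.

Lemma curve_length_concat g a b c : (a <= c)%R -> (c <= b)%R ->
  curve_length g a b <= curve_length g a c + curve_length g c b.
Proof.
move=> ac cb; apply: curve_length_le => s.
elim: s a ac => [|x s ih] a ac.
  move=> [_ /= /eqP ab].
  by rewrite adde_ge0//; apply: curve_length_ge0.
move=> abs; have xbs := itv_partition_cons abs.
have ax : (a < x)%R by case: abs => /= /andP[].
have [xc|cx] := leP x c.
  rewrite /= (le_trans (leeD2l _ (ih _ xc xbs)))// addeA leeD2r//.
  exact: curve_length_cons.
rewrite /= (le_trans (leeD2r _ (edist_triangle _ (g c) _)))// -addeA.
apply: leeD; first exact: edist_le_curve_length.
apply: (@le_curve_length _ _ _ (x :: s)); split.
  by case: xbs => /= -> _; rewrite cx.
by case: abs.
Qed.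

Lemma le_curve_length_comp g h (phi : R -> R) a b :
  (forall x y, (a <= x <= b)%R -> (a <= y <= b)%R -> (x < y)%R ->
    (phi x < phi y)%R) ->
  (forall x, (a <= x <= b)%R -> g x = h (phi x)) ->
  curve_length g a b <= curve_length h (phi a) (phi b).
Proof.
move=> phi_lt gh; apply: curve_length_le => s abs.
have ab := itv_partition_le abs.
suff H c t : (a <= c <= b)%R -> itv_partition c b t ->
    seq_variation g c t = seq_variation h (phi c) (map phi t) /\
    itv_partition (phi c) (phi b) (map phi t).
  have [|-> ?] := H a s _ abs; first by rewrite lexx.
  exact: le_curve_length.
elim: t c => [|x t ih] c cab cbt.
  by case: cbt => _ /= /eqP ->; split => //; split => /=.
have xbt := itv_partition_cons cbt.
have cx : (c < x)%R by case: cbt => /= /andP[].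
have xab : (a <= x <= b)%R.
  by case/andP : cab => ac _; rewrite (itv_partition_le xbt) (le_trans ac (ltW cx)).
have [e [p1 p2]] := ih _ xab xbt.
split; first by rewrite /= e !gh.
by split => //=; rewrite p1 phi_lt.
Qed.

Lemma seq_variation_rcons g a s x :
  seq_variation g a (rcons s x) = seq_variation g a s + edist (g (last a s), g x).
Proof.
by elim: s a => [|y s ih] a /=; rewrite ?adde0 ?add0e// ih addeA.
Qed.

Lemma seq_variation_rev g a s :
  seq_variation g (last a s) (rev (belast a s)) = seq_variation g a s.
Proof.
elim: s a => [//|x s ih] a /=.
rewrite rev_cons seq_variation_rcons ih edist_sym addeC; congr (edist (g _, _) + _).
case: s {ih} => [//|y s] /=.
by rewrite rev_cons last_rcons.
Qed.

Lemma le_curve_length_rev g a b :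
  curve_length (fun x => g (a + b - x)%R) a b <= curve_length g a b.
Proof.
apply: curve_length_le => s [pas /eqP lb].
set phi := fun x => (a + b - x)%R.
have -> c : seq_variation (fun x => g (a + b - x)%R) c s =
    seq_variation g (phi c) (map phi s).
  by elim: s c {pas lb} => //= x s ih c; rewrite ih.
rewrite -seq_variation_rev last_map lb.
have -> : phi b = a by rewrite /phi addrK.
apply: le_curve_length; split.
  have {1}-> : a = last (phi a) (map phi s) by rewrite last_map lb /phi addrK.
  rewrite rev_path path_map.
  apply: sub_path pas => x y /= xy.
  by rewrite /phi ltrD2l ltrN2.
case: s {pas} lb => [|y s] /= lb; first by rewrite lb.
by rewrite rev_cons last_rcons /phi addrAC subrr add0r.
Qed.

Lemma curve_length_cst (x : X) a b : curve_length (fun=> x) a b <= 0.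
Proof.
apply: curve_length_le => s _; elim: s a => //= y s ih a.
have /edist_closeP -> : close x x by [].
by rewrite add0e.
Qed.

End CurveLength.

Section InnerDistance.
Context {R : realType} {X : pseudoMetricType R}.
Variable A : set X.

Definition joins (x y : X) (g : R -> X) : Prop :=
  [/\ {within `[0, 1], continuous g}, g @` `[0, 1] `<=` A, g 0 = x & g 1 = y].

Definition inner_dist (x y : X) : \bar R :=
  ereal_inf [set curve_length g 0 1 | g in joins x y].

Lemma inner_dist_ge0 x y : (0 <= inner_dist x y)%E.
Proof. by apply: le_ereal_inf_tmp => _ [g _ <-]; exact: curve_length_ge0. Qed.

Lemma inner_distxx x : A x -> inner_dist x x = 0%E.
Proof.
move=> Ax; apply/eqP; rewrite eq_le inner_dist_ge0 andbT.
apply: (le_trans _ (curve_length_cst x 0 1)); apply: ereal_inf_lbound.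
exists (fun=> x) => //; split => //; last by move=> _ [t _ <-].
by move=> t; exact: cvg_cst.
Qed.

Let inner_dist_sym_le x y : (inner_dist y x <= inner_dist x y)%E.
Proof.
apply: le_ereal_inf_tmp => _ [g [gc gA g0 g1] <-].
apply: (le_trans _ (le_curve_length_rev g 0 1)).
apply: ereal_inf_lbound; exists (fun t => g (0 + 1 - t)) => //; split.
- apply/subspace_continuousP => t t01.
  have /subspace_continuousP/(_ (0 + 1 - t)) h := gc.
  have t01' : `[0, 1]%classic (0 + 1 - t).
    by move: t01; rewrite /= !in_itv/= => /andP[? ?]; apply/andP; split; lra.
  apply: (cvg_comp _ _ _ (h t01')) => /=.
  move=> P [e /= e0 he]; exists e => //= u /= tu u01; apply: he => /=.
    by rewrite (_ : _ - _ = u - t) 1?distrC//; ring.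
  by move: u01; rewrite !in_itv/= => /andP[? ?]; apply/andP; split; lra.
- move=> _ [t + <-]; rewrite /= in_itv/= => /andP[? ?]; apply: gA.
  by exists (0 + 1 - t) => //; rewrite /= in_itv/=; apply/andP; split; lra.
- by rewrite add0r subr0.
- by rewrite add0r subrr.
Qed.

Lemma inner_dist_sym x y : inner_dist x y = inner_dist y x.
Proof. by apply/eqP; rewrite eq_le !inner_dist_sym_le. Qed.

Let itv01_split :
  `[0, 1]%classic = `[0, 2^-1]%classic `|` `[2^-1, 1]%classic :> set R.
Proof.
apply/seteqP; split => t /=; rewrite !in_itv/=.
  move=> /andP[t0 t1]; have [th|/ltW th] := leP t 2^-1; [left|right].
    by rewrite t0.
  by rewrite th.
by case=> /andP[? ?]; apply/andP; split; lra.
Qed.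

Lemma inner_dist_triangle y x z :
  (inner_dist x z <= inner_dist x y + inner_dist y z)%E.
Proof.
have H g h : joins x y g -> joins y z h ->
    (inner_dist x z <= curve_length g 0 1 + curve_length h 0 1)%E.
  move=> [gc gA g0 g1] [hc hA h0 h1].
  pose k t := if t <= 2^-1 then g (2 * t) else h (2 * t - 1).
  have k1 t : t <= 2^-1 -> k t = g (2 * t) by rewrite /k => ->.
  have k2 t : 2^-1 <= t -> k t = h (2 * t - 1).
    rewrite /k le_eqVlt => /predU1P[<-|]; last by rewrite ltNge => /negbTE ->.
    by rewrite lexx mulfV// subrr g1 h0.
  have l1 : (curve_length k 0 2^-1 <= curve_length g 0 1)%E.
    have := @le_curve_length_comp _ _ k g (fun t => 2 * t) 0 2^-1.
    rewrite /= mulr0 mulfV//; apply => [t u _ _ tu|t /andP[_]].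
      by rewrite ltr_pM2l.
    exact: k1.
  have l2 : (curve_length k 2^-1 1 <= curve_length h 0 1)%E.
    have := @le_curve_length_comp _ _ k h (fun t => 2 * t - 1) 2^-1 1.
    rewrite /= mulfV// subrr (_ : 2 * 1 - 1 = 1); last by ring.
    apply => [t u _ _ tu|t /andP[+ _]]; first by lra.
    exact: k2.
  have h12 : (0 <= 2^-1 :> R) /\ (2^-1 <= 1 :> R) by split; lra.
  apply: (le_trans _ (leeD l1 l2)).
  apply: (le_trans _ (curve_length_concat k h12.1 h12.2)).
  apply: ereal_inf_lbound; exists k => //; split.
  - rewrite itv01_split.
    apply: withinU_continuous; [exact: itv_closed|exact: itv_closed| |].
    + suff: {within `[0, 2^-1], continuous (fun t => g (2 * t))}.
        apply: subspace_eq_continuous => t; rewrite inE/= in_itv/= => /andP[_ th]; by rewrite [RHS]k1.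
      apply/subspace_continuousP => t t01.
      have /subspace_continuousP/(_ (2 * t)) hh := gc.
      have t01' : `[0, 1]%classic (2 * t).
        by move: t01; rewrite /= !in_itv/= => /andP[? ?]; apply/andP; split; lra.
      apply: (cvg_comp _ _ _ (hh t01')) => /=.
      move=> P [e /= e0 he]; exists (e / 2) => /=; first by rewrite divr_gt0.
      move=> u /= tu u01; apply: he => /=.
        by rewrite -mulrBr normrM ger0_norm//; lra.
      by move: u01; rewrite !in_itv/= => /andP[? ?]; apply/andP; split; lra.
    + suff: {within `[2^-1, 1], continuous (fun t => h (2 * t - 1))}.
        apply: subspace_eq_continuous => t; rewrite inE/= in_itv/= => /andP[th _]; by rewrite [RHS]k2.
      apply/subspace_continuousP => t t01.
      have /subspace_continuousP/(_ (2 * t - 1)) hh := hc.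
      have t01' : `[0, 1]%classic (2 * t - 1).
        by move: t01; rewrite /= !in_itv/= => /andP[? ?]; apply/andP; split; lra.
      apply: (cvg_comp _ _ _ (hh t01')) => /=.
      move=> P [e /= e0 he]; exists (e / 2) => /=; first by rewrite divr_gt0.
      move=> u /= tu u01; apply: he => /=.
        rewrite (_ : _ - _ = 2 * (t - u)); last by ring.
        by rewrite normrM ger0_norm//; lra.
      by move: u01; rewrite !in_itv/= => /andP[? ?]; apply/andP; split; lra.
  - move=> _ [t + <-]; rewrite /= in_itv/= => /andP[? ?].
    have [tl|/ltW tl] := leP t 2^-1.
      rewrite k1//; apply: gA; exists (2 * t) => //.
      by rewrite /= in_itv/=; apply/andP; split; lra.
    rewrite k2//; apply: hA; exists (2 * t - 1) => //.
    by rewrite /= in_itv/=; apply/andP; split; lra.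
  - by rewrite k1 ?mulr0//; lra.
  - by rewrite k2 ?mulr1; [rewrite (_ : 2 - 1 = 1)//; ring|lra].
apply: le_ereal_infD => [_ [g _ <-]|_ [g _ <-]|_ _ [g jg <-] [h jh <-]].
- exact: curve_length_ge0.
- exact: curve_length_ge0.
- exact: H jg jh.
Qed.

End InnerDistance.

(* The set A with its inner metric, not with the metric induced by X. *)
Definition inner_space (R : realType) (X : pseudoMetricType R) (A : set X) : Type :=
  {x : X | A x}.

HB.instance Definition _ (R : realType) (X : pseudoMetricType R) (A : set X) :=
  gen_eqMixin (inner_space A).
HB.instance Definition _ (R : realType) (X : pseudoMetricType R) (A : set X) :=
  gen_choiceMixin (inner_space A).
HB.instance Definition _ (R : realType) (X : pseudoMetricType R) (A : set X) :=
  isExtendedDistance.Build R (inner_space A)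
    (fun x y => inner_dist_ge0 A (sval x) (sval y))
    (fun x => inner_distxx (proj2_sig x))
    (fun x y => inner_dist_sym A (sval x) (sval y))
    (fun y x z => inner_dist_triangle A (sval y) (sval x) (sval z)).

Section InnerSpace.
Context {R : realType} {X : pseudoMetricType R}.

Lemma edist_innerE (A : set X) (x y : inner_space A) :
  edist (x, y) = inner_dist A (sval x) (sval y).
Proof.
rewrite (@edist_ballE _ _ (fun x y : inner_space A => inner_dist A (sval x) (sval y)))//.
by move=> *; exact: inner_dist_ge0.
Qed.

Definition nonexpansive {Y Z : pseudoMetricType R} (f : Y -> Z) : Prop :=
  forall x y, (edist (f x, f y) <= edist (x, y))%E.

Definition inner_incl (A B : set X) (AB : A `<=` B) (x : inner_space A) :
  inner_space B := exist _ (sval x) (AB _ (proj2_sig x)).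

Lemma nonexpansive_inner_incl (A B : set X) (AB : A `<=` B) :
  nonexpansive (inner_incl AB).
Proof.
move=> x y; rewrite !edist_innerE; apply: le_ereal_inf => _ [g [gc gA g0 g1] <-].
by exists g => //; split => //; exact: subset_trans AB.
Qed.

End InnerSpace.

Definition cauchy_seqs (R : realType) (X : pseudoMetricType R) : Type :=
  {u : nat -> X | cauchy (u @ \oo)}.

HB.instance Definition _ (R : realType) (X : pseudoMetricType R) :=
  gen_eqMixin (cauchy_seqs X).
HB.instance Definition _ (R : realType) (X : pseudoMetricType R) :=
  gen_choiceMixin (cauchy_seqs X).

Section Completion.
Context {R : realType} {X : pseudoMetricType R}.
Implicit Types u v w : cauchy_seqs X.

Definition cauchy_dist u v : \bar R :=
  limn (fun k => edist (sval u k, sval v k)).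

Lemma cauchy_seqP (u : nat -> X) : cauchy (u @ \oo) <->
  forall e : R, 0 < e -> exists N, forall k m, (N <= k)%N -> (N <= m)%N ->
    (edist (u k, u m) <= e%:E)%E.
Proof.
split=> [/cauchy_ballP cu e e0|cu].
  have [[P Q] /= [[N1 _ hP] [N2 _ hQ]] PQ] := cu e e0.
  exists (maxn N1 N2) => k m; rewrite !geq_max => /andP[k1 k2] /andP[m1 m2].
  apply: edist_fin => //=; apply: (PQ (u k, u m)); split; [exact: hP|exact: hQ].
apply/cauchy_ballP => e e0; have [N hN] := cu _ (divr_gt0 e0 (ltr0n R 2)).
pose P := [set x | exists2 k, (N <= k)%N & x = u k].
exists (P, P) => /=.
  by split; exists N => // k /= Nk; exists k.
move=> [x y] /= [[k Nk ->] [m Nm ->]].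
apply: (@edist_lt_ball _ _ e (u k, u m)).
by rewrite (le_lt_trans (hN _ _ Nk Nm))// lte_fin gtr_pMr// invf_lt1// ltr1n.
Qed.

Lemma is_cvg_cauchy_dist u v : cvgn (fun k => edist (sval u k, sval v k)).
Proof.
set a := fun k => _.
have H (e : R) : 0 < e -> exists N, forall k m, (N <= k)%N -> (N <= m)%N ->
    (a k <= a m + e%:E)%E.
  move=> e0; have e2 : 0 < e / 2 by rewrite divr_gt0.
  have [N1 h1] := (cauchy_seqP _).1 (svalP u) _ e2.
  have [N2 h2] := (cauchy_seqP _).1 (svalP v) _ e2.
  exists (maxn N1 N2) => k m; rewrite !geq_max => /andP[k1 k2] /andP[m1 m2].
  rewrite /a (le_trans (edist_triangle _ (sval u m) _))//.
  rewrite (le_trans (leeD2l _ (edist_triangle _ (sval v m) _)))//.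
  rewrite addeCA leeD2l// [e in leRHS]splitr EFinD leeD//.
    exact: h1.
  exact: h2.
have [N hN] := H 1 ltr01.
have [aoo|afin] := pselect (exists2 k, (N <= k)%N & a k = +oo%E).
  have [k Nk ak] := aoo.
  apply/cvg_ex; exists +oo%E; apply: cvg_near_cst; exists N => // m /= Nm.
  have := hN _ _ Nk Nm; rewrite ak leye_eq.
  by case: (a m) => [r| |].
have {}afin k : (N <= k)%N -> (a k \is a fin_num).
  move=> Nk; rewrite ge0_fin_numE ?edist_ge0// ltey; apply/eqP => ak.
  by apply: afin; exists k.
have /cauchy_cvgP/cvg_ex[l hl] : cauchy ((fine \o a) @ \oo).
  apply: cauchy_exP => e e0; have [N' hN'] := H _ (divr_gt0 e0 (ltr0n R 2)).
  exists (fine (a (maxn N N'))); exists (maxn N N') => // k /=.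
  rewrite geq_max => /andP[k1 k2]; rewrite /ball/=.
  have n1 := leq_maxl N N'; have n2 := leq_maxr N N'.
  have := hN' _ _ k2 n2; have := hN' _ _ n2 k2.
  rewrite -(fineK (afin _ k1)) -(fineK (afin _ n1)) -!EFinD !lee_fin => x1 x2.
  by rewrite ltr_norml; apply/andP; split; lra.
apply/cvg_ex; exists l%:E; apply/fine_cvgP; split => //.
by exists N => // k /=; exact: afin.
Qed.

Lemma cauchy_dist_ge0 u v : (0 <= cauchy_dist u v)%E.
Proof.
by apply: lime_ge; [exact: is_cvg_cauchy_dist|apply: nearW => k; exact: edist_ge0].
Qed.

Lemma cauchy_distxx u : cauchy_dist u u = 0%E.
Proof.
rewrite /cauchy_dist (_ : (fun _ => _) = cst 0%E) ?lim_cst//.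
by apply/funext => k; apply/edist_closeP.
Qed.

Lemma cauchy_dist_sym u v : cauchy_dist u v = cauchy_dist v u.
Proof. by congr (limn _); apply/funext => k; exact: edist_sym. Qed.

Lemma cauchy_dist_triangle v u w :
  (cauchy_dist u w <= cauchy_dist u v + cauchy_dist v w)%E.
Proof.
rewrite /cauchy_dist -limeD; [|exact: is_cvg_cauchy_dist..|]; last first.
  by apply: ge0_adde_def; rewrite inE; exact: cauchy_dist_ge0.
apply: lee_lim; [exact: is_cvg_cauchy_dist| |].
  apply: is_cvgeD; [|exact: is_cvg_cauchy_dist..].
  by apply: ge0_adde_def; rewrite inE; exact: cauchy_dist_ge0.
by apply: nearW => k; exact: edist_triangle.
Qed.

Definition cauchy_equiv u v : bool := cauchy_dist u v == 0%E.

Lemma cauchy_equiv_refl : reflexive cauchy_equiv.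
Proof. by move=> u; rewrite /cauchy_equiv cauchy_distxx. Qed.

Lemma cauchy_equiv_sym : symmetric cauchy_equiv.
Proof. by move=> u v; rewrite /cauchy_equiv cauchy_dist_sym. Qed.

Lemma cauchy_equiv_trans : transitive cauchy_equiv.
Proof.
move=> v u w /eqP uv /eqP vw; rewrite /cauchy_equiv eq_le cauchy_dist_ge0 andbT.
by rewrite (le_trans (cauchy_dist_triangle v _ _))// uv vw adde0.
Qed.

Canonical cauchy_equiv_equiv :=
  EquivRel cauchy_equiv cauchy_equiv_refl cauchy_equiv_sym cauchy_equiv_trans.

End Completion.

Definition completion (R : realType) (X : pseudoMetricType R) : Type :=
  {eq_quot (@cauchy_equiv R X)}%qT.

HB.instance Definition _ (R : realType) (X : pseudoMetricType R) :=
  Choice.copy (completion X) {eq_quot (@cauchy_equiv R X)}%qT.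
HB.instance Definition _ (R : realType) (X : pseudoMetricType R) :=
  EqQuotient.copy (completion X) {eq_quot (@cauchy_equiv R X)}%qT.

Definition completion_dist (R : realType) (X : pseudoMetricType R)
  (p q : completion X) : \bar R := cauchy_dist (repr p) (repr q).

HB.instance Definition _ (R : realType) (X : pseudoMetricType R) :=
  isExtendedDistance.Build R (completion X)
    (fun p q => cauchy_dist_ge0 (repr p) (repr q))
    (fun p => cauchy_distxx (repr p))
    (fun p q => cauchy_dist_sym (repr p) (repr q))
    (fun q p r => cauchy_dist_triangle (repr q) (repr p) (repr r)).

Section CompletionTheory.
Context {R : realType}.
Implicit Types X Y Z : pseudoMetricType R.
Local Open Scope quotient_scope.

Lemma edist_completionE X (p q : completion X) :
  edist (p, q) = completion_dist p q.
Proof. by rewrite (edist_ballE (d := @completion_dist R X))// => *; exact: cauchy_dist_ge0. Qed.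

Lemma cauchy_dist_repr X (u : cauchy_seqs X) :
  cauchy_dist (repr (\pi_(completion X) u)) u = 0%E.
Proof.
apply/eqP; have /eqmodP : repr (\pi_(completion X) u) = u %[mod completion X].
  by rewrite reprK.
by [].
Qed.

Lemma edist_completion_pi X (u v : cauchy_seqs X) :
  edist (\pi_(completion X) u, \pi_(completion X) v) =
  limn (fun k => edist (sval u k, sval v k)).
Proof.
rewrite edist_completionE /completion_dist -/(cauchy_dist u v).
apply/eqP; rewrite eq_le; apply/andP; split.
  rewrite (le_trans (cauchy_dist_triangle u _ _))// cauchy_dist_repr add0e.
  rewrite (le_trans (cauchy_dist_triangle v _ _))//.
  by rewrite [X in (_ + X)%E]cauchy_dist_sym cauchy_dist_repr adde0.
rewrite (le_trans (cauchy_dist_triangle (repr (\pi_(completion X) u)) _ _))//.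
rewrite cauchy_dist_sym cauchy_dist_repr add0e.
rewrite (le_trans (cauchy_dist_triangle (repr (\pi_(completion X) v)) _ _))//.
by rewrite cauchy_dist_repr adde0.
Qed.

Lemma cauchy_map Y Z (f : Y -> Z) (hf : nonexpansive f) (u : cauchy_seqs Y) :
  cauchy ((f \o sval u) @ \oo).
Proof.
apply/cauchy_seqP => e e0; have [N hN] := (cauchy_seqP _).1 (svalP u) _ e0.
by exists N => k m Nk Nm; rewrite (le_trans (hf _ _))// hN.
Qed.

Definition map_seq Y Z (f : Y -> Z) (hf : nonexpansive f) (u : cauchy_seqs Y) :
  cauchy_seqs Z := exist _ (f \o sval u) (cauchy_map hf u).

(* The extension of f to the completions, see completion_map_pi. *)
Definition completion_map Y Z (f : Y -> Z) (hf : nonexpansive f)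
  (p : completion Y) : completion Z :=
  \pi_(completion Z) (map_seq hf (repr p)).

Lemma cauchy_dist_map Y Z (f : Y -> Z) (hf : nonexpansive f)
    (u v : cauchy_seqs Y) :
  (cauchy_dist (map_seq hf u) (map_seq hf v) <= cauchy_dist u v)%E.
Proof.
apply: lee_lim; [exact: is_cvg_cauchy_dist..|].
by apply: nearW => k; exact: hf.
Qed.

Lemma completion_map_pi Y Z (f : Y -> Z) (hf : nonexpansive f)
    (u : cauchy_seqs Y) :
  completion_map hf (\pi_(completion Y) u) =
  \pi_(completion Z) (map_seq hf u).
Proof.
apply/eqmodP; rewrite /= /cauchy_equiv eq_le cauchy_dist_ge0 andbT.
by rewrite (le_trans (cauchy_dist_map _ _ _))// cauchy_dist_repr.
Qed.

Lemma nonexpansive_completion_map Y Z (f : Y -> Z) (hf : nonexpansive f) :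
  nonexpansive (completion_map hf).
Proof.
move=> p q; rewrite -[p]reprK -[q]reprK !completion_map_pi !edist_completion_pi.
exact: cauchy_dist_map.
Qed.

Lemma cauchy_cst Y (x : Y) : cauchy ((fun=> x) @ \oo : set_system Y).
Proof.
apply/cauchy_seqP => e e0; exists 0%N => k m _ _.
have /edist_closeP -> : close x x by [].
by rewrite lee_fin ltW.
Qed.

Definition to_completion Y (x : Y) : completion Y :=
  \pi_(completion Y) (exist _ (fun=> x) (cauchy_cst x)).

Lemma completion_map_to Y Z (f : Y -> Z) (hf : nonexpansive f) (x : Y) :
  completion_map hf (to_completion x) = to_completion (f x).
Proof. by rewrite /to_completion completion_map_pi; congr \pi_(completion Z); exact: eq_exist. Qed.

End CompletionTheory.

Section InverseLimit.
Context {R : realType} (Y : nat -> pseudoMetricType R).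
Variable f : forall i j, (i <= j)%N -> Y j -> Y i.
Hypothesis f_nonexpansive : forall i j (ij : (i <= j)%N), nonexpansive (f ij).

Definition inverse_limit : Type :=
  {p : forall i, Y i | forall i j (ij : (i <= j)%N), f ij (p j) = p i}.

Implicit Types p q r : inverse_limit.

Definition limit_dist p q : \bar R := limn (fun i => edist (sval p i, sval q i)).

Lemma is_cvg_limit_dist p q : cvgn (fun i => edist (sval p i, sval q i)).
Proof.
apply: ereal_nondecreasing_is_cvgn => i j ij.
by rewrite -(svalP p _ _ ij) -(svalP q _ _ ij) f_nonexpansive.
Qed.

Lemma limit_dist_ge0 p q : (0 <= limit_dist p q)%E.
Proof.
by apply: lime_ge; [exact: is_cvg_limit_dist|apply: nearW => k; exact: edist_ge0].
Qed.

Lemma limit_distxx p : limit_dist p p = 0%E.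
Proof.
rewrite /limit_dist (_ : (fun _ => _) = cst 0%E) ?lim_cst//.
by apply/funext => k; apply/edist_closeP.
Qed.

Lemma limit_dist_sym p q : limit_dist p q = limit_dist q p.
Proof. by congr (limn _); apply/funext => k; exact: edist_sym. Qed.

Lemma limit_dist_triangle q p r :
  (limit_dist p r <= limit_dist p q + limit_dist q r)%E.
Proof.
rewrite /limit_dist -limeD; [|exact: is_cvg_limit_dist..|]; last first.
  by apply: ge0_adde_def; rewrite inE; exact: limit_dist_ge0.
apply: lee_lim; [exact: is_cvg_limit_dist| |].
  apply: is_cvgeD; [|exact: is_cvg_limit_dist..].
  by apply: ge0_adde_def; rewrite inE; exact: limit_dist_ge0.
by apply: nearW => k; exact: edist_triangle.
Qed.

End InverseLimit.

Section MetricDouble.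
Context {R : realType} {M : pseudoMetricType R}.
Variable B : set M.

(* The two copies of M are the fibres of bool * M over false and true; they are
   glued along B. *)
Definition glue_dist (x y : bool * M) : \bar R :=
  if x.1 == y.1 then edist (x.2, y.2)
  else ereal_inf [set (edist (x.2, z) + edist (z, y.2))%E | z in B].

Lemma glue_dist_ge0 x y : (0 <= glue_dist x y)%E.
Proof.
rewrite /glue_dist; case: eqP => _; first exact: edist_ge0.
by apply: le_ereal_inf_tmp => _ [z _ <-]; rewrite adde_ge0 ?edist_ge0.
Qed.

Let edistxx (p : M) : edist (p, p) = 0%E.
Proof. by apply/edist_closeP. Qed.

Lemma glue_distxx x : glue_dist x x = 0%E.
Proof. by rewrite /glue_dist eqxx edistxx. Qed.

Lemma glue_dist_sym x y : glue_dist x y = glue_dist y x.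
Proof.
rewrite /glue_dist eq_sym; case: ifP => _; first exact: edist_sym.
congr ereal_inf; apply/seteqP.
by split => _ [z bz <-]; exists z => //; rewrite addeC; congr +%E; exact: edist_sym.
Qed.

Lemma glue_dist_triangle y x z :
  (glue_dist x z <= glue_dist x y + glue_dist y z)%E.
Proof.
have D0 (p q : M) : (0 <= edist (p, q))%E := edist_ge0 (p, q).
move: x y z => [b p] [b' q] [b'' r]; rewrite /glue_dist/=.
have T (u v w : M) := edist_triangle u v w.
have S1 (u v : M) : edist (u, v) = ereal_inf [set edist (u, v)].
  by rewrite ereal_inf1.
have pos (u v : M) t : [set (edist (u, z) + edist (z, v))%E | z in B] t ->
  (0 <= t)%E by move=> [z _ <-]; rewrite adde_ge0.
have [bb'|bb'] := eqVneq b b'; have [b'b''|b'b''] := eqVneq b' b''.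
- by rewrite bb' b'b'' eqxx T.
- rewrite bb' (negbTE b'b'') [X in (_ <= X + _)%E]S1.
  apply: le_ereal_infD; [by move=> _ ->|exact: pos|move=> _ _ -> [z bz <-]].
  rewrite (@le_trans _ _ (edist (p, z) + edist (z, r))%E)//.
    by apply: ereal_inf_lbound; exists z.
  by rewrite addeA leeD2r.
- rewrite -b'b'' (negbTE bb') [X in (_ <= _ + X)%E]S1.
  apply: le_ereal_infD; [exact: pos|by move=> _ ->|move=> _ _ [z bz <-] ->].
  rewrite (@le_trans _ _ (edist (p, z) + edist (z, r))%E)//.
    by apply: ereal_inf_lbound; exists z.
  by rewrite -addeA leeD2l.
- have -> : b = b'' by case: b b' b'' bb' b'b'' => -[] [].
  rewrite eqxx; apply: le_ereal_infD; [exact: pos|exact: pos|].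
  move=> _ _ [z bz <-] [w bw <-].
  rewrite (le_trans (T _ z _))// -addeA leeD2l// (le_trans (T _ q _))// leeD2l//.
Qed.

Definition glue_rel (x y : bool * M) : bool :=
  (x == y) || (x.2 == y.2) && `[< B x.2 >].

Lemma glue_rel_refl : reflexive glue_rel.
Proof. by move=> x; rewrite /glue_rel eqxx. Qed.

Lemma glue_rel_sym : symmetric glue_rel.
Proof.
move=> x y; rewrite /glue_rel eq_sym [x.2 == _]eq_sym.
by have [->|] := eqVneq y.2 x.2.
Qed.

Lemma glue_rel_trans : transitive glue_rel.
Proof.
move=> y x z; rewrite /glue_rel => /orP[/eqP ->//|/andP[/eqP -> b]].
move=> /orP[/eqP <-|/andP[/eqP <- _]]; by rewrite eqxx b orbT.
Qed.

Canonical glue_rel_equiv :=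
  EquivRel glue_rel glue_rel_refl glue_rel_sym glue_rel_trans.

Definition metric_double : Type := {eq_quot glue_rel}%qT.

End MetricDouble.

HB.instance Definition _ (R : realType) (M : pseudoMetricType R) (B : set M) :=
  Choice.copy (metric_double B) {eq_quot (glue_rel B)}%qT.
HB.instance Definition _ (R : realType) (M : pseudoMetricType R) (B : set M) :=
  EqQuotient.copy (metric_double B) {eq_quot (glue_rel B)}%qT.
HB.instance Definition _ (R : realType) (M : pseudoMetricType R) (B : set M) :=
  isExtendedDistance.Build R (metric_double B)
    (fun x y => glue_dist_ge0 B (repr x) (repr y))
    (fun x => glue_distxx B (repr x))
    (fun x y => glue_dist_sym B (repr x) (repr y))
    (fun y x z => glue_dist_triangle B (repr y) (repr x) (repr z)).
HB.instance Definition _ (R : realType) (M : pseudoPMetricType R) (B : set M) :=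
  isPointed.Build (metric_double B) (\pi_(metric_double B) (false, point))%qT.

Section MetricDoubleTheory.
Context {R : realType} {M : pseudoMetricType R}.
Variable B : set M.

Lemma glue_dist_glued (x y : bool * M) : glue_rel B x y -> glue_dist B x y = 0%E.
Proof.
have D0 (p : M) : edist (p, p) = 0%E by apply/edist_closeP.
case/orP => [/eqP ->|/andP[/eqP xy /asboolP bx]]; first exact: glue_distxx.
rewrite /glue_dist -xy D0; case: ifP => // _.
apply/eqP; rewrite eq_le; apply/andP; split.
  by apply: ereal_inf_lbound; exists x.2 => //; rewrite D0 adde0.
by apply: le_ereal_inf_tmp => _ [z _ <-]; rewrite adde_ge0 ?edist_ge0.
Qed.

Lemma edist_metric_double_pi (x y : bool * M) :
  edist (\pi_(metric_double B) x, \pi_(metric_double B) y)%qT = glue_dist B x y.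
Proof.
have H (z : bool * M) : glue_dist B (repr (\pi_(metric_double B) z)%qT) z = 0%E.
  by apply: glue_dist_glued; apply/eqmodP; rewrite reprK.
rewrite (edist_ballE (d := fun a b : metric_double B => glue_dist B (repr a) (repr b)))//;
  last by move=> *; exact: glue_dist_ge0.
apply/eqP; rewrite eq_le; apply/andP; split.
  rewrite (le_trans (glue_dist_triangle B x _ _))// H add0e.
  rewrite (le_trans (glue_dist_triangle B y _ _))//.
  by rewrite [X in (_ + X)%E]glue_dist_sym H adde0.
rewrite (le_trans (glue_dist_triangle B (repr (\pi_(metric_double B) x)%qT) _ _))//.
rewrite glue_dist_sym H add0e.
rewrite (le_trans (glue_dist_triangle B (repr (\pi_(metric_double B) y)%qT) _ _))//.
by rewrite H adde0.
Qed.

Lemma metric_double_repr_pi (x : bool * M) : (repr (\pi_(metric_double B) x)%qT).2 = x.2.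
Proof.
have : glue_rel B (repr (\pi_(metric_double B) x)%qT) x by apply/eqmodP; rewrite reprK.
by case/orP => [/eqP ->//|/andP[/eqP -> _]].
Qed.

End MetricDoubleTheory.

Section Slits.
Context {R : realType} {n : nat}.
Local Notation E := (euclid R n.+1).

(* The dimension is n.+1, so that ord0 is the first coordinate. *)
Record box := Box {
  box_lo : E ;
  box_hi : E ;
  box_lt : forall i, coord box_lo i < coord box_hi i }.

Definition open_box (I : box) : set E :=
  [set x | forall i, coord (box_lo I) i < coord x i < coord (box_hi I) i].

Definition is_slit (I : box) (s : set E) : Prop :=
  exists (c : E) (l : R), [/\ 0 < l,
    s = [set x | coord x ord0 = coord c ord0 /\
      forall i, i != ord0 -> coord c i <= coord x i <= coord c i + l] &
    s `<=` open_box I].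

(* The slits are numbered from 0. *)
Record slit_seq (I : box) := SlitSeq {
  slit :> nat -> set E ;
  slitP : forall i, is_slit I (slit i) ;
  slit_disjoint : trivIset setT slit }.

Section SlitSpace.
Variables (I : box) (S : slit_seq I).

Definition slit_domain (i : nat) : set E :=
  open_box I `\` \bigcup_(j in `I_i) S j.

Lemma slit_domainS i j : (i <= j)%N -> slit_domain j `<=` slit_domain i.
Proof.
move=> ij x [Ix Sx]; split => // -[k /= ki Skx]; apply: Sx.
by exists k => //=; exact: leq_trans ij.
Qed.

Definition stage (i : nat) : pseudoMetricType R :=
  completion (inner_space (slit_domain i)).

Definition tau i j (ij : (i <= j)%N) : stage j -> stage i :=
  completion_map (nonexpansive_inner_incl (slit_domainS ij)).

Lemma nonexpansive_tau i j (ij : (i <= j)%N) : nonexpansive (tau ij).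
Proof. exact: nonexpansive_completion_map. Qed.

Definition slit_space : Type := inverse_limit tau.

(* The inverse limit is nonempty: countably many hyperplanes orthogonal to the
   first axis do not cover the box. *)
Lemma slit_complement_neq0 :
  exists x : E, forall i, slit_domain i x.
Proof.
have /choice[c hc] : forall i, exists c : R, forall x, S i x -> coord x ord0 = c.
  move=> i; have [c [l [_ -> _]]] := slitP S i.
  by exists (coord c ord0) => x [].
pose T : set R := `]coord (box_lo I) ord0, coord (box_hi I) ord0[%classic.
have [t [Tt ct]] : exists t, T t /\ ~ range c t.
  apply: contrapT => h.
  have Tc : T `<=` range c.
    by move=> t Tt; apply: contrapT => ct; apply: h; exists t.
  have cT : countable T.
    by apply: (sub_countable (subset_card_le Tc)); exact: card_image_le.
  have := countable_lebesgue_measure0 cT.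
  rewrite /T lebesgue_measure_itv/= lte_fin box_lt -EFinB => -[] /eqP.
  by rewrite subr_eq0 gt_eqF// box_lt.
pose x : E := \row_i (if i == ord0 then t
  else (coord (box_lo I) i + coord (box_hi I) i) / 2).
have x0 : coord x ord0 = t by rewrite /coord mxE eqxx.
exists x => i; split.
  move=> k; rewrite /coord mxE; have := box_lt I k.
  case: eqP => [-> _|_]; first by move: Tt; rewrite /T /= in_itv.
  by rewrite /coord => lt_k; apply/andP; split; lra.
move=> [j _] /hc; rewrite x0 => tc; apply: ct; exists j => //.
Qed.

Lemma slit_space_neq0 : exists p : slit_space, True.
Proof.
have [x hx] := slit_complement_neq0.
pose y i : inner_space (slit_domain i) := exist _ x (hx i).
have h i j (ij : (i <= j)%N) : tau ij (to_completion (y j)) = to_completion (y i).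
  rewrite /tau completion_map_to; congr to_completion; exact: eq_exist.
by exists (exist _ (fun i => to_completion (y i)) h).
Qed.

End SlitSpace.
End Slits.
Arguments box : clear implicits.
Arguments tau {R n I} S {i j} ij _.
Arguments nonexpansive_tau {R n I} S {i j} ij.

HB.instance Definition _ (R : realType) n (I : box R n) (S : slit_seq I) :=
  gen_eqMixin (slit_space S).
HB.instance Definition _ (R : realType) n (I : box R n) (S : slit_seq I) :=
  gen_choiceMixin (slit_space S).
HB.instance Definition _ (R : realType) n (I : box R n) (S : slit_seq I) :=
  isPointed.Build (slit_space S) (projT1 (cid (slit_space_neq0 S))).
HB.instance Definition _ (R : realType) n (I : box R n) (S : slit_seq I) :=
  isExtendedDistance.Build R (slit_space S)
    (limit_dist_ge0 (@nonexpansive_tau _ _ _ S)) (@limit_distxx _ _ (@tau _ _ _ S))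
    (@limit_dist_sym _ _ (@tau _ _ _ S)) (limit_dist_triangle (@nonexpansive_tau _ _ _ S)).

Definition boundary (X : topologicalType) (A : set X) : set X :=
  closure A `\` interior A.

Section SlitSpaceTheory.
Context {R : realType} {n : nat} {I : box R n}.
Variable S : slit_seq I.
Local Notation E := (euclid R n.+1).

Lemma edist_slit_spaceE (p q : slit_space S) :
  edist (p, q) = limn (fun i => edist (sval p i, sval q i)).
Proof.
rewrite (@edist_ballE R (slit_space S) (@limit_dist _ _ (@tau _ _ _ S)))// => x y.
exact: (limit_dist_ge0 (@nonexpansive_tau _ _ _ S)).
Qed.

(* Stage 0 is the completion of the box in its inner metric. The box is convex,
   so this metric is the Euclidean one, and stage 0 is identified with the
   closed box by sending the class of a Cauchy sequence to its limit. *)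
Definition tau0 (p : slit_space S) : E :=
  limn (fun k => sval (sval (repr (sval p 0%N : completion _)) k)).

Definition outer_boundary : set (slit_space S) := tau0 @^-1` boundary (open_box I).

Definition slit_double : Type := metric_double outer_boundary.

End SlitSpaceTheory.

Arguments tau0 {R n I} S p.
Arguments outer_boundary {R n I} S.

HB.instance Definition _ (R : realType) n (I : box R n) (S : slit_seq I) :=
  PseudoPointedMetric.copy (slit_double S) (metric_double (outer_boundary S)).

Definition double_tau0 (R : realType) n (I : box R n) (S : slit_seq I)
  (x : slit_double S) : euclid R n.+1 := tau0 S (repr (x : metric_double _)).2.

Arguments double_tau0 {R n I} S x.

Section HausdorffMeasure.
Context {R : realType} {X : pseudoMetricType R}.
Implicit Types A F : set X.
Local Open Scope ereal_scope.

Definition diam A : \bar R := ereal_sup ([set edist xy | xy in A `*` A] `|` [set 0]).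

Definition set_dist A F : \bar R := ereal_inf [set edist xy | xy in A `*` F].

Definition relative_dist A F : R :=
  (fine (set_dist A F) / fine (mine (diam A) (diam F)))%R.

(* Hausdorff measure without normalising constant, as a function on all
   sets; it is a measure on the Borel sets. The constant scales all the moduli
   below by the same positive factor. *)
Definition hausdorff_content (m : nat) (delta : R) A : \bar R :=
  ereal_inf [set \sum_(0 <= k <oo) diam (F k) ^+ m | F in
    [set F : (set X)^nat | A `<=` \bigcup_k F k /\
      forall k, diam (F k) <= delta%:E]].

Definition hausdorff (m : nat) A : \bar R :=
  ereal_sup [set hausdorff_content m delta A | delta in [set d | (0 < d)%R]].

End HausdorffMeasure.

Section Curves.
Context {R : realType} {X : pseudoMetricType R}.
Implicit Types (g : R -> X) (rho : X -> R).

(* A curve (0, 1) -> X is given by a total function R -> X of which only the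
   values on ]0, 1[ are used. *)
Definition curve g : Prop := {within `]0, 1[, continuous g}.

Definition locally_rectifiable g : Prop :=
  forall a b, 0 < a -> a <= b -> b < 1 -> (curve_length g a b < +oo)%E.

(* The point g u at which the arc g|[a, u] first has length t. *)
Definition arclength_param g (a b t : R) : X :=
  g (inf [set u | a <= u <= b /\ (t%:E <= curve_length g a u)%E]).

(* The supremum over compact subarcs g|[a, b] of the integrals of rho along
   their arc length parametrisations. *)
Definition line_integral g rho : \bar R :=
  ereal_sup [set (\int[lebesgue_measure]_(t in `[0%R, fine (curve_length g ab.1 ab.2)])
                    (rho (arclength_param g ab.1 ab.2 t))%:E)%E
            | ab in [set ab : R * R | 0 < ab.1 <= ab.2 /\ ab.2 < 1]].

Definition connects (A F : set X) g : Prop :=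
  connected (A `|` F `|` closure (g @` `]0, 1[)).

End Curves.

Definition borel (X : ptopologicalType) := g_sigma_algebraType (@open X).

Section Modulus.
Context {R : realType} {X : pseudoPMetricType R}.

Definition admissible (G : set (R -> X)) (rho : X -> R) : Prop :=
  [/\ measurable_fun [set: borel X] (rho : borel X -> R),
      forall x, 0 <= rho x &
      forall g, G g -> locally_rectifiable g -> (1 <= line_integral g rho)%E].

Definition modulus (m : nat) (p : R) (G : set (R -> X)) : \bar R :=
  ereal_inf [set (\int[hausdorff m : set (borel X) -> \bar R]_(x in [set: borel X]) ((rho x) `^ p)%:E)%E
            | rho in admissible G].

End Modulus.

Section CurveFamilies.
Context {R : realType} {n : nat} {I : box R n}.
Variable S : slit_seq I.
Local Notation E := (euclid R n.+1).

Definition uniformly_relatively_separated : Prop :=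
  exists2 sigma : R, 0 < sigma &
    (forall i j, i != j -> sigma <= relative_dist (S i) (S j)) /\
    (forall i, sigma <= relative_dist (S i) (boundary (open_box I))).

Definition all_locations_and_scales : Prop :=
  exists2 C : R, 1 <= C &
    forall (x : E) (r : R), 0 < r -> ball x r `<=` open_box I ->
      exists2 i, S i `<=` ball x r & ((r / C)%:E <= diam (S i))%E.

Definition left_face : set E := [set x | coord x ord0 = coord (box_lo I) ord0 /\
  forall i, i != ord0 -> coord (box_lo I) i < coord x i < coord (box_hi I) i].

Definition right_face : set E := [set x | coord x ord0 = coord (box_hi I) ord0 /\
  forall i, i != ord0 -> coord (box_lo I) i < coord x i < coord (box_hi I) i].

Definition Gamma : set (R -> E) :=
  [set g | [/\ curve g, g @` `]0, 1[ `<=` open_box I `\` \bigcup_i S i &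
    connects left_face right_face g]].

Definition Gamma_hat : set (R -> E) :=
  [set tau0 S \o g | g in [set g : R -> slit_space S | curve g /\
    connects (tau0 S @^-1` left_face) (tau0 S @^-1` right_face) g]].

Definition vertical (X : Type) (t0 : X -> E) (g : R -> X) : Prop :=
  exists c : R, [set coord (t0 (g t)) ord0 | t in `]0, 1[] = [set c].

Definition Gamma_nv : set (R -> slit_space S) :=
  [set g | curve g /\ ~ vertical (tau0 S) g].

Definition double_Gamma_nv : set (R -> slit_double S) :=
  [set g | curve g /\ ~ vertical (double_tau0 S) g].

End CurveFamilies.

Arguments Gamma {R n I} S _.
Arguments Gamma_hat {R n I} S _.
Arguments Gamma_nv {R n I} S _.
Arguments double_Gamma_nv {R n I} S _.

(* Main.v *)
From HB Require Import structures.
From mathcomp Require Import all_boot all_order all_algebra generic_quotient.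
From mathcomp Require Import all_classical all_reals all_analysis.
From mathcomp Require Import measurable_realfun.
From mathcomp Require Import ring lra zify.
Require Import Defs.

Set Implicit Arguments.
Unset Strict Implicit.
Unset Printing Implicit Defensive.

Import Order.TTheory GRing.Theory Num.Theory.
Import numFieldNormedType.Exports.

Local Open Scope classical_set_scope.
Local Open Scope ring_scope.

(** The density that shows the modulus of a family to be 0 lives on a null set.
    Let f be the first coordinate, which takes different values along each curve
    of the families: on a curve joining the two faces its values fill an
    interval, by connectedness.

    For every k the box is filled, up to finitely many cells of small total
    volume, with the cores of finitely many flat boxes, the pockets. Each has
    its right face inside a slit, and the slits are so plentiful that such a
    pocket occupies a fixed proportion of a grid of cells inside every cell; the
    rest is filled recursively (exists_pockets). Inside a pocket the first
    coordinate can be flattened to a constant. A curve coming from the left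
    leaves the pocket through its lateral faces, as the slit blocks its way to
    the right; so the flattening may be cut off near the lateral faces, in
    layers that are thick compared with the width of the pocket, and it need
    not match anything beyond the slit. The result is a function w k along the
    curve, close to f, Lipschitz with a fixed constant, constant above the
    cores, and with a slope tending to 0 with k outside of an open set V k that
    lies above the cells not filled (flat_curve_slope, flat_curve_cst).

    As w k changes only while the curve is in V k, up to a small error, the
    length that the curve spends in V k while f takes values in a closed set H is
    at least proportional to the measure of H, when H lies inside the range of f
    along the curve. This survives for the limit superior B of the sets V k
    (length_in_lim_sup), which has Hausdorff measure 0 as the volumes of the
    cells are summable (hausdorff_lim_sup_eq0). It remains to choose disjoint
    closed sets of positive measure, one in every interval, and as density on B
    a suitable constant on the preimage of each (modulus_nonconstant_eq0).

    In the slit space two points above one cell may a priori be far apart, and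
    small cells do not directly give small sets. There f is first replaced by a
    staircase, which is constant except in zones about finitely many
    hyperplanes (staircase_slope, staircase_cst). Two points of the same zone
    reach a common hyperplane without slits along short curves, and inside that
    hyperplane every motion is free, so the parts of the zones above a small
    cell are small (climb_dist). The double is folded onto one copy of the slit
    space, and its two sheets are covered separately. *)

(** * Increments along a curve and its arc length *)

Section LocalMonotonicity.
Context {R : realType}.

(** The points t with F a <= F t reach up to their supremum, and then beyond it. *)
Lemma local_nondecreasing (F : R -> R) (a b : R) : a <= b ->
  (forall t, a <= t <= b -> exists2 e : R, 0 < e & forall c d,
     a <= c -> c <= d -> d <= b -> `|c - t| < e -> `|d - t| < e -> F c <= F d) ->
  F a <= F b.
Proof.
move=> ab loc.
pose A := [set t | a <= t <= b /\ F a <= F t].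
have Aa : A a by split; rewrite ?lexx.
have supA : has_sup A by split; [exists a|exists b => t [/andP[]]].
have sA : a <= sup A <= b.
  rewrite (ub_le_sup _ Aa) /=; last by exists b => t [/andP[]].
  by apply: ge_sup => [|t [/andP[]]//]; exists a.
have [e e0 he] := loc _ sA; have /andP[as_ sb] := sA.
have [t [/andP[ant tb] Ft] ts] := sup_adherent e0 supA.
have ts' : t <= sup A by apply: ub_le_sup => //; [exists b => u [/andP[]]|split=> //; apply/andP].
have Fs : F a <= F (sup A).
  by apply: (le_trans Ft); apply: he => //; rewrite ?subrr ?normr0 // ler0_norm; lra.
pose d := Num.min b (sup A + e / 2).
have sd : sup A <= d by rewrite le_min sb; lra.
have db : d <= b by rewrite ge_min lexx.
have ds : d <= sup A.
  apply: ub_le_sup => //; first by exists b => u [/andP[]].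
  split; first by rewrite db (le_trans as_).
  apply: (le_trans Fs); apply: he => //; rewrite ?subrr ?normr0 // ger0_norm ?subr_ge0//.
  by rewrite ltrBlDl gt_min; apply/orP; right; lra.
have [bs|bs] := leP b (sup A).
  by rewrite (_ : b = sup A)//; apply/le_anti; rewrite bs.
by move: ds; rewrite /d leNgt lt_min bs /= => /negP[]; lra.
Qed.

End LocalMonotonicity.

Section ArcLength.
Context {R : realType} {Y : pseudoMetricType R}.
Implicit Types (h : R -> Y) (a b c d t : R).

Lemma curve_length_rcons h a c d : a <= c -> c <= d ->
  (curve_length h a d < +oo)%E ->
  (curve_length h a c + edist (h c, h d) <= curve_length h a d)%E.
Proof.
move=> ac; rewrite le_eqVlt => /predU1P[<- _|cd lfin].
  have /edist_closeP -> : close (h c) (h c) by [].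
  by rewrite adde0.
have H s : itv_partition a c s ->
    (seq_variation h a s + edist (h c, h d) <= curve_length h a d)%E.
  move=> [pas /eqP lac]; rewrite -{1}lac -seq_variation_rcons.
  apply: le_curve_length; split; last by rewrite last_rcons.
  by rewrite rcons_path pas lac.
have [s sac] : exists s, itv_partition a c s.
  move: ac; rewrite le_eqVlt => /predU1P[<-|ac]; first by exists [::]; split=> /=.
  by exists [:: c]; exact: itv_partition1.
have dfin : edist (h c, h d) \is a fin_num.
  rewrite ge0_fin_numE ?edist_ge0// (le_lt_trans _ lfin)// (le_trans _ (H _ sac))//.
  by rewrite leeDr// seq_variation_ge0.
by rewrite -leeBrDr//; apply: curve_length_le => u /H; rewrite -leeBrDr.
Qed.

Lemma le_curve_length_itv h a c d : a <= c -> c <= d ->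
  (curve_length h a c <= curve_length h a d)%E.
Proof.
move=> ac cd.
have [->|ne] := eqVneq (curve_length h a d) +oo%E; first by rewrite leey.
apply: (le_trans _ (curve_length_rcons ac cd _)); last by rewrite ltey.
by rewrite leeDl// edist_ge0.
Qed.

Variables (h : R -> Y) (a b : R).
Hypothesis ab : a <= b.
Hypothesis lfin : (curve_length h a b < +oo)%E.

Let L t : R := fine (curve_length h a t).

Lemma arclengthE t : a <= t <= b -> ((L t)%:E = curve_length h a t)%E.
Proof.
move=> /andP[ant tb]; rewrite fineK// ge0_fin_numE ?curve_length_ge0//.
by rewrite (le_lt_trans _ lfin)// le_curve_length_itv.
Qed.

Lemma arclength_ge0 t : 0 <= L t.
Proof.
have [ant|ta] := leP a t; first by rewrite fine_ge0// curve_length_ge0.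
rewrite /L /curve_length (_ : [set _ | _ in _] = set0) ?ereal_sup0//.
apply/seteqP; split => // ? [s /itv_partition_le sat _].
by move: sat; rewrite leNgt => /negP; apply.
Qed.

Lemma edist_le_arclength c d : a <= c -> c <= d -> d <= b ->
  (edist (h c, h d) <= (L d - L c)%:E)%E.
Proof.
move=> ac cd db.
have dab : a <= d <= b by rewrite db (le_trans ac).
have cab : a <= c <= b by rewrite ac (le_trans cd).
rewrite EFinB leeBrDl// !arclengthE//.
apply: curve_length_rcons => //; rewrite -arclengthE//; exact: ltry.
Qed.

Lemma arclength_nd c d : a <= c -> c <= d -> d <= b -> L c <= L d.
Proof.
move=> ac cd db; rewrite -lee_fin !arclengthE ?le_curve_length_itv//.
  by rewrite db (le_trans ac).
by rewrite ac (le_trans cd).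
Qed.

Let A t := [set u | a <= u <= b /\ (t%:E <= curve_length h a u)%E].
Let U t := inf (A t).

Let A_neq0 t : t <= L b -> A t b.
Proof. by move=> tl; split; rewrite ?ab ?lexx// -arclengthE ?ab ?lexx// lee_fin. Qed.

Let A_lb t : has_lbound (A t).
Proof. by exists a => u [/andP[]]. Qed.

Let U_itv t : t <= L b -> a <= U t <= b.
Proof.
move=> tl; apply/andP; split.
  by apply: lb_le_inf => [|u [/andP[]]//]; exists b; exact: A_neq0.
exact/ge_inf/A_neq0.
Qed.

Lemma arclength_paramE t : t <= L b ->
  exists2 u, a <= u <= b & arclength_param h a b t = h u.
Proof. by move=> tl; exists (U t) => //; exact: U_itv. Qed.

Let U_between t c d : a <= c -> d <= b -> L c < t -> t <= L d -> c <= d ->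
  c <= U t <= d.
Proof.
move=> ac db ct td cd; apply/andP; split.
  apply: lb_le_inf => [|u [/andP[au ub] tu]].
    by exists b; apply/A_neq0/(le_trans td)/arclength_nd; rewrite // (le_trans ac).
  rewrite leNgt; apply/negP => uc.
  have := arclength_nd au (ltW uc) (le_trans cd db).
  move: tu; rewrite -arclengthE ?au// lee_fin => tu uLc.
  by move: ct; rewrite ltNge (le_trans tu).
apply: ge_inf => //; split; first by rewrite db (le_trans ac).
by rewrite -arclengthE ?lee_fin// db (le_trans ac).
Qed.

Lemma measurable_arclength_preimage (V : set Y) : curve h -> 0 < a -> b < 1 ->
  open V -> measurable (`[0, L b]%classic `&` [set t : R | V (arclength_param h a b t)]).
Proof.
move=> ch a0 b1 oV.
pose U' t := if t <= L b then U t else b.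
have U'nd : nondecreasing_fun U'.
  move=> t u tu; rewrite /U'; case: ifPn => tb; case: ifPn => ub //.
  - apply: lb_le_inf => [|x [xab ux]]; first by exists b; exact: A_neq0.
    by apply: ge_inf => //; split => //; rewrite (le_trans _ ux)// lee_fin.
  - by have /andP[] := U_itv tb.
  - by rewrite (le_trans tu ub) in tb.
have mU : measurable_fun setT U' by exact: nondecreasing_measurable.
have oW : open (`]0, 1[%classic `&` h @^-1` V).
  have o01 : open (`]0, 1[%classic : set R) by exact: itv_open.
  have := ch; rewrite /curve (continuous_open_subspace _ o01).
  move=> hc; rewrite openE => t [t01 Vt]; rewrite /interior.
  apply: filterI; first by apply: open_nbhs_nbhs; split.
  have := hc t; rewrite inE => /(_ t01); apply.
  by apply: open_nbhs_nbhs; split.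
have -> : `[0, L b] `&` [set t | V (arclength_param h a b t)] =
   `[0, L b] `&` (setT `&` U' @^-1` (`]0, 1[%classic `&` h @^-1` V)).
  apply/seteqP; split => t [] /=; rewrite in_itv/= => /andP[t0 tb]; rewrite /U' tb.
    have /andP[aU Ub] := U_itv tb.
    move=> ht; split; rewrite ?in_itv/= ?t0//; split=> //; split=> //.
    by rewrite ?in_itv/= (lt_le_trans a0)// (le_lt_trans Ub).
  by move=> [_ [_ ht]]; split; rewrite ?in_itv/= ?t0.
apply: measurableI => //; apply: mU => //; exact: open_measurable.
Qed.

(** The times at which the arc-length parametrisation visits V bound the
    increment of w; elsewhere w varies at the small rate kap. Let m s be the
    measure of the times in [0, s] spent in V. Then K * m (L t) + kap * L t - w t
    is locally nondecreasing in the original parameter t, so that w need not be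
    differentiated along the arc-length parametrisation. *)
Lemma increment_le_time (V : set Y) (K kap : R) (w : R -> R) :
  0 <= K -> 0 <= kap ->
  measurable (`[0, L b]%classic `&` [set t : R | V (arclength_param h a b t)]) ->
  (forall t, a <= t <= b -> exists2 e : R, 0 < e &
     (forall c d, a <= c -> c <= d -> d <= b -> `|c - t| < e -> `|d - t| < e ->
       (forall u, c <= u <= d -> V (h u)) /\
       (`|w d - w c|%:E <= K%:E * edist (h c, h d))%E) \/
     (forall c d, a <= c -> c <= d -> d <= b -> `|c - t| < e -> `|d - t| < e ->
       (`|w d - w c|%:E <= kap%:E * edist (h c, h d))%E)) ->
  `|w b - w a| <= K * fine (lebesgue_measure
     (`[0, L b]%classic `&` [set t : R | V (arclength_param h a b t)])) + kap * L b.
Proof.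
move=> K0 kap0; set T : set R := `[0, L b] `&` _ => mT loc.
pose m t : R := fine (lebesgue_measure (T `&` `[0, t])).
have mTt (t : R) : measurable (T `&` `[0, t]) by exact: measurableI.
have mfin t : lebesgue_measure (T `&` `[0, t]) \is a fin_num.
  rewrite ge0_fin_numE ?measure_ge0//; apply: (@le_lt_trans _ _ (lebesgue_measure (`[0, L b] : set R))).
    by apply: le_measure; [rewrite inE; exact: mTt|rewrite inE; exact: measurable_itv|move=> x [[]]].
  rewrite lebesgue_measure_itv/=; case: ifPn => // _; exact: ltry.
have m_nd t u : t <= u -> m t <= m u.
  move=> tu; rewrite fine_le//; apply: le_measure; [rewrite inE; exact: mTt..|move=> x [Tx]].
  rewrite /= !in_itv/= => /andP[x0 xt]; split => //; rewrite ?in_itv/= x0.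
  exact: le_trans tu.
have mS t u : 0 <= t -> t <= u -> `]t, u] `<=` T -> u - t <= m u - m t.
  move=> t0 tu tuT; rewrite lerBrDl -lee_fin EFinD /m !fineK//.
  have <- : lebesgue_measure (`]t, u]%classic : set R) = (u - t)%:E.
    rewrite lebesgue_measure_itv/= lte_fin; case: ltP => // ut.
    by rewrite (_ : u = t) ?subrr//; apply/le_anti/andP.
  rewrite -measureU; [|exact: mTt|exact: measurable_itv|]; last first.
    apply/seteqP; split => // x [[_ /=]]; rewrite !in_itv/= => /andP[_ xt] /andP[tx _].
    by move: tx; rewrite ltNge xt.
  apply: le_measure; [by rewrite inE; apply: measurableU; [exact: mTt|exact: measurable_itv]|rewrite inE; exact: mTt|].
  move=> x [[Tx /=]|/[dup] /tuT Tx /=]; rewrite !in_itv/= => /andP[x0 xt]; split => //=.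
    by rewrite ?in_itv/= x0 (le_trans xt).
  by rewrite ?in_itv/= xt andbT (le_trans t0)// ltW.
have mE : m (L b) = fine (lebesgue_measure T).
  by rewrite /m (_ : T `&` _ = T)//; apply/seteqP; split => x [] // [].
have m0 : 0 <= m 0 by rewrite fine_ge0.
rewrite -mE; clearbody m.
have key (v : R -> R) : (forall c d, `|v d - v c| = `|w d - w c|) ->
    v b - v a <= K * m (L b) + kap * L b.
  move=> vw; pose F t := K * m (L t) + kap * L t - v t.
  have Fab : F a <= F b.
    apply: local_nondecreasing => // t tab; have [e e0 he] := loc t tab.
    exists e => // c d ac cd db ce de.
    have Lcd := arclength_nd ac cd db.
    have D := edist_le_arclength ac cd db.
    have mcd : K * m (L c) <= K * m (L d) by rewrite ler_wpM2l// m_nd.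
    have kcd : kap * L c <= kap * L d by rewrite ler_wpM2l.
    have swap (x y p q : R) : y - x <= q - p -> p - x <= q - y by lra.
    apply: swap.
    apply: (le_trans (ler_norm _)); rewrite vw.
    case: he => he.
      have [hV hw] := he c d ac cd db ce de.
      have /(le_trans hw) : (K%:E * edist (h c, h d) <= K%:E * (L d - L c)%:E)%E by rewrite lee_wpmul2l.
      rewrite -EFinM lee_fin => /le_trans; apply.
      have : K * (L d - L c) <= K * (m (L d) - m (L c)).
        rewrite ler_wpM2l// mS ?arclength_ge0// => x /=; rewrite in_itv/= => /andP[cx xd].
        split; rewrite /= ?in_itv/=.
          rewrite (le_trans (arclength_ge0 c) (ltW cx))/= (le_trans xd)//.
          by apply: arclength_nd; rewrite // (le_trans ac).
        exact/hV/U_between.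
      by lra.
    have hw := he c d ac cd db ce de.
    have /(le_trans hw) : (kap%:E * edist (h c, h d) <= kap%:E * (L d - L c)%:E)%E by rewrite lee_wpmul2l.
    by rewrite -EFinM lee_fin => /le_trans; apply; lra.
  have := m_nd 0 (L a) (arclength_ge0 a); have := arclength_ge0 a.
  move: Fab; rewrite /F => Fab La ma.
  have : 0 <= K * m (L a) by rewrite mulr_ge0// (le_trans m0).
  have : 0 <= kap * L a by rewrite mulr_ge0.
  by lra.
rewrite ler_norml; apply/andP; split; last exact: key.
rewrite lerNl; apply: (@le_trans _ _ (- w b - - w a)); first by lra.
by apply: (key (fun t => - w t)) => c d; rewrite -normrN; congr `|_|; lra.
Qed.

End ArcLength.

(** * Null sets of the Hausdorff set function *)

Section NullSets.
Context {R : realType} {X : pseudoMetricType R}.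
Implicit Types (A F : set X) (m : nat).
Local Open Scope ereal_scope.

Lemma diam_ge0 A : 0 <= diam A.
Proof. by apply: ereal_sup_ubound; right. Qed.

Lemma diam_set0 : diam (set0 : set X) = 0.
Proof.
apply/eqP; rewrite eq_le diam_ge0 andbT.
by apply: ge_ereal_sup => _ [[xy [[]]]//|->].
Qed.

Lemma diam_le A (r : R) : (0 <= r)%R ->
  (forall x y, A x -> A y -> edist (x, y) <= r%:E) -> diam A <= r%:E.
Proof.
move=> r0 h; apply: ge_ereal_sup => _ [[[x y] [/= Ax Ay] <-]|->].
  exact: h.
by rewrite lee_fin.
Qed.

Lemma expe0S m : (0 : \bar R) ^+ m.+1 = 0.
Proof. by rewrite -EFin_expe expr0n. Qed.

Lemma diam_expe_ge0 A m : 0 <= diam A ^+ m.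
Proof. by rewrite expe_ge0// diam_ge0. Qed.

Lemma diam_expe_le A (r : R) m : (diam A <= r%:E) -> diam A ^+ m <= (r ^+ m)%:E.
Proof.
case: (diam A) (diam_ge0 A) => [s| |]//; rewrite !lee_fin => s0 sr.
by rewrite -EFin_expe lee_fin lerXn2r// ?nnegrE// (le_trans s0).
Qed.

Lemma hausdorff_content_ge0 m (delta : R) A : 0 <= hausdorff_content m delta A.
Proof.
by apply: le_ereal_inf_tmp => _ [F _ <-]; apply: nneseries_ge0 => k _ _; exact: diam_expe_ge0.
Qed.

Lemma hausdorff_ge0 m A : 0 <= hausdorff m A.
Proof.
apply: (le_trans (hausdorff_content_ge0 m 1 A)).
by apply: ereal_sup_ubound; exists 1%R => //=.
Qed.

Lemma le_hausdorff m A B : A `<=` B -> hausdorff m A <= hausdorff m B.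
Proof.
move=> AB; apply: ge_ereal_sup => _ [d d0 <-].
apply: (@le_trans _ _ (hausdorff_content m d B)); last first.
  by apply: ereal_sup_ubound; exists d.
apply: le_ereal_inf => _ [F [BF dF] <-]; exists F => //; split => //.
exact: subset_trans BF.
Qed.

(** As in the Borel-Cantelli lemma, the covers of all the V k with k large form
    a single countable cover of the limit superior, whose total content is the
    tail of a convergent series. *)
Lemma hausdorff_lim_sup_eq0 m (V : nat -> set X) (D : set X)
    (M : nat -> nat) (r : nat -> R) (F : nat -> nat -> set X) (C : R) :
  (forall k, V k `&` D `<=` \bigcup_(i in `I_(M k)) F k i) ->
  (forall k i, (i < M k)%N -> diam (F k i) <= (r k)%:E) ->
  (forall k, (M k)%:R * r k ^+ m.+1 <= C / 4 ^+ k)%R ->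
  (forall e : R, (0 < e)%R -> exists k0, forall k, (k0 <= k)%N -> (r k <= e)%R) ->
  hausdorff m.+1 (lim_sup_set V `&` D) = 0.
Proof.
move=> cov dF MrC r0; apply/eqP; rewrite eq_le hausdorff_ge0 andbT.
apply: ge_ereal_sup => _ [d /= d0 <-]; apply/lee_addgt0Pr => e e0; rewrite add0e.
have [k1 hk1] := r0 _ d0.
have [k2 hk2] : exists k2, (C / 2 ^+ k2 <= e / 2)%R.
  pose a : R := (`|C| / (e / 2))%R.
  exists (Num.truncn a).+1.
  have : (a < 2 ^+ (Num.truncn a).+1)%R.
    apply: (lt_le_trans (truncnS_gt a)).
    by rewrite -natrX ler_nat ltnW// ltn_expl.
  rewrite /a ltr_pdivrMr ?divr_gt0// => /ltW h.
  rewrite ler_pdivrMr ?exprn_gt0// mulrC (le_trans (ler_norm C))//.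
pose k0 := maxn k1 k2.
pose ok (k j : nat) := (k0 <= k)%N && (j < M k)%N.
pose G (x : nat * nat) := if ok x.1 x.2 then F x.1 x.2 else set0.
have G0 x : 0 <= diam (G x) ^+ m.+1 by exact: diam_expe_ge0.
have /card_esym/ppcard_eqP[f] := card_nat2.
apply: (@le_trans _ _ (\sum_(0 <= i <oo) diam (G (f i)) ^+ m.+1)).
  apply: ereal_inf_lbound; exists (fun i => G (f i)) => //; split.
    move=> x [/(_ k0 I)[k /= k0k Vx] Dx].
    have [j /= jM Fx] := cov k x (conj Vx Dx).
    exists (f^-1%FUN (k, j)) => //; rewrite invK ?inE// /G/= /ok.
    by rewrite k0k jM.
  move=> i; rewrite /G /ok; case: ifPn => [/andP[k0k jM]|_]; last by rewrite diam_set0 lee_fin ltW.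
  apply: (le_trans (dF _ _ jM)); rewrite lee_fin hk1//.
  by rewrite (leq_trans _ k0k)// leq_maxl.
rewrite nneseries_esumT; last by move=> i; exact: G0.
have bf : set_bij [set: nat] [set: nat * nat] f by exact: 'bij_f.
rewrite -(reindex_esum _ _ _ (fun x => diam (G x) ^+ m.+1) bf).
rewrite (_ : [set: nat * nat] = setT `*`` (fun=> setT)); last by apply/seteqP; split.
rewrite -(@esum_esum _ _ _ _ _ (fun i j => diam (G (i, j)) ^+ m.+1)); last first.
  by move=> *; exact: G0.
apply: (le_trans (le_esum (b := fun i => (e / (2 ^ i.+1)%:R)%:E) _)); last first.
  by rewrite -nneseries_esumT ?epsilon_trick0// ?ltW// => k; rewrite lee_fin divr_ge0// ltW.
move=> k _; rewrite -nneseries_esumT//.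
apply: lime_le; first exact: is_cvg_nneseries.
apply: nearW => n.
have [k0k|kk0] := leqP k0 k; last first.
  rewrite big1 ?lee_fin ?divr_ge0 ?ltW// => j _.
  by rewrite /G /ok leqNgt kk0 diam_set0 expe0S.
have rk0 : (0 < M k)%N -> (0 <= r k)%R.
  by move=> Mk; rewrite -lee_fin (le_trans (diam_ge0 _) (dF _ _ Mk)).
apply: (@le_trans _ _ (\sum_(0 <= j < n) (if (j < M k)%N then (r k ^+ m.+1)%:E else 0))).
  apply: lee_sum => j _; rewrite /G /ok k0k andTb [(k, j).2]/=; case: ifPn => [jM|_].
    exact/diam_expe_le/dF.
  by rewrite diam_set0 expe0S.
apply: (@le_trans _ _ ((M k)%:R * r k ^+ m.+1)%:E); last first.
  rewrite lee_fin; apply: (le_trans (MrC k)); rewrite natrX exprS invfM.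
  rewrite (_ : 4 ^+ k = 2 ^+ k * 2 ^+ k :> R)%R; last by rewrite -exprMn -natrM.
  rewrite invfM !mulrA ler_wpM2r// ?invr_ge0 ?exprn_ge0//.
  have [C0|/ltW C0] := leP 0%R C.
    apply: le_trans hk2; rewrite ler_wpM2l// lef_pV2 ?posrE ?exprn_gt0//.
    by rewrite ler_weXn2l ?ler1n// (leq_trans _ k0k)// leq_maxr.
  apply: (@le_trans _ _ 0%R); last by rewrite divr_ge0// ltW.
  by rewrite mulr_le0_ge0// invr_ge0 exprn_ge0.
rewrite -big_mkcond/= big_mkord sumEFin lee_fin.
have [M0|Mp] := posnP (M k).
  by rewrite big1 ?M0 ?mul0r.
rewrite mulr_natl.
rewrite sumr_const; apply: ler_wpMn2l => //.
  by rewrite exprn_ge0// rk0.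
rewrite -[leqRHS]card_ord.
pose g (i : 'I_n) : 'I_(M k) := insubd (Ordinal Mp) (val i).
rewrite -(@card_in_imset _ _ g) ?max_card// => i j iM jM /(congr1 val).
rewrite !val_insubd.
have -> : (i < M k)%N := iM; have -> : (j < M k)%N := jM.
exact: val_inj.
Qed.

Lemma hausdorff_set0 m : hausdorff m.+1 (set0 : set X) = 0.
Proof.
apply/eqP; rewrite eq_le hausdorff_ge0 andbT.
apply: ge_ereal_sup => _ [d /= d0 <-]; apply: ereal_inf_lbound.
exists (fun=> set0); first by split => [x []|k]; rewrite ?diam_set0 ?lee_fin ?ltW.
by rewrite eseries0// => k _ _; rewrite diam_set0 expe0S.
Qed.

End NullSets.

(** The integral is a supremum over simple functions, so monotonicity of the
    Hausdorff set function alone gives that functions vanishing off a null set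
    have integral 0. *)
Section IntegralHausdorff.
Context {R : realType} {X : pseudoPMetricType R}.
Local Open Scope ereal_scope.
Import HBNNSimple.

Lemma sintegral_null_eq0 m (B : set X) (h : {nnsfun (borel X) >-> R}) :
  hausdorff m B = 0 -> (forall x, ~ B x -> h x = 0%R) ->
  sintegral (hausdorff m : set (borel X) -> \bar R) h = 0.
Proof.
move=> B0 hB; rewrite sintegralET; apply: fsbig1 => x _.
have [->|x0] := eqVneq x 0%R; first by rewrite mul0e.
suff -> : hausdorff m (h @^-1` [set x] : set X) = 0 by rewrite mule0.
apply/eqP; rewrite eq_le hausdorff_ge0 andbT -B0.
apply: le_hausdorff => y /= hy; apply: contrapT => /hB.
by rewrite hy => xE; move: x0; rewrite xE eqxx.
Qed.

Let integralE m (f : X -> R) : (forall x, (0 <= f x)%R) ->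
  \int[hausdorff m.+1 : set (borel X) -> \bar R]_(x in [set: borel X]) (f x)%:E =
  ereal_sup [set sintegral (hausdorff m.+1 : set (borel X) -> \bar R) h |
    h in [set h : {nnsfun (borel X) >-> R} | forall x, (h x <= f x)%R]].
Proof.
move=> f0; rewrite /integral !patch_setT.
have -> : (fun x => (f x)%:E)^\+ = fun x => (f x)%:E.
  by apply/funext => x; rewrite funeposE; apply/max_idPl; rewrite lee_fin.
have -> : (fun x => (f x)%:E)^\- = cst 0.
  by apply/funext => x; rewrite funenegE; apply/max_idPr; rewrite -EFinN lee_fin oppr_le0.
rewrite [X in _ - X](_ : _ = 0) ?sube0//.
apply/eqP; rewrite eq_le; apply/andP; split.
  apply: ge_ereal_sup => _ [h /= h0 <-].
  rewrite (sintegral_null_eq0 (hausdorff_set0 m))// => x _.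
  by apply/eqP; rewrite eq_le -lee_fin h0/=.
apply: ereal_sup_ubound; exists nnsfun0 => //.
by rewrite (sintegral_null_eq0 (hausdorff_set0 m)).
Qed.

Lemma integral_null_eq0 m (B : set X) (f : X -> R) :
  hausdorff m.+1 B = 0 -> (forall x, (0 <= f x)%R) -> (forall x, ~ B x -> f x = 0%R) ->
  \int[hausdorff m.+1 : set (borel X) -> \bar R]_(x in [set: borel X]) (f x)%:E = 0.
Proof.
move=> B0 f0 fB; rewrite integralE//.
rewrite (_ : [set _ | _ in _] = [set 0]) ?ereal_sup1//.
apply/seteqP; split => [_ [h /= hf <-]|_ ->].
  rewrite (sintegral_null_eq0 B0)// => x Bx.
  by apply/eqP; rewrite eq_le -{1}(fB x Bx) hf/=.
by exists nnsfun0 => //; rewrite (sintegral_null_eq0 (hausdorff_set0 m)).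
Qed.

Lemma integral_hausdorff_ge0 m (f : X -> R) : (forall x, (0 <= f x)%R) ->
  0 <= \int[hausdorff m.+1 : set (borel X) -> \bar R]_(x in [set: borel X]) (f x)%:E.
Proof.
move=> f0; rewrite integralE//; apply: ereal_sup_ubound; exists nnsfun0 => //.
by rewrite (sintegral_null_eq0 (hausdorff_set0 m)).
Qed.

End IntegralHausdorff.

(** * Densities on the real line *)

Section IntegralLowerBound.
Context d (T : measurableType d) {R : realType} (mu : {measure set T -> \bar R}).
Import HBNNSimple.
Local Open Scope ereal_scope.

(** A constant times the indicator of S is a simple function below f. *)
Lemma le_integral_set (D S : set T) (f : T -> R) (c : R) :
  measurable S -> S `<=` D -> (0 <= c)%R -> (forall x, D x -> (0 <= f x)%R) ->
  (forall x, S x -> (c <= f x)%R) ->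
  c%:E * mu S <= \int[mu]_(x in D) (f x)%:E.
Proof.
move=> mS SD c0 f0 cf.
rewrite ge0_integralE; last by move=> x Dx; rewrite lee_fin f0.
pose h := scale_nnsfun (indic_nnsfun R mS) c0.
have hE : sintegral mu h = c%:E * mu S.
  have := sintegralrM mu c (indic_nnsfun R mS).
  by rewrite [in RHS]/= sintegral_indic => <-.
rewrite -hE; apply: ereal_sup_ubound; exists h => // x /=.
rewrite /h /= /patch mindicE; have [Sx|Sx] := pselect (S x).
  by rewrite !mem_set ?mulr1 ?lee_fin ?cf//; exact: SD.
rewrite (memNset Sx) mulr0; case: ifPn => // /set_mem Dx; by rewrite lee_fin f0.
Qed.

End IntegralLowerBound.

Section FatSets.
Context {R : realType}.

(** Disjoint closed sets of positive measure, one inside every interval: around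
    the terms of a sequence that takes each rational value infinitely often,
    rapidly shrinking intervals, each with the slightly enlarged later ones
    removed. *)
Lemma dense_disjoint_fat_sets : exists H : nat -> set R,
  [/\ forall m, closed (H m), trivIset setT H,
      forall m, (0 < lebesgue_measure (H m) < +oo)%E &
      forall a b : R, a < b -> exists m, H m `<=` `]a, b[].
Proof.
pose q (m : nat) : R := if unpickle m is Some x then ratr (x : rat * nat).1 else 0.
pose r (m : nat) : R := (8 ^+ m)^-1.
have r0 m : 0 < r m by rewrite invr_gt0 exprn_gt0.
pose J m := [set` `[q m - r m, q m + r m]] : set R.
pose J2 m := [set` `]q m - 2 * r m, q m + 2 * r m[] : set R.
pose U m := \bigcup_i J2 (m.+1 + i)%N.
have oU m : open (U m) by apply: bigcup_open => i _; exact: itv_open.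
pose H m := J m `&` ~` U m.
have cH m : closed (H m).
  apply: closedI; first exact: itv_closed.
  by apply: open_closedC; exact: oU.
exists H; split => //.
- have lt m1 m2 : (m1 < m2)%N -> H m1 `&` H m2 = set0.
    move=> m12; apply/seteqP; split => // x [[_ U1] [Jx _]]; apply: U1.
    exists (m2 - m1.+1)%N => //; rewrite subnKC//.
    move: Jx; rewrite /J /J2 /= !in_itv/= => /andP[? ?].
    by have := r0 m2; move=> ?; apply/andP; split; lra.
  move=> m1 m2 _ _; rewrite -[in X in X -> _]setIC => -[x Hx].
  apply: contrapT => /eqP; rewrite neq_ltn => /orP[] /lt h.
    by move: Hx; rewrite setIC h.
  by move: Hx; rewrite h.
- move=> m; have mH : measurable (H m) by exact: closed_measurable.
  have mJ : lebesgue_measure (J m) = (2 * r m)%:E.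
    rewrite lebesgue_measure_itv/= lte_fin ifT; last by have := r0 m; lra.
    by rewrite -EFinB; congr EFin; ring.
  apply/andP; split; last first.
    apply: (@le_lt_trans _ _ (lebesgue_measure (J m))); last by rewrite mJ ltry.
    by apply: le_measure; [rewrite inE|rewrite inE; exact: measurable_itv|move=> x []].
  have mU : (lebesgue_measure (U m) <= (r m)%:E)%E.
    apply: (@le_trans _ _ (\sum_(0 <= i <oo) lebesgue_measure (J2 (m.+1 + i)%N))%E).
      apply: measure_sigma_subadditive => //; last exact: open_measurable.
      by move=> i; exact: measurable_itv.
    apply: (le_trans _ (epsilon_trick0 xpredT (ltW (r0 m)))).
    apply: lee_nneseries => [i _ _|i _]; first exact: measure_ge0.
    rewrite lebesgue_measure_itv/= lte_fin ifT; last by have := r0 (m.+1 + i)%N; lra.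
    rewrite -EFinB lee_fin.
    rewrite (_ : _ - _ = 4 * r (m.+1 + i)%N); last by ring.
    have -> : 4 * r (m.+1 + i)%N = r m * (2^-1 * (8 ^+ i)^-1).
      by rewrite /r exprD exprS; field; rewrite !expf_neq0.
    rewrite natrX exprS invfM ler_wpM2l ?ler_wpM2l ?invr_ge0 ?(ltW (r0 m))//.
    by rewrite lef_pV2 ?posrE ?exprn_gt0// lerXn2r ?nnegrE ?ler_nat.
  rewrite lt_neqAle measure_ge0 andbT eq_sym; apply/eqP => H0.
  have : (lebesgue_measure (J m) <= lebesgue_measure (H m) + lebesgue_measure (U m))%E.
    apply: (@le_trans _ _ (lebesgue_measure (H m `|` U m))); last first.
      apply: measureU2 => //; exact: open_measurable.
    apply: le_measure; [rewrite inE; exact: measurable_itv|rewrite inE|].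
      apply: measurableU => //; exact: open_measurable.
    by move=> x Jx; have [?|?] := pselect (U m x); [right|left].
  rewrite H0 add0e mJ => /le_trans/(_ mU); rewrite lee_fin; have := r0 m; lra.
move=> a b ab; pose d := (b - a) / 3.
have d0 : 0 < d by rewrite divr_gt0// subr_gt0.
have /rat_in_itvoo[x] : a + d < b - d by rewrite /d; lra.
rewrite in_itv/= => /andP[ax xb].
pose n0 := Num.truncn (d^-1).
have rn m : (n0 < m)%N -> r m < d.
  move=> nm; rewrite /r invf_plt ?posrE ?exprn_gt0//.
  apply: (lt_le_trans (truncnS_gt _)).
  rewrite (@le_trans _ _ m%:R) ?ler_nat//.
  by rewrite -natrX ler_nat ltnW// ltn_expl.
have [i hi] : exists i : nat, (n0 < pickle (x, i))%N.
  apply: contrapT => h.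
  have {}h (i : nat) : (pickle (x, i) < n0.+1)%N.
    by rewrite ltnS leqNgt; apply/negP => hi; apply: h; exists i.
  pose f (i : 'I_n0.+2) : 'I_n0.+1 := Ordinal (h i).
  have : injective f.
    by move=> i j /(congr1 val)/= /(pcan_inj (@pickleK _))[] /val_inj.
  by move/leq_card; rewrite !card_ord ltnn.
exists (pickle (x, i)) => y [+ _].
have := rn _ hi; rewrite /J /= /q pickleK/= !in_itv/=.
by move=> ? /andP[? ?]; apply/andP; split; lra.
Qed.

End FatSets.

(** * A criterion for modulus zero *)

Section Cumulative.
Context {R : realType}.
Variable H : set R.
Hypothesis mH : measurable H.
Hypothesis Hfin : (lebesgue_measure H < +oo)%E.

(** Composed with this function, w has increments only while its values lie in
    H. *)
Definition cumul (x : R) : R := fine (lebesgue_measure (H `&` `]-oo, x])).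

Lemma cumulE x y : x <= y ->
  cumul y = cumul x + fine (lebesgue_measure (H `&` `]x, y])).
Proof.
move=> xy.
have fin A : measurable A -> lebesgue_measure (H `&` A) \is a fin_num.
  move=> mA; rewrite ge0_fin_numE ?measure_ge0// (le_lt_trans _ Hfin)//.
  by apply: le_measure; [rewrite inE; exact: measurableI|rewrite inE|move=> ? []].
rewrite /cumul -fineD ?fin//; [|exact: measurable_itv..].
rewrite -measureU//; [|by apply: measurableI => //; exact: measurable_itv..|]; last first.
  apply/seteqP; split => // t [[_ /=]]; rewrite !in_itv/= => tx [_ /andP[xt _]].
  by move: xt; rewrite ltNge tx.
congr (fine (lebesgue_measure _)); rewrite -setIUr; congr (_ `&` _).
apply/seteqP; split => t /=; rewrite !in_itv/=.
  by move=> ty; case: leP => tx; [left|right].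
by case=> [tx|/andP[]//]; exact: le_trans xy.
Qed.

Lemma cumul_lip x y : `|cumul x - cumul y| <= `|x - y|.
Proof.
wlog xy : x y / x <= y => [h|].
  have [|yx] := orP (le_total x y); first exact: h.
  by rewrite distrC [leRHS]distrC h.
rewrite distrC (cumulE xy) addrC addKr [leRHS]distrC.
rewrite !ger0_norm ?subr_ge0 ?fine_ge0// -lee_fin fineK.
  apply: (@le_trans _ _ (lebesgue_measure (`]x, y]%classic : set R))).
    apply: le_measure => [||t []//]; rewrite inE; last exact: measurable_itv.
    by apply: measurableI => //; exact: measurable_itv.
  rewrite lebesgue_measure_itv/= lte_fin; case: ltP => // _.
  by rewrite lee_fin subr_ge0.
rewrite ge0_fin_numE ?measure_ge0// (le_lt_trans _ Hfin)//.
apply: le_measure => [||t []//]; rewrite inE//.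
by apply: measurableI => //; exact: measurable_itv.
Qed.

Lemma cumul_cst x y : (forall s, H s -> ~ (Num.min x y < s <= Num.max x y)) ->
  cumul x = cumul y.
Proof.
wlog xy : x y / x <= y => [h|].
  have [|yx] := orP (le_total x y); first exact: h.
  by rewrite minC maxC => /h ->.
move=> Hxy; rewrite (cumulE xy) (_ : _ `&` _ = set0) ?measure0 ?addr0//.
apply/seteqP; split => // s [/Hxy + /=]; rewrite in_itv/=.
by rewrite (min_idPl xy) (max_idPr xy) => /negP/negbTE ->.
Qed.

Lemma cumul_total x y : (forall s, H s -> Num.min x y < s <= Num.max x y) ->
  `|cumul x - cumul y| = fine (lebesgue_measure H).
Proof.
wlog xy : x y / x <= y => [h|].
  have [|yx] := orP (le_total x y); first exact: h.
  by rewrite minC maxC distrC => /h ->.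
move=> Hxy; rewrite distrC (cumulE xy) addrC addKr (_ : _ `&` _ = H).
  by rewrite ger0_norm// fine_ge0.
apply/seteqP; split => [s []//|s Hs]; split => //=; rewrite in_itv/=.
by have := Hxy s Hs; rewrite (min_idPl xy) (max_idPr xy).
Qed.

End Cumulative.

Section SlopeNear.
Context {R : realType} {X : pseudoMetricType R}.

(** A local Lipschitz constant of w with respect to the distance in X between
    the points of the curve, not to the parameter. *)
Definition slope_near (g : R -> X) (w : R -> R) (c t : R) : Prop :=
  exists2 e : R, 0 < e & forall u v, `|u - t| < e -> `|v - t| < e ->
    (`|w v - w u|%:E <= c%:E * edist (g u, g v))%E.

Lemma curve_continuous (g : R -> X) t : curve g -> 0 < t < 1 ->
  {for t, continuous g}.
Proof.
move=> cg t01; have o01 : open (`]0, 1[%classic : set R) by exact: itv_open.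
move: cg; rewrite /curve (continuous_open_subspace _ o01); apply.
by rewrite inE/= in_itv.
Qed.

Lemma curve_near_open (g : R -> X) t (V : set X) : curve g -> 0 < t < 1 ->
  open V -> V (g t) -> exists2 e : R, 0 < e & forall u, `|u - t| < e -> V (g u).
Proof.
move=> cg t01 oV Vt.
have /nbhs_ballP[e /= e0 he] : nbhs t (g @^-1` V).
  by apply: curve_continuous => //; exact: open_nbhs_nbhs.
by exists e => // u ut; apply: he; rewrite /ball/= distrC.
Qed.

Lemma curve_near_edist (g : R -> X) t (d : R) : curve g -> 0 < t < 1 -> 0 < d ->
  exists2 e : R, 0 < e & forall u, `|u - t| < e -> (edist (g t, g u) <= d%:E)%E.
Proof.
move=> cg t01 d0.
have /nbhs_ballP[e /= e0 he] : nbhs t (g @^-1` ball (g t) d).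
  by apply: curve_continuous => //; exact: nbhsx_ballx.
by exists e => // u ut; apply: edist_fin => //; apply: he; rewrite /ball/= distrC.
Qed.

Lemma open_edist_nbhd (V : set X) : (forall x, V x -> exists2 e : R, 0 < e &
  forall y, (edist (x, y) < e%:E)%E -> V y) -> open V.
Proof.
move=> h; rewrite openE => x /h[e e0 he]; apply/nbhs_ballP.
exists (e / 2) => /=; first by rewrite divr_gt0.
move=> y xy; apply: he; apply: (@le_lt_trans _ _ (e / 2)%:E).
  by apply: edist_fin => //; rewrite divr_gt0.
by rewrite lte_fin gtr_pMr// invf_lt1// ltr1n.
Qed.

Lemma open_edist_nbhdP (V : set X) : open V -> forall x, V x -> exists2 e : R, 0 < e &
  forall y, (edist (x, y) < e%:E)%E -> V y.
Proof.
rewrite openE => oV x /oV /nbhs_ballP[e /= e0 he]; exists e => // y xy.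
by apply: he; exact: (@edist_lt_ball _ _ e (x, y)).
Qed.

End SlopeNear.

Section Arithmetic.
Context {R : realType}.

Let away (w u v y s eps eta : R) : `|w - y| <= eps -> `|u - w| < eta ->
  `|v - w| < eta -> eps + eta <= `|y - s| ->
  ~ (Num.min v u < s <= Num.max v u).
Proof.
move=> wy uw vw ys /andP[].
rewrite gt_min le_max => /orP h3 /orP h4.
have sw : `|s - w| < eta.
  move: uw vw; rewrite !ltr_norml => /andP[? ?] /andP[? ?].
  by apply/andP; case: h3; case: h4 => ? ?; split; lra.
have := ler_normD (y - w) (w - s); rewrite subrKA.
by rewrite (distrC y w) (distrC w s); lra.
Qed.

Let between (fa fb wa wb d s : R) : `|wa - fa| <= d -> `|wb - fb| <= d ->
  Num.min fa fb + d < s < Num.max fa fb - d -> Num.min wb wa < s <= Num.max wb wa.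
Proof.
rewrite !ler_norml => /andP[? ?] /andP[? ?].
rewrite gt_min le_max; case: (leP fa fb) => fab /andP[h1 h2].
  by apply/andP; split; apply/orP; [right|left]; lra.
by apply/andP; split; apply/orP; [left|right]; lra.
Qed.

Context {X : pseudoMetricType R}.

(** The curve need not stay long in any single set V k. What survives in the
    limit is that, among the times at which f takes a value in H, the limit
    superior of the V k accounts for length at least the measure of H, up to
    the factor K. *)
Lemma length_in_lim_sup (f : X -> R) (V : nat -> set X) (g : R -> X)
    (a b K d : R) (kap eps : nat -> R) (w : nat -> R -> R) (H : set R) :
  (forall x y, (`|f x - f y|%:E <= edist (x, y))%E) ->
  (forall k, open (V k)) -> 0 < K -> (forall k, 0 <= kap k) ->
  kap @ \oo --> 0 -> eps @ \oo --> 0 ->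
  curve g -> 0 < a -> a <= b -> b < 1 -> (curve_length g a b < +oo)%E ->
  (forall k (t : R), 0 < t < 1 -> `|w k t - f (g t)| <= eps k) ->
  (forall k (t : R), 0 < t < 1 -> slope_near g (w k) K t) ->
  (forall k (t : R), 0 < t < 1 -> ~ V k (g t) -> slope_near g (w k) (kap k) t) ->
  closed H -> (lebesgue_measure H < +oo)%E -> 0 < d ->
  (forall s : R, H s -> Num.min (f (g a)) (f (g b)) + d < s <
                    Num.max (f (g a)) (f (g b)) - d) ->
  exists S : set R, [/\ measurable S,
    S `<=` `[0, fine (curve_length g a b)],
    (lebesgue_measure H <= K%:E * lebesgue_measure S)%E &
    forall t, S t -> let x := arclength_param g a b t in
      lim_sup_set V x /\ H (f x)].
Proof.
move=> f1 oV K0 kap0 kapcv epscv cg a0 ab b1 lfin weps wK wkap cH Hfin d0 Hab.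
have mH : measurable H by exact: closed_measurable.
set l := fine _.
have l0 : 0 <= l by rewrite fine_ge0// curve_length_ge0.
(* When f is not within e k of H, the values of w k stay off H locally and
   cumul H \o w k is locally constant; so V k may be intersected with O k. *)
pose e k : R := eps k + k.+1%:R^-1.
pose O k := [set x | exists2 s, H s & `|x - s| < e k].
pose V' k := V k `&` f @^-1` O k.
have oV' k : open (V' k).
  apply: openI => //; apply: open_edist_nbhd => x [s Hs xs].
  exists (e k - `|f x - s|); first by rewrite subr_gt0.
  move=> y xy; exists s => //.
  have : `|f x - f y| < e k - `|f x - s| by rewrite -lte_fin (le_lt_trans (f1 x y)).
  have := ler_normD (f y - f x) (f x - s); rewrite subrKA => h.
  by rewrite (distrC (f x) (f y)); lra.
have [cu1 cu2] := (cumul_lip mH Hfin, cumul_cst mH Hfin).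
pose T k : set R := `[0, l] `&` [set t | V' k (arclength_param g a b t)].
have mT k : measurable (T k) by exact: measurable_arclength_preimage.
have inc k : `|cumul H (w k b) - cumul H (w k a)| <=
    K * fine (lebesgue_measure (T k)) + kap k * l.
  apply: (increment_le_time ab lfin (V := V' k) (w := cumul H \o w k)); [exact: ltW|by []|exact: mT|].
  move=> t /andP[ta tb].
  have t01 : 0 < t < 1 by rewrite (lt_le_trans a0 ta) (le_lt_trans tb b1).
  have [e1 e10 he1] := wK k t t01.
  have [[Vt Ot]|nV] := pselect (V' k (g t)).
    have [e2 e20 he2] := curve_near_open cg t01 (oV' k) (conj Vt Ot).
    exists (Num.min e1 e2); first by rewrite lt_min e10.
    left => u v au uv vb; rewrite !lt_min => /andP[u1 u2] /andP[v1 v2]; split.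
      move=> z /andP[uz zv]; apply: he2.
      by move: u2 v2; rewrite !ltr_norml => /andP[? ?] /andP[? ?]; apply/andP; split; lra.
    apply: le_trans (he1 _ _ u1 v1).
    by rewrite lee_fin cu1.
  have [Vt|nVt] := pselect (V k (g t)); last first.
    have [e2 e20 he2] := wkap k t t01 nVt.
    exists e2 => //; right => u v au uv vb u2 v2.
    by apply: le_trans (he2 _ _ u2 v2); rewrite lee_fin cu1.
  have nO s : H s -> e k <= `|f (g t) - s|.
    by move=> Hs; rewrite leNgt; apply/negP => fs; apply: nV; split => //; exists s.
  pose eta : R := k.+1%:R^-1; have eta0 : 0 < eta by rewrite invr_gt0 ltr0n.
  have [e2 e20 he2] := curve_near_edist cg t01 (divr_gt0 eta0 (mulr_gt0 (ltr0n R 2) K0)).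
  have wnear u : `|u - t| < Num.min e1 e2 -> `|w k u - w k t| < eta.
    rewrite lt_min => /andP[u1 u2]; rewrite -lte_fin.
    apply: (@le_lt_trans _ _ (K%:E * (eta / (2 * K))%:E)%E).
      apply: (le_trans (he1 t u _ u1)); first by rewrite subrr normr0.
      by apply: lee_wpmul2l; [rewrite lee_fin ltW|exact: he2].
    rewrite -EFinM lte_fin (_ : K * _ = eta / 2); first by lra.
    by field; rewrite gt_eqF.
  exists (Num.min e1 e2); first by rewrite lt_min e10.
  right => u v au uv vb /wnear wu /wnear wv.
  rewrite /= (cu2 (w k v) (w k u)) ?subrr ?normr0 ?mule_ge0 ?lee_fin ?edist_ge0//.
  move=> s /nO; exact: away (weps k t t01) wu wv.
have aI : 0 < a < 1 by rewrite a0 (le_lt_trans ab).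
have bI : 0 < b < 1 by rewrite b1 (lt_le_trans a0).
exists (lim_sup_set T); split.
- apply: bigcap_measurable => [|n _]; first by exists 0%N.
  by apply: bigcup_measurable.
- by move=> t /(_ 0%N I)[j _ []].
- have lfinT A : A `<=` (`[0, l]%classic : set R) -> measurable A ->
      lebesgue_measure A \is a fin_num.
    move=> Al mA; rewrite ge0_fin_numE ?measure_ge0//.
    apply: (@le_lt_trans _ _ (lebesgue_measure (`[0, l]%classic : set R))).
      by apply: le_measure; rewrite ?inE//; exact: measurable_itv.
    by rewrite lebesgue_measure_itv/=; case: ifPn => // _; exact: ltry.
  have mU n : measurable (\bigcup_(j >= n) T j) by apply: bigcup_measurable.
  have Ul n : \bigcup_(j >= n) T j `<=` (`[0, l]%classic : set R).
    by move=> t [j _ []].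
  have U0fin : (lebesgue_measure (\bigcup_(k in [set k | (0 <= k)%N]) T k) < +oo)%E.
    by rewrite -ge0_fin_numE ?measure_ge0// lfinT.
  have cvU := lim_sup_set_cvg lebesgue_measure T mT U0fin.
  have Hf : lebesgue_measure H \is a fin_num by rewrite ge0_fin_numE ?measure_ge0.
  rewrite -(fineK Hf); apply/lee_addgt0Pr => z z0.
  rewrite -leeBlDr// -lee_pdivrMl// -(cvg_lim _ cvU)//.
  apply: lime_ge; first by apply/cvg_ex; eexists; exact: cvU.
  near=> n; rewrite lee_pdivrMl// -EFinB.
  apply: (@le_trans _ _ (K%:E * lebesgue_measure (T n))%E); last first.
    apply: lee_wpmul2l; first by rewrite lee_fin ltW.
    apply: le_measure; [rewrite inE; exact: mT|rewrite inE; exact: mU|].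
    by move=> t Tt; exists n => //=.
  have Tf : lebesgue_measure (T n) \is a fin_num by apply: lfinT => // t [].
  rewrite -(fineK Tf) -EFinM lee_fin lerBlDr.
  have kz : kap n * l <= z.
    apply: (@le_trans _ _ (kap n * (l + 1))); first by rewrite ler_wpM2l//; lra.
    rewrite -ler_pdivlMr; last lra.
    apply: (le_trans (ler_norm _)); near: n.
    have := @cvgr0_norm_le _ _ _ _ _ kap kapcv; apply.
    by rewrite divr_gt0//; lra.
  apply: (@le_trans _ _ (K * fine (lebesgue_measure (T n)) + kap n * l)); last by rewrite lerD2l.
  apply: le_trans (inc n).
  rewrite -(@cumul_total _ _ mH Hfin (w n b) (w n a))//.
  have ed : eps n <= d.
    apply: (le_trans (ler_norm _)); near: n.
    by have := @cvgr0_norm_le _ _ _ _ _ eps epscv; apply.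
  move=> s /Hab; apply: between.
    by rewrite (le_trans (weps _ _ aI)).
  by rewrite (le_trans (weps _ _ bI)).
- move=> t Tt x; split.
  + move=> n _; have [j nj [_ [Vj _]]] := Tt n I; exists j => //.
  + apply: contrapT => nH.
    have : nbhs (f x) (~` H) by apply: open_nbhs_nbhs; split => //; exact: closed_openC.
    move=> /nbhs_ballP[z /= z0 hz].
    have [n hn] : exists n, forall k, (n <= k)%N -> e k < z.
      have ecv : e @ \oo --> 0.
        by rewrite -[X in _ --> X]addr0; apply: cvgD => //; exact: cvg_harmonic.
      have [n _ hn] := @cvgr0_norm_lt _ _ _ _ _ e ecv _ z0.
      by exists n => k nk; apply: (le_lt_trans (ler_norm _)); exact: hn.
    have [j nj [_ [_ [s Hs fs]]]] := Tt n I.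
    apply: (hz s) => //; rewrite /ball/=.
    exact: lt_trans fs (hn _ nj).
Unshelve. all: by end_near.
Qed.

End Arithmetic.

Section ModulusNonconstant.
Context {R : realType} {X : pseudoPMetricType R}.

Lemma measurable_borel_open (A : set X) : open A -> measurable (A : set (borel X)).
Proof. exact: sub_sigma_algebra. Qed.

Lemma measurable_borel_lip (f : X -> R) :
  (forall x y, (`|f x - f y|%:E <= edist (x, y))%E) ->
  measurable_fun [set: borel X] (f : borel X -> R).
Proof.
move=> f1; apply: (measurability _ (RGenOInfty.measurableE R)).
move=> _ [_ [r ->] <-]; rewrite setTI; apply: measurable_borel_open.
apply: open_edist_nbhd => x; rewrite /= in_itv/= andbT => rx.
exists (f x - r); first by rewrite subr_gt0.
move=> y xy; rewrite /= in_itv/= andbT.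
have : `|f x - f y| < f x - r by rewrite -lte_fin (le_lt_trans (f1 x y)).
by rewrite ltr_norml => /andP[? ?]; lra.
Qed.

(** A single real-valued density serves all curves on which f is not constant:
    it lives on the null limit superior of the sets V k, and it takes on each
    of the disjoint sets H m of values of f the constant that makes the time
    spent there count for 1. Since every interval contains some H m, no curve
    escapes. The constants are unbounded, as they must be: the range of f along
    a curve can be arbitrarily short. *)
Lemma modulus_nonconstant_eq0 (m : nat) (p : R) (f : X -> R) (V : nat -> set X)
    (D : set X) (G : set (R -> X)) (K : R) (kap eps : nat -> R) :
  1 <= p -> (forall x y, (`|f x - f y|%:E <= edist (x, y))%E) ->
  (forall k, open (V k)) -> closed D ->
  hausdorff m.+1 (lim_sup_set V `&` D) = 0%E ->
  0 < K -> (forall k, 0 <= kap k) -> kap @ \oo --> 0 -> eps @ \oo --> 0 ->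
  (forall g, G g -> [/\ curve g, forall t : R, 0 < t < 1 -> D (g t),
     exists s t : R, [/\ 0 < s < 1, 0 < t < 1 & f (g s) <> f (g t)] &
     forall k, exists w, [/\ forall t : R, 0 < t < 1 -> `|w t - f (g t)| <= eps k,
       forall t : R, 0 < t < 1 -> slope_near g w K t &
       forall t : R, 0 < t < 1 -> ~ V k (g t) -> slope_near g w (kap k) t]]) ->
  modulus m.+1 p G = 0%E.
Proof.
move=> p1 f1 oV cD null K0 kap0 kapcv epscv hG.
apply/eqP; rewrite eq_le; apply/andP; split; last first.
  apply: le_ereal_inf_tmp => _ [rho _ <-].
  by apply: integral_hausdorff_ge0 => x; exact: powR_ge0.
have [H [cH tH Hpos Hitv]] := @dense_disjoint_fat_sets R.
have mH j : measurable (H j) by exact: closed_measurable.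
pose c j : R := K / fine (lebesgue_measure (H j)).
have Hfin j : lebesgue_measure (H j) \is a fin_num.
  by rewrite ge0_fin_numE ?measure_ge0//; case/andP: (Hpos j).
have Hgt0 j : 0 < fine (lebesgue_measure (H j)).
  by rewrite -lte_fin fineK//; case/andP: (Hpos j).
have c0 j : 0 <= c j by rewrite divr_ge0// ltW.
pose theta (x : R) := if pselect (exists j, H j x) is left h
  then c (projT1 (cid h)) else 0.
have thetaE j x : H j x -> theta x = c j.
  move=> Hjx; rewrite /theta; case: pselect => [h|[]]; last by exists j.
  by congr c; apply: tH => //; exists x; split => //; exact: (projT2 (cid h)).
have theta0 x : 0 <= theta x by rewrite /theta; case: pselect.
have mtheta : measurable_fun [set: R] theta.
  move=> _ Y mY; rewrite setTI.
  rewrite (_ : _ @^-1` _ = \bigcup_(j in [set j | Y (c j)]) H j `|`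
     (if pselect (Y 0) then ~` (\bigcup_j H j) else set0)); last first.
    apply/seteqP; split => [x /= Yx|x [[j /= Yj /thetaE tx]|]].
    - have [[j Hj]|nH] := pselect (exists j, H j x).
        by left; exists j => //=; rewrite -(thetaE j x).
      right; move: Yx; rewrite /theta; case: pselect => // _ Y0.
      by case: pselect => // _ [j _ Hj]; apply: nH; exists j.
    - by rewrite /= tx.
    - case: pselect => // Y0 /= nH; rewrite /theta; case: pselect => // -[j Hj].
      by case: nH; exists j.
  apply: measurableU; first exact: bigcup_measurable.
  case: pselect => Y0; last exact: measurable0.
  by apply: measurableC; exact: bigcupT_measurable.
pose B := lim_sup_set V `&` D.
have mB : measurable (B : set (borel X)).
  apply: measurableI.
    apply: bigcap_measurable => [|n _]; first by exists 0%N.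
    by apply: bigcup_measurable => j _; exact: measurable_borel_open.
  rewrite -[D]setCK; apply: measurableC; apply: measurable_borel_open.
  exact: closed_openC.
pose rho (x : X) := theta (f x) * \1_B x.
have rho0 x : 0 <= rho x by rewrite mulr_ge0.
apply: ereal_inf_lbound; exists rho; last first.
  apply: (integral_null_eq0 (B := B) (f := fun x => rho x `^ p)) => // [x|x Bx].
    exact: powR_ge0.
  by rewrite /rho indicE memNset// mulr0 powR0// gt_eqF// (lt_le_trans _ p1).
split => //.
  apply: measurable_funM; first exact: (measurableT_comp mtheta (measurable_borel_lip f1)).
  exact: measurable_indic.
move=> g Gg lr; have [cg Dg [s0 [t0 [s01 t01 fst]]] hw] := hG g Gg.
have [s [t [/andP[s0' _] st /andP[_ t1] fne]]] : exists s t : R,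
    [/\ 0 < s < 1, s <= t, 0 < t < 1 & f (g s) != f (g t)].
  have [st|/ltW ts] := leP s0 t0; first by exists s0, t0; split => //; apply/eqP.
  by exists t0, s0; split => //; rewrite eq_sym; apply/eqP.
have lfin := lr s t s0' st t1.
have /choice[w hw'] := hw.
pose lo := Num.min (f (g s)) (f (g t)); pose hi := Num.max (f (g s)) (f (g t)).
have lohi : lo < hi.
  by rewrite /lo /hi; move: fne; rewrite neq_lt; case: ltgtP.
pose d := (hi - lo) / 3; have d0 : 0 < d by rewrite divr_gt0// subr_gt0.
have [j hj] : exists j, H j `<=` `]lo + d, hi - d[ by apply: Hitv; rewrite /d; lra.
have [S [mS Sl HS hS]] : exists S : set R, [/\ measurable S,
    S `<=` `[0, fine (curve_length g s t)],
    (lebesgue_measure (H j) <= K%:E * lebesgue_measure S)%E &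
    forall t', S t' -> let x := arclength_param g s t t' in
      lim_sup_set V x /\ H j (f x)].
  apply: (@length_in_lim_sup _ _ f V g s t K d kap eps w (H j)) => //.
  - by move=> k u u01; have [/(_ u u01)] := hw' k.
  - by move=> k u u01; have [_ /(_ u u01)] := hw' k.
  - by move=> k u u01; have [_ _ /(_ u u01)] := hw' k.
  - by case/andP: (Hpos j).
apply: (@le_trans _ _ (\int[lebesgue_measure]_(u in `[0%R, fine (curve_length g s t)])
                    (rho (arclength_param g s t u))%:E)%E); last first.
  by apply: ereal_sup_ubound; exists (s, t) => //=; rewrite s0' st.
apply: (@le_trans _ _ ((c j)%:E * lebesgue_measure S)%E).
  move: HS; rewrite -(fineK (Hfin j)) -lee_pdivrMl// -EFinM => h.
  rewrite (_ : 1%E = (c j * (K^-1 * fine (lebesgue_measure (H j))))%:E).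
    by rewrite EFinM lee_wpmul2l ?lee_fin.
  by congr EFin; rewrite /c; field; rewrite !gt_eqF.
apply: le_integral_set => // u Su.
have [Vx Hx] := hS u Su.
rewrite /rho (thetaE j)// indicE mem_set ?mulr1//; split => //.
have := Sl u Su; rewrite /= in_itv/= => /andP[_ ul].
have [z /andP[sz zt] ->] := arclength_paramE st lfin ul.
by apply: Dg; rewrite (lt_le_trans s0' sz) (le_lt_trans zt t1).
Qed.

End ModulusNonconstant.

(** * Euclidean space and inner distances *)

Section EuclideanSpace.
Context {R : realType} {n : nat}.
Local Notation E := (euclid R n).
Implicit Types (x y : E) (u : nat -> E).

Lemma euclid_dist_ge0 x y : 0 <= euclid_dist x y.
Proof. exact: sqrtr_ge0. Qed.

Lemma coord_dist x y i : `|coord x i - coord y i| <= euclid_dist x y.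
Proof.
rewrite -sqrtr_sqr ler_sqrt ?sumr_ge0//; last by move=> j _; exact: sqr_ge0.
by rewrite (bigD1 i)//= lerDl sumr_ge0// => j _; exact: sqr_ge0.
Qed.

Lemma coord_edist x y i : (`|coord x i - coord y i|%:E <= edist (x, y))%E.
Proof. by rewrite edist_euclidE lee_fin coord_dist. Qed.

Lemma euclid_dist_le x y (r : R) : 0 <= r ->
  (forall i, `|coord x i - coord y i| <= r) -> euclid_dist x y <= n%:R * r.
Proof.
move=> r0 h; rewrite -(@ler_pXn2r _ 2)// ?nnegrE ?euclid_dist_ge0 ?mulr_ge0//.
rewrite sqr_sqrtr; last by apply: sumr_ge0 => i _; exact: sqr_ge0.
apply: (@le_trans _ _ (\sum_(i < n) r ^+ 2)).
  by apply: ler_sum => i _; rewrite -[leLHS]real_normK ?num_real// lerXn2r// ?nnegrE.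
rewrite sumr_const card_ord exprMn -[leLHS]mulr_natl ler_wpM2r ?sqr_ge0//.
by rewrite -natrX ler_nat; case: n => // k; rewrite leq_pmulr.
Qed.

Lemma ball_euclid x y (r : R) : ball x r y <-> euclid_dist x y < r.
Proof. by []. Qed.

Lemma euclid_cvg u x : u @ \oo --> x -> forall e : R, 0 < e ->
  exists N, forall k, (N <= k)%N -> euclid_dist (u k) x < e.
Proof.
move=> /cvg_ballP h e /h [N _ hN]; exists N => k Nk.
by rewrite euclid_dist_sym; exact: hN.
Qed.

Lemma coord_cvg u x i : u @ \oo --> x -> (fun k => coord (u k) i) @ \oo --> coord x i.
Proof.
move=> /euclid_cvg ux; apply/cvgrPdist_lt => e /ux[N hN].
by exists N => // k /= Nk; rewrite distrC (le_lt_trans (coord_dist _ _ _))// hN.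
Qed.

Lemma euclid_cauchy_cvg u :
  (forall e : R, 0 < e -> exists N, forall k l, (N <= k)%N -> (N <= l)%N ->
    euclid_dist (u k) (u l) <= e) -> u @ \oo --> limn u.
Proof.
move=> uc.
have cv i : cvgn (fun k => coord (u k) i).
  apply/cauchy_cvgP/cauchy_exP => e e0; have [N hN] := uc _ (divr_gt0 e0 (ltr0n R 2)).
  exists (coord (u N) i); exists N => // k /= Nk; rewrite /ball/=.
  by rewrite (le_lt_trans (coord_dist _ _ _))// (le_lt_trans (hN _ _ _ Nk))//; lra.
pose l : E := \row_i limn (fun k => coord (u k) i).
suff ul : u @ \oo --> l by apply/cvg_ex; exists l.
apply/cvg_ballP => e e0; have [N hN] := uc _ (divr_gt0 e0 (ltr0n R 2)).
have d2 : 0 < e / 2 / n.+1%:R by rewrite !divr_gt0.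
have hall : \forall k \near \oo, forall i, `|coord l i - coord (u k) i| <= e / 2 / n.+1%:R.
  apply: filter_forall => i; have /cvgrPdist_le/(_ _ d2) := cv i.
  have -> : coord l i = limn (fun k => coord (u k) i) by rewrite {1}/coord mxE.
  exact.
apply: filterS hall => k hk; apply/ball_euclid.
apply: (@le_lt_trans _ _ (n%:R * (e / 2 / n.+1%:R))); last first.
  apply: (@le_lt_trans _ _ (n.+1%:R * (e / 2 / n.+1%:R))).
    by rewrite ler_wpM2r ?ler_nat// ltW.
  by rewrite mulrC divfK//; lra.
by apply: euclid_dist_le => //; exact: ltW.
Qed.

End EuclideanSpace.

Section InnerDistanceEuclid.
Context {R : realType} {n : nat}.
Local Notation E := (euclid R n).
Implicit Types (x y : E) (A : set E).

Lemma euclid_le_inner_dist A x y : ((euclid_dist x y)%:E <= inner_dist A x y)%E.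
Proof.
apply: le_ereal_inf_tmp => _ [g [_ _ <- <-] <-].
by rewrite -edist_euclidE edist_le_curve_length.
Qed.

Definition segment x y (t : R) : E := \row_i ((1 - t) * coord x i + t * coord y i).

Lemma coord_segment x y t i : coord (segment x y t) i = (1 - t) * coord x i + t * coord y i.
Proof. by rewrite /coord mxE. Qed.

Lemma segment_dist x y s t :
  euclid_dist (segment x y s) (segment x y t) = `|s - t| * euclid_dist x y.
Proof.
rewrite /euclid_dist -sqrtr_sqr -sqrtrM ?sqr_ge0// mulr_sumr; congr Num.sqrt.
by apply: eq_bigr => i _; rewrite !coord_segment; ring.
Qed.

Lemma inner_dist_segment A x y : (forall t, 0 <= t <= 1 -> A (segment x y t)) ->
  (inner_dist A x y <= (euclid_dist x y)%:E)%E.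
Proof.
move=> hA; apply: (@le_trans _ _ (curve_length (segment x y) 0 1)).
  apply: ereal_inf_lbound; exists (segment x y) => //; split.
  - apply: continuous_subspaceT => t; apply/cvg_ballP => e e0.
    have d0 : 0 < euclid_dist x y + 1 by rewrite ltr_wpDl ?euclid_dist_ge0.
    near=> s; apply/ball_euclid; rewrite segment_dist.
    apply: (@le_lt_trans _ _ (`|t - s| * (euclid_dist x y + 1))).
      by rewrite ler_wpM2l//; lra.
    rewrite -ltr_pdivlMr//; near: s.
    by apply: cvgr_dist_lt; rewrite ?divr_gt0//; exact: cvg_id.
  - by move=> _ [t + <-]; rewrite /= in_itv/=; exact: hA.
  - by apply/rowP => i; rewrite mxE subr0 mul1r mul0r addr0.
  - by apply/rowP => i; rewrite mxE subrr mul1r mul0r add0r.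
apply: curve_length_le => s.
suff H a : path <%R a s ->
    (seq_variation (segment x y) a s <= ((last a s - a) * euclid_dist x y)%:E)%E.
  by move=> [ps /eqP ls]; have := H _ ps; rewrite ls subr0 mul1r.
elim: s a => [a _|z s ih a /= /andP[az zs]] /=; first by rewrite subrr mul0r.
apply: (le_trans (leeD2l _ (ih _ zs))).
rewrite edist_euclidE segment_dist -EFinD lee_fin -mulrDl distrC gtr0_norm ?subr_gt0//.
by rewrite addrC subrKA.
Unshelve. all: by end_near.
Qed.

(** Along a curve realising an inner distance less than r, every point is at
    inner distance less than r from its start; the intermediate value theorem
    finds one on a prescribed hyperplane. *)
Lemma inner_dist_crossing A x y (r z : R) i : A x ->
  (inner_dist A x y < r%:E)%E ->
  Num.min (coord x i) (coord y i) <= z <= Num.max (coord x i) (coord y i) ->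
  exists v, [/\ A v, coord v i = z & (inner_dist A x v < r%:E)%E].
Proof.
move=> Ax /ereal_inf_lt[_ [g [gc gA g0 g1] <-] gr] hz.
have cc : {within `[0, 1], continuous (fun t => coord (g t) i)}.
  apply/subspace_continuousP => t t01.
  have /subspace_continuousP/(_ t t01) gt := gc.
  apply/cvgrPdist_lt => e e0.
  move/cvg_ballP : gt => /(_ e e0); apply: filterS => s /ball_euclid.
  by apply: le_lt_trans; exact: coord_dist.
have zg : Num.min (coord (g 0) i) (coord (g 1) i) <= z <= Num.max (coord (g 0) i) (coord (g 1) i).
  by rewrite g0 g1.
have [t t01 gtz] := IVT (@ler01 R) cc zg.
have /andP[t0 t1] : 0 <= t <= 1 by move: t01; rewrite in_itv.
exists (g t); split => //; first by apply: gA; exists t.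
have [tz|tn0] := eqVneq t 0.
  rewrite tz g0 inner_distxx// (le_lt_trans _ gr)//; exact: curve_length_ge0.
have tp : 0 < t by rewrite lt_neqAle eq_sym tn0.
apply: le_lt_trans gr; apply: (@le_trans _ _ (curve_length g 0 t)); last first.
  exact: le_curve_length_itv.
have -> : curve_length g 0 t = curve_length g (t * 0) (t * 1) by rewrite mulr0 mulr1.
apply: (le_trans _ (@le_curve_length_comp _ _ (fun s => g (t * s)) g (fun s => t * s) 0 1 _ _)) => //.
  apply: ereal_inf_lbound; exists (fun s => g (t * s)) => //; split.
  - apply/subspace_continuousP => s s01.
    have s01' : `[0, 1]%classic (t * s).
      move: s01; rewrite /= !in_itv/= => /andP[? ?].
      by rewrite mulr_ge0//= mulr_ile1.
    have /subspace_continuousP/(_ _ s01') gt := gc.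
    apply: (@cvg_comp _ _ _ (fun v => t * v) g _ _ _ _ gt) => /=.
    move=> P [e /= e0 he]; exists e => //= v sv v01; apply: he => /=.
      rewrite -mulrBr normrM ger0_norm//.
      by apply: le_lt_trans sv; rewrite ler_piMl.
    move: v01; rewrite !in_itv/= => /andP[? ?].
    by rewrite mulr_ge0//= mulr_ile1.
  - move=> _ [s + <-]; rewrite /= in_itv/= => /andP[? ?]; apply: gA.
    by exists (t * s) => //; rewrite /= in_itv/= mulr_ge0//= mulr_ile1.
  - by rewrite mulr0.
  - by rewrite mulr1.
by move=> u v _ _ uv; rewrite ltr_pM2l.
Unshelve. all: by end_near.
Qed.

End InnerDistanceEuclid.

(** * Pockets in front of the slits *)

Section LipschitzMinMax.
Context {R : realType}.
Implicit Types a b c d D : R.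

Lemma min_lip a b c d D : `|a - c| <= D -> `|b - d| <= D ->
  `|Num.min a b - Num.min c d| <= D.
Proof.
rewrite !ler_norml => /andP[? ?] /andP[? ?].
by case: (leP a b) => ?; case: (leP c d) => ?; apply/andP; split; lra.
Qed.

Lemma max_lip a b c d D : `|a - c| <= D -> `|b - d| <= D ->
  `|Num.max a b - Num.max c d| <= D.
Proof.
rewrite !ler_norml => /andP[? ?] /andP[? ?].
by case: (leP a b) => ?; case: (leP c d) => ?; apply/andP; split; lra.
Qed.

End LipschitzMinMax.

(** The box [plo, phi] lies on the left of a slit, which contains its right face
    and a neighbourhood of that face in its hyperplane; play is the thickness of
    the layer along the lateral faces in which the flattening is cut off. *)
Record pocket (R : realType) (n : nat) := Pocket {
  plo : euclid R n.+1 ;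
  phi : euclid R n.+1 ;
  play : R }.

HB.instance Definition _ (R : realType) n := gen_eqMixin (pocket R n).

Section Pockets.
Context {R : realType} {n : nat}.
Local Notation E := (euclid R n.+1).
Local Notation pocket := (pocket R n).
Implicit Types (Q : pocket) (x y : E) (s : seq pocket).

(** The lateral profile of the pocket, 1 in the middle, 0 outside and linear in
    the layers of thickness play; the first coordinate does not enter. *)
Definition cutoff Q x : R := Num.max 0 (\big[Num.min/1]_(i < n.+1 | i != ord0)
  Num.min ((coord x i - coord (plo Q) i) / play Q) ((coord (phi Q) i - coord x i) / play Q)).

Lemma cutoff_ge0 Q x : 0 <= cutoff Q x.
Proof. by rewrite /cutoff le_max lexx. Qed.

Lemma cutoff_le1 Q x : cutoff Q x <= 1.
Proof. by rewrite /cutoff ge_max ler01/= bigmin_le_id. Qed.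

Lemma cutoff_lip Q x y : 0 < play Q ->
  `|cutoff Q x - cutoff Q y| <= euclid_dist x y / play Q.
Proof.
move=> e0; have D0 : 0 <= euclid_dist x y / play Q.
  by rewrite divr_ge0 ?euclid_dist_ge0// ltW.
rewrite /cutoff; apply: max_lip; first by rewrite subrr normr0.
elim/big_ind2: _ => [|a b c d|i _]; first by rewrite subrr normr0.
  exact: min_lip.
have h : `|coord x i - coord y i| / play Q <= euclid_dist x y / play Q.
  by rewrite ler_pM2r ?invr_gt0// coord_dist.
have V0 : `|(play Q)^-1| = (play Q)^-1 by rewrite gtr0_norm// invr_gt0.
apply: min_lip; rewrite -mulrBl normrM V0; apply: le_trans h.
  by rewrite ler_pM2r ?invr_gt0// le_eqVlt; apply/orP; left; apply/eqP; congr `|_|; ring.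
by rewrite ler_pM2r ?invr_gt0// distrC le_eqVlt; apply/orP; left; apply/eqP; congr `|_|; ring.
Qed.

Lemma cutoff_eq0 Q x i : 0 < play Q -> i != ord0 ->
  ~ (coord (plo Q) i < coord x i < coord (phi Q) i) -> cutoff Q x = 0.
Proof.
move=> e0 i0 xi; apply/max_idPl; apply: (bigmin_inf i) => //.
rewrite ge_min; apply/orP; have [h|h] := leP (coord x i) (coord (plo Q) i).
  by left; rewrite mulr_le0_ge0// ?subr_le0// invr_ge0 ltW.
have [h'|h'] := leP (coord (phi Q) i) (coord x i).
  by right; rewrite mulr_le0_ge0// ?subr_le0// invr_ge0 ltW.
by exfalso; apply: xi; rewrite h.
Qed.

Lemma cutoff_eq1 Q x : 0 < play Q ->
  (forall i, i != ord0 -> coord (plo Q) i + play Q <= coord x i <= coord (phi Q) i - play Q) ->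
  cutoff Q x = 1.
Proof.
move=> e0 h; apply/eqP; rewrite eq_le cutoff_le1 /cutoff le_max; apply/orP; right.
apply: le_bigmin => // i /h /andP[h1 h2].
by rewrite le_min !ler_pdivlMr// !mul1r; apply/andP; split; lra.
Qed.

Definition side_cutoff Q x : R := if coord x ord0 < coord (phi Q) ord0 then cutoff Q x else 0.

(** A curve of length less than the margin m cannot lead from one side of the
    slit to the other without leaving the support of the cutoff, hence the
    discontinuity of the cutoff across the slit is invisible to it. *)
Lemma side_cutoff_lip (A : set E) Q (m : R) x y : 0 < play Q -> A x -> A y ->
  (forall v, coord v ord0 = coord (phi Q) ord0 ->
    (forall i, i != ord0 -> coord (plo Q) i - m <= coord v i <= coord (phi Q) i + m) -> ~ A v) ->
  (inner_dist A x y < m%:E)%E ->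
  `|side_cutoff Q x - side_cutoff Q y| <= euclid_dist x y / play Q.
Proof.
move=> e0 Ax Ay wall.
have D0 u v : 0 <= euclid_dist u v / play Q by rewrite divr_ge0 ?euclid_dist_ge0// ltW.
have cross u v : A u -> (inner_dist A u v < m%:E)%E ->
    coord u ord0 < coord (phi Q) ord0 -> coord (phi Q) ord0 <= coord v ord0 ->
    cutoff Q u = 0.
  move=> Au duv u0 v0.
  have mid : Num.min (coord u ord0) (coord v ord0) <= coord (phi Q) ord0 <=
      Num.max (coord u ord0) (coord v ord0).
    by rewrite ge_min le_max v0 (ltW u0) orbT.
  have [z [Az z0 dz]] := inner_dist_crossing Au duv mid.
  have [i [i0 hi]] : exists i, i != ord0 /\
      ~ (coord (plo Q) i - m <= coord z i <= coord (phi Q) i + m).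
    apply: contrapT => h; apply: (wall z) => // i i0.
    by apply: contrapT => hi; apply: h; exists i.
  apply: (cutoff_eq0 e0 i0) => /andP[u1 u2]; apply: hi.
  have : `|coord u i - coord z i| < m.
    rewrite -lte_fin; apply: le_lt_trans dz.
    by apply: (le_trans _ (euclid_le_inner_dist _ _ _)); rewrite lee_fin coord_dist.
  by rewrite ltr_norml => /andP[? ?]; apply/andP; split; lra.
move=> dxy; rewrite /side_cutoff; case: ltP => hx; case: ltP => hy.
- exact: cutoff_lip.
- by rewrite (cross x y)// subrr normr0.
- by rewrite (cross y x) ?subrr ?normr0// inner_dist_sym.
- by rewrite subrr normr0.
Qed.

(** The first coordinate xi, made constant in front of the slits: inside a
    pocket where the cutoff is 1 the value is the coordinate of its left face.
    The cutoffs are arbitrary numbers here, as the side of a slit on which a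
    point lies is not determined by its position. *)
Definition flat_coord s (chi : pocket -> R) (xi : R) : R :=
  xi - \big[Num.max/0]_(Q <- s) (Num.max 0 (xi - coord (plo Q) ord0) * chi Q).

Let width Q := coord (phi Q) ord0 - coord (plo Q) ord0.

(** Where a cutoff does not vanish, its coefficient in the correction is at most
    the width of the pocket. Hence the variation of the cutoffs, at the rate
    1 / play, contributes at most width / play to the slope. *)
Lemma flat_coord_lip s (chi chi' : pocket -> R) (xi xi' D kap : R) :
  0 <= D -> 0 <= kap ->
  (forall Q, Q \in s -> [/\ 0 <= width Q, (0 <= chi Q <= 1) && (0 <= chi' Q <= 1),
     chi Q != 0 -> xi <= coord (phi Q) ord0,
     chi' Q != 0 -> xi' <= coord (phi Q) ord0 &
     width Q * `|chi Q - chi' Q| <= kap * D]) ->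
  `|flat_coord s chi xi - flat_coord s chi' xi'| <= 2 * `|xi - xi'| + kap * D.
Proof.
move=> D0 k0 hs.
suff : `|\big[Num.max/0]_(Q <- s) (Num.max 0 (xi - coord (plo Q) ord0) * chi Q) -
         \big[Num.max/0]_(Q <- s) (Num.max 0 (xi' - coord (plo Q) ord0) * chi' Q)|
       <= `|xi - xi'| + kap * D.
  rewrite /flat_coord; set a := \big[_/_]_(_ <- _) _; set b := \big[_/_]_(_ <- _) _ => h.
  have -> : xi - a - (xi' - b) = (xi - xi') - (a - b) by ring.
  by apply: (le_trans (ler_normB _ _)); lra.
rewrite big_seq [X in _ - X]big_seq.
elim/big_ind2: _ => [|a b c d|Q Qs].
- by rewrite subrr normr0 addr_ge0 ?mulr_ge0.
- exact: max_lip.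
have [w0 /andP[/andP[c0 c1] /andP[c0' c1']] cxi cxi' wD] := hs Q Qs.
set al := Num.max 0 _; set al' := Num.max 0 _.
have al0 : 0 <= al by rewrite le_max lexx.
have al0' : 0 <= al' by rewrite le_max lexx.
have alal : `|al - al'| <= `|xi - xi'|.
  apply: max_lip; first by rewrite subrr normr0.
  by rewrite opprB addrA subrK.
have alw : chi Q != 0 -> al <= width Q.
  by move=> /cxi h; rewrite ge_max w0 lerD2r.
have alw' : chi' Q != 0 -> al' <= width Q.
  by move=> /cxi' h; rewrite ge_max w0 lerD2r.
have [z|nz] := eqVneq (chi Q) 0.
  have [z'|nz'] := eqVneq (chi' Q) 0.
    by rewrite z z' !mulr0 subrr normr0 addr_ge0 ?mulr_ge0.
  apply: (@le_trans _ _ (kap * D)); last by rewrite lerDr.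
  apply: le_trans wD; rewrite z !mulr0 !sub0r !normrN !ger0_norm ?mulr_ge0//.
  by rewrite ler_wpM2r// alw'.
have -> : al * chi Q - al' * chi' Q = al * (chi Q - chi' Q) + (al - al') * chi' Q by ring.
apply: (le_trans (ler_normD _ _)); rewrite addrC lerD//.
  by rewrite normrM (ger0_norm c0'); apply: le_trans alal; rewrite ler_piMr.
apply: le_trans wD; rewrite normrM (ger0_norm al0) ler_wpM2r//; exact: alw.
Qed.

Lemma flat_coord_close s (chi : pocket -> R) (xi eps : R) : 0 <= eps ->
  (forall Q, Q \in s -> [/\ 0 <= width Q <= eps, 0 <= chi Q <= 1 &
     chi Q != 0 -> xi <= coord (phi Q) ord0]) ->
  `|flat_coord s chi xi - xi| <= eps.
Proof.
move=> e0 hs; rewrite /flat_coord addrAC subrr sub0r normrN big_seq.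
suff : 0 <= \big[Num.max/0]_(Q <- s | Q \in s)
    (Num.max 0 (xi - coord (plo Q) ord0) * chi Q) <= eps.
  by move=> /andP[h1 h2]; rewrite ger0_norm.
elim/big_ind: _ => [|a b /andP[a0 a1] /andP[b0 b1]|Q Qs].
- by rewrite lexx.
- by rewrite le_max a0/= ge_max a1.
have [/andP[w0 we] /andP[c0 c1] cxi] := hs Q Qs.
rewrite mulr_ge0 ?le_max ?lexx//=.
have [->|nz] := eqVneq (chi Q) 0; first by rewrite mulr0.
apply: (@le_trans _ _ (width Q)) => //.
have al : Num.max 0 (xi - coord (plo Q) ord0) <= width Q.
  by rewrite ge_max w0 lerD2r cxi.
by rewrite (le_trans (ler_wpM2r c0 al))// ler_piMr.
Qed.

Lemma flat_coord_cst s (chi : pocket -> R) (xi : R) Q : Q \in s -> chi Q = 1 ->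
  coord (plo Q) ord0 <= xi ->
  (forall Q', Q' \in s -> Q' != Q -> coord (plo Q') ord0 < xi -> chi Q' = 0) ->
  flat_coord s chi xi = coord (plo Q) ord0.
Proof.
move=> Qs cQ lxi h; rewrite /flat_coord.
suff -> : \big[Num.max/0]_(Q' <- s) (Num.max 0 (xi - coord (plo Q') ord0) * chi Q') =
    xi - coord (plo Q) ord0 by rewrite opprB addrC subrK.
apply/eqP; rewrite eq_le; apply/andP; split; last first.
  apply: (@le_trans _ _ (Num.max 0 (xi - coord (plo Q) ord0) * chi Q)); last exact: (@le_bigmax_seq _ _ _ _ _ _ xpredT (fun Q => Num.max 0 (xi - coord (plo Q) ord0) * chi Q)).
  by rewrite cQ mulr1 le_max lexx orbT.
rewrite big_seq; elim/big_ind: _ => [|a b ha hb|Q' Qs'].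
- by rewrite subr_ge0.
- by rewrite ge_max ha.
have [->|nQ] := eqVneq Q' Q; first by rewrite cQ mulr1 ge_max subr_ge0 lxi/=.
have [h1|h1] := leP xi (coord (plo Q') ord0).
  by rewrite (max_idPl _) ?mul0r ?subr_ge0// subr_le0.
by rewrite (h Q')// mulr0 subr_ge0.
Qed.

Definition apart (lo hi lo' hi' : E) : Prop :=
  exists i, coord hi i <= coord lo' i \/ coord hi' i <= coord lo i.

(** The part of the pocket where its cutoff is 1, with a margin eta, so that
    nearby points see a constant flattened coordinate. *)
Definition pocket_core (eta : R) Q : set E := [set x |
  coord (plo Q) ord0 + eta <= coord x ord0 <= coord (phi Q) ord0 - eta /\
  forall i, i != ord0 ->
    coord (plo Q) i + play Q + eta <= coord x i <= coord (phi Q) i - play Q - eta].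

Lemma near_pocket_core (eta : R) Q x y : 0 < play Q -> pocket_core eta Q x ->
  euclid_dist x y < eta ->
  [/\ coord (plo Q) ord0 < coord y ord0 < coord (phi Q) ord0, cutoff Q y = 1 &
   forall Q', 0 < play Q' -> apart (plo Q) (phi Q) (plo Q') (phi Q') ->
     coord (plo Q') ord0 < coord y ord0 <= coord (phi Q') ord0 -> cutoff Q' y = 0].
Proof.
move=> e0 [/andP[x1 x2] xi] xy.
have near i : - eta < coord x i - coord y i < eta.
  by rewrite -ltr_norml (le_lt_trans (coord_dist x y i)).
have y0 : coord (plo Q) ord0 < coord y ord0 < coord (phi Q) ord0.
  by have /andP[? ?] := near ord0; apply/andP; split; lra.
have yi i : i != ord0 -> coord (plo Q) i + play Q < coord y i < coord (phi Q) i - play Q.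
  by move=> /xi/andP[? ?]; have /andP[? ?] := near i; apply/andP; split; lra.
split => //.
  by apply: cutoff_eq1 => // i /yi/andP[? ?]; apply/andP; split; exact: ltW.
move=> Q' e0' [i hi] /andP[y1 y2].
have [i0|i0] := eqVneq i ord0.
  by move: hi y0 y1 y2; rewrite i0 => -[?|?] /andP[? ?] ? ?; exfalso; lra.
apply: (cutoff_eq0 e0' i0); have /andP[? ?] := yi i i0.
by move=> /andP[? ?]; case: hi => ?; lra.
Qed.

End Pockets.

(** * Filling the box with pockets *)

Section GridBoxes.
Variables (n N : nat).
Local Open Scope nat_scope.

Definition grid_box (st ln : 'I_n.+1 -> nat) : {set {ffun 'I_n.+1 -> 'I_N}} :=
  [set k : {ffun 'I_n.+1 -> 'I_N} | [forall i, st i <= k i < st i + ln i]].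

Lemma card_grid_box (st ln : 'I_n.+1 -> nat) : (forall i, st i + ln i <= N) ->
  #|grid_box st ln| = \prod_i ln i.
Proof.
move=> h; pose F i := [pred a : 'I_N | st i <= a < st i + ln i].
have -> : #|grid_box st ln| = #|family F|.
  by apply: eq_card => k; rewrite inE; apply/forallP/familyP.
rewrite card_family foldrE big_map big_enum; apply: eq_bigr => i _.
rewrite -[RHS]card_ord.
have lt (a : 'I_(ln i)) : st i + a < N by apply: leq_trans (h i); rewrite ltn_add2l.
have inj : injective (fun a => Ordinal (lt a)).
  by move=> a b /(congr1 val)/= /addnI/val_inj.
rewrite -(card_codom inj); apply: eq_card => a; rewrite inE.
apply/andP/codomP => [[h1 h2]|[b ->]] /=.
  have ha : a - st i < ln i by rewrite ltn_subLR.
  by exists (Ordinal ha); apply: val_inj; rewrite /= subnKC.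
by rewrite leq_addr ltn_add2l.
Qed.

End GridBoxes.

Section Covers.
Context {R : realType} {n : nat} {I : box R n}.
Variable S : slit_seq I.
Local Notation E := (euclid R n.+1).
Local Notation pocket := (pocket R n).
Implicit Types (x y : E) (t : R) (Q : pocket).

Let L (i : 'I_n.+1) : R := coord (box_hi I) i - coord (box_lo I) i.

Let L_gt0 i : 0 < L i.
Proof. by rewrite subr_gt0 box_lt. Qed.

Definition corner x t : E := \row_i (coord x i + t * L i).

Lemma coord_corner x t i : coord (corner x t) i = coord x i + t * L i.
Proof. by rewrite /coord mxE. Qed.

(** A homothetic copy of the box, so that the box itself is subdivided exactly. *)
Definition cell x t : set E :=
  [set y | forall i, coord x i <= coord y i <= coord (corner x t) i].

Definition cell_in x t : Prop := forall i,
  coord (box_lo I) i <= coord x i /\ coord (corner x t) i <= coord (box_hi I) i.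

Lemma box_size_bound : exists2 Lam : R, 0 < Lam & forall i, L i <= Lam.
Proof.
exists (\sum_i L i); first by rewrite (bigD1 ord0)//= ltr_wpDr ?sumr_ge0// => i _; exact: ltW.
by move=> i; rewrite (bigD1 i)//= lerDl sumr_ge0// => j _; exact: ltW.
Qed.

Lemma finite_lower_bound (I' : finType) (f : I' -> R) : (forall i, 0 < f i) ->
  exists2 m : R, 0 < m & forall i, m <= f i.
Proof.
move=> f0; exists (\big[Num.min/1]_i f i).
  by elim/big_ind: _ => // a b a0 b0; rewrite lt_min a0.
by move=> i; exact: bigmin_le_cond.
Qed.

(** The ball about the centre of the cell whose radius is a fixed proportion of
    t contains a slit of comparable size. *)
Lemma slit_in_cell (loc : all_locations_and_scales S) :
  exists2 lam : R, 0 < lam & forall x t, 0 < t -> cell_in x t ->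
    exists j (c : E) (l : R), [/\ lam * t <= l,
      forall v, coord v ord0 = coord c ord0 ->
        (forall i, i != ord0 -> coord c i <= coord v i <= coord c i + l) -> S j v,
      coord x ord0 + t * L ord0 / 4 <= coord c ord0 <= coord x ord0 + t * L ord0 * (3 / 4) &
      forall i, i != ord0 -> coord x i < coord c i /\
        coord c i + l < coord x i + t * L i].
Proof.
have [C C1 hC] := loc; have C0 : 0 < C by exact: lt_le_trans C1.
have [ell ell0 hell] := finite_lower_bound L_gt0.
exists (ell / 4 / C / n.+1%:R); first by rewrite !divr_gt0.
move=> x t t0 xt; pose z : E := \row_i (coord x i + t * L i / 2).
have zE i : coord z i = coord x i + t * L i / 2 by rewrite /coord mxE.
pose r := t * ell / 4; have r0 : 0 < r by rewrite divr_gt0// mulr_gt0.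
have rL i : r <= t * L i / 4 by rewrite ler_pM2r ?invr_gt0// ler_pM2l.
have near y i : ball z r y -> coord x i + t * L i / 4 < coord y i < coord x i + t * L i * (3 / 4).
  move=> /ball_euclid zy; have := le_lt_trans (coord_dist z y i) zy.
  have := rL i; rewrite zE ltr_norml => ? /andP[? ?]; apply/andP; split; lra.
have zI : ball z r `<=` open_box I.
  move=> y zy i; have /andP[h1 h2] := near y i zy; have [h3 h4] := xt i.
  have := mulr_gt0 t0 (L_gt0 i).
  by move: h4; rewrite coord_corner => h4 tL; apply/andP; split; lra.
have [j Sz rS] := hC z r r0 zI.
have [c [l [l0 SE _]]] := slitP S j.
pose v1 : E := \row_i (if i == ord0 then coord c ord0 else coord c i + l).
have v1E i : coord v1 i = if i == ord0 then coord c ord0 else coord c i + l.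
  by rewrite /coord mxE.
have Sc : S j c by rewrite SE; split => // i _; rewrite lexx/= lerDl ltW.
have Sv1 : S j v1.
  rewrite SE; split; first by rewrite v1E eqxx.
  by move=> i i0; rewrite v1E (negbTE i0) lexx andbT lerDl ltW.
exists j, c, l; split.
- have : (diam (S j) <= (n.+1%:R * l)%:E)%E.
    apply: diam_le => [|v w]; first by rewrite mulr_ge0// ltW.
    rewrite SE => -[v0 vi] [w0 wi]; rewrite edist_euclidE lee_fin.
    apply: euclid_dist_le => [|i]; first exact: ltW.
    have [->|i0] := eqVneq i ord0; first by rewrite v0 w0 subrr normr0 ltW.
    have /andP[? ?] := vi i i0; have /andP[? ?] := wi i i0.
    by rewrite ler_norml; apply/andP; split; lra.
  move=> /(le_trans rS); rewrite lee_fin /r => h.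
  have -> : ell / 4 / C / n.+1%:R * t = t * ell / 4 / C / n.+1%:R by ring.
  by rewrite ler_pdivrMr ?ltr0n// [l * _]mulrC.
- by move=> v v0 vi; rewrite SE.
- by have /andP[/ltW -> /ltW ->] := near c ord0 (Sz _ Sc).
- move=> i i0; have /andP[h1 _] := near c i (Sz _ Sc).
  have /andP[_] := near v1 i (Sz _ Sv1); rewrite v1E (negbTE i0) => h2.
  by have := mulr_gt0 t0 (L_gt0 i); split; lra.
Qed.

(** A small width keeps the flattened coordinate close to the first coordinate;
    a small ratio of the width to play makes its lateral slope small. *)
Definition valid_pocket (eps : R) Q : Prop := [/\ 0 < play Q,
  0 <= coord (phi Q) ord0 - coord (plo Q) ord0 <= eps,
  coord (phi Q) ord0 - coord (plo Q) ord0 <= eps * play Q &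
  exists j, exists2 m : R, 0 < m & forall v, coord v ord0 = coord (phi Q) ord0 ->
    (forall i, i != ord0 -> coord (plo Q) i - m <= coord v i <= coord (phi Q) i + m) ->
    S j v].

Section Subdivision.
Variable N : nat.
Hypothesis N0 : (0 < N)%N.
Implicit Type k : {ffun 'I_n.+1 -> 'I_N}.

Let NR0 : (0 : R) < N%:R.
Proof. by rewrite ltr0n. Qed.

Definition subcell x t k : E := \row_i (coord x i + (k i)%:R * (t * L i / N%:R)).

Lemma coord_subcell x t k i :
  coord (subcell x t k) i = coord x i + (k i)%:R * (t * L i / N%:R).
Proof. by rewrite /coord mxE. Qed.

Lemma coord_subcell_corner x t k i :
  coord (corner (subcell x t k) (t / N%:R)) i =
  coord x i + (k i).+1%:R * (t * L i / N%:R).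
Proof. by rewrite coord_corner coord_subcell -natr1; field; rewrite gt_eqF. Qed.

Lemma subcell_in x t k : 0 < t -> forall i,
  coord x i <= coord (subcell x t k) i /\
  coord (corner (subcell x t k) (t / N%:R)) i <= coord (corner x t) i.
Proof.
move=> t0 i; have h0 : 0 < t * L i / N%:R by rewrite divr_gt0// mulr_gt0.
split; first by rewrite coord_subcell lerDl mulr_ge0// ltW.
rewrite coord_subcell_corner coord_corner lerD2l.
apply: (@le_trans _ _ (N%:R * (t * L i / N%:R))).
  by rewrite ler_pM2r// ler_nat.
by rewrite mulrC divfK ?gt_eqF.
Qed.

Lemma subcell_cover x t y : 0 < t -> cell x t y ->
  exists k, cell (subcell x t k) (t / N%:R) y.
Proof.
move=> t0 xy; have h0 i : 0 < t * L i / N%:R by rewrite divr_gt0// mulr_gt0.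
pose a i := (coord y i - coord x i) / (t * L i / N%:R).
have a0 i : 0 <= a i.
  by rewrite divr_ge0 ?subr_ge0 ?(ltW (h0 i))//; have /andP[] := xy i.
have aN i : a i <= N%:R.
  rewrite ler_pdivrMr//; have /andP[_] := xy i; rewrite coord_corner => h.
  by rewrite mulrC divfK ?gt_eqF//; lra.
pose ka i := minn (Num.truncn (a i)) N.-1.
have kaN i : (ka i < N)%N by rewrite /ka gtn_min; apply/orP; right; rewrite prednK.
exists [ffun i => Ordinal (kaN i)] => i.
rewrite coord_subcell coord_subcell_corner ffunE /=.
have yE : coord y i = coord x i + a i * (t * L i / N%:R).
  by rewrite divfK ?gt_eqF// addrC subrK.
rewrite yE !lerD2l !ler_pM2r//; apply/andP; split.
  apply: (@le_trans _ _ (Num.truncn (a i))%:R); first by rewrite ler_nat geq_minl.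
  by rewrite truncn_le.
rewrite /ka; case: (leqP (Num.truncn (a i)) N.-1) => _.
  exact/ltW/truncnS_gt.
by rewrite prednK.
Qed.

Lemma subcell_apart x t k k' : 0 < t -> k != k' ->
  apart (subcell x t k) (corner (subcell x t k) (t / N%:R))
        (subcell x t k') (corner (subcell x t k') (t / N%:R)).
Proof.
move=> t0 kk'; have [i ki] : exists i, k i != k' i.
  apply: contrapT => h; case/eqP: kk'; apply/ffunP => i; apply/eqP.
  by apply/negPn/negP => hi; apply: h; exists i.
have h0 : 0 < t * L i / N%:R by rewrite divr_gt0// mulr_gt0.
exists i; rewrite !coord_subcell !coord_subcell_corner !lerD2l !ler_pM2r// !ler_nat.
by move: ki; rewrite -val_eqE neq_ltn => /orP[]; [left|right].
Qed.

(** A slit inside the cell provides a pocket made of cells of the grid, up to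
    those that the hyperplane of the slit cuts. The pocket touches the cells in
    T only, and contains those in G in its core; for W, and for K compared with
    d, large, G is almost all of T. *)
Lemma pocket_in_cell (eps lam ell Lam : R) (W K d : nat) x t :
  0 < eps -> 0 < ell -> (forall i, ell <= L i <= Lam) -> 0 < t <= 1 ->
  (4 * W <= N)%N -> (0 < d)%N -> (2 <= W)%N -> (2 * d + 2 <= K)%N ->
  W.+1%:R * L ord0 <= eps * d%:R * ell ->
  W.+1%:R * L ord0 <= eps * N%:R -> K.+2%:R * Lam <= lam * N%:R ->
  (exists j (c : E) (l : R), [/\ lam * t <= l,
      forall v, coord v ord0 = coord c ord0 ->
        (forall i, i != ord0 -> coord c i <= coord v i <= coord c i + l) -> S j v,
      coord x ord0 + t * L ord0 / 4 <= coord c ord0 <= coord x ord0 + t * L ord0 * (3 / 4) &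
      forall i, i != ord0 -> coord x i < coord c i /\
        coord c i + l < coord x i + t * L i]) ->
  exists Q (T G : {set {ffun 'I_n.+1 -> 'I_N}}), [/\ valid_pocket eps Q,
    forall i, coord x i <= coord (plo Q) i /\ coord (phi Q) i <= coord (corner x t) i,
    G \subset T /\ #|T| = (W.+1 * K ^ n)%N /\ #|G| = ((W - 2) * (K - (2 * d + 2)) ^ n)%N,
    forall k, k \in G -> cell (subcell x t k) (t / N%:R) `<=` pocket_core (ell * t / N%:R) Q &
    forall k, k \notin T -> apart (plo Q) (phi Q) (subcell x t k)
      (corner (subcell x t k) (t / N%:R))].
Proof.
move=> eps0 ell0 Lb /andP[t0 t1] WN d0 W2 dK cW cW' cK [j [c [l [lt Sj /andP[c1 c2] ci]]]].
pose h i := t * L i / N%:R.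
have h0 i : 0 < h i by rewrite divr_gt0// mulr_gt0.
have Nh i : N%:R * h i = t * L i by rewrite mulrC divfK ?gt_eqF.
have hell i : ell * t / N%:R <= h i.
  by rewrite ler_pM2r ?invr_gt0// mulrC ler_pM2l//; have /andP[] := Lb i.
have xc : coord x ord0 <= coord c ord0.
  by apply: le_trans c1; rewrite lerDl divr_ge0// mulr_ge0// ltW.
(* The hyperplane of the slit cuts the column jj of grid cells; p i is the
   index of the first grid line beyond the lower side of the slit. *)
pose a0 := (coord c ord0 - coord x ord0) / h ord0.
have a00 : 0 <= a0 by rewrite divr_ge0 ?subr_ge0// ltW.
have c0E : coord c ord0 = coord x ord0 + a0 * h ord0.
  by rewrite divfK ?gt_eqF// addrC subrK.
pose jj := Num.truncn a0.
have /andP[jj1 jj2] : jj%:R <= a0 < jj.+1%:R by exact: truncn_itv.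
have jjW : (W <= jj)%N.
  rewrite truncn_ge_nat// ler_pdivlMr// lerBrDl; apply: le_trans c1; rewrite lerD2l.
  rewrite ler_pdivlMr// -Nh mulrAC ler_pM2r// -natrM ler_nat mulnC//.
have jjN : (jj < N)%N.
  rewrite -(ltr_nat R); apply: (le_lt_trans jj1); rewrite ltr_pdivrMr// Nh ltrBlDl.
  by apply: (le_lt_trans c2); rewrite ltrD2l; have := mulr_gt0 t0 (L_gt0 ord0); lra.
pose a i := (coord c i - coord x i) / h i.
pose p i := (Num.truncn (a i)).+1.
have aE i : coord c i = coord x i + a i * h i by rewrite divfK ?gt_eqF// addrC subrK.
have pa i : i != ord0 -> a i < (p i)%:R <= a i + 1.
  move=> i0; have ai0 : 0 <= a i.
    by rewrite divr_ge0 ?subr_ge0 ?(ltW (h0 i))//; have [/ltW] := ci i i0.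
  by rewrite truncnS_gt/= -natr1 lerD2r truncn_le.
have Kl i : (K.+2)%:R * h i <= l.
  apply: le_trans lt; rewrite /h mulrA ler_pdivrMr// [lam * t * _]mulrAC.
  apply: (@le_trans _ _ (K.+2%:R * Lam * t)); last by rewrite ler_pM2r.
  by rewrite -mulrA [t * _]mulrC ler_pM2l// ler_pM2r//; have /andP[] := Lb i.
have pc i : i != ord0 -> coord c i < coord x i + (p i)%:R * h i.
  by move=> i0; rewrite aE ltrD2l ltr_pM2r//; have /andP[] := pa i i0.
have pl i : i != ord0 -> coord x i + (p i + K)%:R * h i < coord c i + l.
  move=> i0; apply: (@lt_le_trans _ _ (coord c i + K.+2%:R * h i)); last by rewrite lerD2l.
  rewrite aE -addrA ltrD2l -mulrDl ltr_pM2r// natrD -[K.+2]addn2 natrD.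
  by have /andP[_] := pa i i0; lra.
have pN i : i != ord0 -> (p i + K <= N)%N.
  move=> i0; rewrite -(ler_nat R) -(ler_pM2r (h0 i)) Nh -(lerD2l (coord x i)).
  by apply/ltW/(lt_trans (pl i i0)); have [] := ci i i0.
pose lo : E := \row_i (coord x i + (if i == ord0 then (jj - W)%N else p i)%:R * h i).
pose hi : E := \row_i (if i == ord0 then coord c ord0 else coord x i + (p i + K)%:R * h i).
have loE i : coord lo i = coord x i + (if i == ord0 then (jj - W)%N else p i)%:R * h i.
  by rewrite /coord mxE.
have hiE i : coord hi i = if i == ord0 then coord c ord0 else coord x i + (p i + K)%:R * h i.
  by rewrite /coord mxE.
pose Q := Pocket lo hi (d%:R * (ell * t / N%:R)).
pose T := grid_box N (fun i => if i == ord0 then jj - W else p i)%N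
                     (fun i => if i == ord0 then W.+1 else K).
pose G := grid_box N (fun i => if i == ord0 then (jj - W).+1 else p i + d.+1)%N
                     (fun i => if i == ord0 then (W - 2)%N else K - (2 * d + 2))%N.
have hl0 : 0 < ell * t / N%:R by rewrite divr_gt0// mulr_gt0.
have width : coord hi ord0 - coord lo ord0 <= W.+1%:R * h ord0.
  rewrite hiE loE eqxx /= c0E opprD addrACA subrr add0r -mulrBl ler_pM2r//.
  have -> : W.+1%:R = W%:R + 1 :> R by rewrite natr1.
  have : a0 < jj%:R + 1 by rewrite natr1.
  by rewrite natrB//; lra.
have prodE (u v : nat) : (\prod_(i < n.+1) (if i == ord0 then u else v) = u * v ^ n)%N.
  by rewrite big_ord_recl/= (eq_bigr (fun=> v))// prod_nat_const card_ord.
exists Q, T, G; split.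
- split => /=.
  + by rewrite mulr_gt0// ltr0n.
  + rewrite subr_ge0 (le_trans width) ?andbT.
      by rewrite hiE loE eqxx /= c0E lerD2l ler_pM2r// (le_trans _ jj1)// ler_nat leq_subr.
    have -> : W.+1%:R * h ord0 = W.+1%:R * L ord0 * (t / N%:R) by rewrite /h; ring.
    apply: (@le_trans _ _ (eps * N%:R * (t / N%:R))).
      by rewrite ler_pM2r// divr_gt0.
    by rewrite -mulrA [N%:R * _]mulrC divfK ?gt_eqF// ler_piMr// ltW.
  + apply: (le_trans width).
    have -> : W.+1%:R * h ord0 = W.+1%:R * L ord0 * (t / N%:R) by rewrite /h; ring.
    have -> : eps * (d%:R * (ell * t / N%:R)) = eps * d%:R * ell * (t / N%:R) by ring.
    by rewrite ler_pM2r// divr_gt0.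
  + pose f (i : 'I_n.+1) := if i == ord0 then 1 else
      Num.min (coord lo i - coord c i) (coord c i + l - coord hi i).
    have [m m0 hm] : exists2 m : R, 0 < m & forall i, m <= f i.
      apply: finite_lower_bound => i; rewrite /f; case: ifPn => // i0.
      by rewrite lt_min !subr_gt0 loE hiE (negbTE i0) pc ?pl.
    exists j, m => // v v0 vi; apply: Sj; first by rewrite v0 hiE eqxx.
    move=> i i0; have := hm i; rewrite /f (negbTE i0) le_min => /andP[? ?].
    by have /andP[? ?] := vi i i0; apply/andP; split; lra.
- move=> i /=; rewrite loE hiE coord_corner; split.
    by rewrite lerDl mulr_ge0// ltW.
  have [->|i0] := eqVneq i ord0.
    by apply: (le_trans c2); rewrite lerD2l; have := mulr_gt0 t0 (L_gt0 ord0); lra.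
  by apply/ltW/(lt_trans (pl i i0)); have [] := ci i i0.
- have GT : G \subset T.
    apply/fintype.subsetP => k; rewrite !inE => /forallP hk; apply/forallP => i.
    have := hk i; case: ifPn => _ /andP[h1 h2]; move: h1 h2 W2 dK.
      by generalize jj (nat_of_ord (k i)) => ? ?; clear; lia.
    by generalize (p i) (nat_of_ord (k i)) => ? ?; clear; lia.
  split => //; split.
    rewrite card_grid_box ?prodE// => i; case: ifPn => i0; last exact: pN.
    by move: jjW jjN; generalize jj => ?; clear; lia.
  rewrite card_grid_box ?prodE// => i; case: ifPn => i0.
    by move: jjW jjN W2; generalize jj => ?; clear; lia.
  by move: (pN i i0) dK; generalize (p i) => ?; clear; lia.
- move=> k; rewrite inE => /forallP hk y ky.
  have {}ky i : coord x i + (k i)%:R * h i <= coord y i <= coord x i + (k i).+1%:R * h i.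
    by have := ky i; rewrite coord_subcell_corner// coord_subcell.
  split => /=.
    have /andP[y1 y2] := ky ord0; have /andP[k1 k2] := hk ord0.
    rewrite /= in k1 k2.
    rewrite loE hiE eqxx /= c0E; apply/andP; split.
      apply: le_trans y1; rewrite -addrA lerD2l.
      apply: (@le_trans _ _ ((jj - W).+1%:R * h ord0)); last by rewrite ler_pM2r// ler_nat.
      by rewrite -natr1 mulrDl mul1r lerD2l hell.
    apply: (le_trans y2); rewrite -addrA lerD2l lerBrDr.
    apply: (@le_trans _ _ (jj%:R * h ord0)); last by rewrite ler_pM2r.
    apply: (@le_trans _ _ ((k ord0).+2%:R * h ord0)).
      by rewrite -[in leRHS]natr1 mulrDl mul1r lerD2l hell.
    rewrite ler_pM2r// ler_nat; move: k2 jjW W2; generalize jj (nat_of_ord (k ord0)) => ? ?; clear; lia.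
  move=> i i0; have /andP[y1 y2] := ky i; have := hk i; rewrite (negbTE i0) => /andP[k1 k2].
  have dh : d%:R * (ell * t / N%:R) + ell * t / N%:R <= d.+1%:R * h i.
    by rewrite -natr1 mulrDl mul1r lerD ?hell// ler_wpM2l.
  rewrite loE hiE (negbTE i0); apply/andP; split.
    apply: le_trans y1; rewrite -addrA -addrA lerD2l.
    apply: (@le_trans _ _ ((p i + d.+1)%:R * h i)); last by rewrite ler_pM2r// ler_nat.
    by rewrite natrD mulrDl lerD2l.
  apply: (le_trans y2); rewrite -addrA -opprD lerBrDr -addrA lerD2l.
  apply: (@le_trans _ _ (((k i).+1 + d.+1)%:R * h i)).
    by rewrite natrD mulrDl lerD2l.
  rewrite ler_pM2r// ler_nat; move: k2 dK; generalize (p i) (nat_of_ord (k i)) => ? ?; clear; lia.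
- move=> k; rewrite inE => /forallPn[i hi'].
  exists i; rewrite /= loE hiE coord_subcell_corner// coord_subcell.
  rewrite -/(h i); move: hi'; have [->|i0] := eqVneq i ord0;
    rewrite negb_and -ltnNge -leqNgt => /orP[hk|hk].
  + by right; rewrite lerD2l ler_pM2r// ler_nat.
  + left; rewrite c0E lerD2l ler_pM2r//; apply: (le_trans (ltW jj2)).
    by rewrite ler_nat; move: hk jjW; generalize jj (nat_of_ord (k ord0)) => ? ?; clear; lia.
  + by right; rewrite lerD2l ler_pM2r// ler_nat.
  + by left; rewrite lerD2l ler_pM2r// ler_nat.
Qed.

End Subdivision.
End Covers.

Arguments corner {R n} I x t.
Arguments cell {R n} I x t _.
Arguments cell_in {R n} I x t.
Arguments subcell {R n} I {N} x t k.

Lemma size_flatten_map (T' : finType) (A : Type) (F : T' -> seq A) :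
  size (flatten [seq F k | k <- enum T']) = (\sum_k size (F k))%N.
Proof.
by rewrite size_flatten /shape -map_comp sumnE big_map big_enum.
Qed.

Section Recursion.
Context {R : realType} {n : nat} {I : box R n}.
Variable S : slit_seq I.
Local Notation E := (euclid R n.+1).
Local Notation pocket := (pocket R n).
Implicit Types (x y : E) (t v : R) (Q : pocket).
Variables (N : nat) (eps ell : R) (cT cG : nat).
Hypothesis N0 : (0 < N)%N.
Hypothesis ell0 : 0 < ell.
Implicit Type k : {ffun 'I_n.+1 -> 'I_N}.

Let M : nat := (N ^ n.+1)%N.
Let NR0 : (0 : R) < N%:R.
Proof. by rewrite ltr0n. Qed.

Let cardM : #|{ffun 'I_n.+1 -> 'I_N}| = M.
Proof. by rewrite card_ffun !card_ord. Qed.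

Hypothesis step : forall x t, 0 < t <= 1 -> cell_in I x t ->
  exists Q (T G : {set {ffun 'I_n.+1 -> 'I_N}}), [/\ valid_pocket S eps Q,
    forall i, coord x i <= coord (plo Q) i /\ coord (phi Q) i <= coord (corner I x t) i,
    G \subset T /\ #|T| = cT /\ #|G| = cG,
    forall k, k \in G -> cell I (subcell I x t k) (t / N%:R) `<=` pocket_core (ell * t / N%:R) Q &
    forall k, k \notin T -> apart (plo Q) (phi Q) (subcell I x t k)
      (corner I (subcell I x t k) (t / N%:R))].

Lemma apart_sym (a b c d : E) : apart a b c d -> apart c d a b.
Proof. by move=> [i [h|h]]; exists i; [right|left]. Qed.

Lemma apart_sub (a b c d c' d' : E) : apart a b c d ->
  (forall i, coord c i <= coord c' i /\ coord d' i <= coord d i) -> apart a b c' d'.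
Proof.
move=> [i h] sub; exists i; have [h1 h2] := sub i.
by case: h => h; [left; exact: le_trans h1|right; exact: le_trans h].
Qed.

(** The assertion proved by induction on the depth m, where v bounds the
    proportion of volume left outside of the cores. *)
Definition pocket_cover (v : R) (m : nat) x t : Prop :=
  exists (s : seq pocket) (cs : seq E), [/\
    forall Q, Q \in s -> valid_pocket S eps Q /\
      forall i, coord x i <= coord (plo Q) i /\ coord (phi Q) i <= coord (corner I x t) i,
    forall Q Q', Q \in s -> Q' \in s -> Q' != Q -> apart (plo Q) (phi Q) (plo Q') (phi Q'),
    (size cs)%:R <= v * M%:R ^+ m &
    forall y, cell I x t y ->
      (exists2 Q, Q \in s & pocket_core (ell * t / N%:R ^+ m) Q y) \/
      (exists2 c, c \in cs & cell I c (t / N%:R ^+ m) y)].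

Lemma grid_cover m x t : 0 < t -> exists2 cs : seq E, size cs = (M ^ m)%N &
  forall y, cell I x t y -> exists2 c, c \in cs & cell I c (t / N%:R ^+ m) y.
Proof.
elim: m x t => [|m ih] x t t0.
  exists [:: x]; first by rewrite expn0.
  by move=> y xy; exists x; rewrite ?inE// expr0 divr1.
have /choice[f hf] : forall k : {ffun 'I_n.+1 -> 'I_N}, exists cs : seq E,
    size cs = (M ^ m)%N /\ forall y, cell I (subcell I x t k) (t / N%:R) y ->
      exists2 c, c \in cs & cell I c (t / N%:R / N%:R ^+ m) y.
  move=> k; have [cs h1 h2] := ih (subcell I x t k) (t / N%:R) (divr_gt0 t0 NR0).
  by exists cs.
exists (flatten [seq f k | k <- enum {: {ffun 'I_n.+1 -> 'I_N}}]).
  rewrite size_flatten_map (eq_bigr (fun=> M ^ m)%N) => [|k _]; last by case: (hf k).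
  by rewrite sum_nat_const cardM expnS.
move=> y /(subcell_cover N0 t0)[k] /(hf k).2[c fc cy].
exists c; last by rewrite exprS invfM mulrA.
by apply/flattenP; exists (f k) => //; apply: map_f; rewrite mem_enum.
Qed.

Lemma pocket_cover0 x t : pocket_cover 1 0 x t.
Proof.
exists [::], [:: x]; split => //; first by rewrite mul1r expr0.
by move=> y xy; right; exists x; rewrite ?inE// expr0 divr1.
Qed.

(** One step of the recursion: the cells in G are covered by the core of the new
    pocket, those in T but not in G are left without pockets, and the others
    are filled by the induction hypothesis. *)
Lemma pocket_coverS v m x t : 0 <= v -> 0 < t <= 1 -> cell_in I x t ->
  (forall x' t', 0 < t' <= 1 -> cell_in I x' t' -> pocket_cover v m x' t') ->
  pocket_cover ((cT%:R - cG%:R) / M%:R + (1 - cT%:R / M%:R) * v) m.+1 x t.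
Proof.
move=> v0 /andP[t0 t1] xt ih.
have [Q0 [T [G [vQ0 Q0x [GT [cTE cGE]] coreG apT]]]] := step (introT andP (conj t0 t1)) xt.
have tN0 : 0 < t / N%:R by rewrite divr_gt0.
have tN1 : t / N%:R <= 1.
  by rewrite ler_pdivrMr// mul1r (le_trans t1)// ler1n.
have subin k : cell_in I (subcell I x t k) (t / N%:R).
  move=> i; have [h1 h2] := xt i; have [h3 h4] := @subcell_in _ _ I _ N0 x t k t0 i.
  by split; [exact: le_trans h1 h3|exact: le_trans h4 h2].
pose w k : R := if k \in G then 0 else if k \in T then 1 else v.
have /choice[f hf] : forall k : {ffun 'I_n.+1 -> 'I_N}, exists p : seq pocket * seq E,
    [/\ k \in T -> p.1 = [::],
      forall Q, Q \in p.1 -> valid_pocket S eps Q /\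
      forall i, coord (subcell I x t k) i <= coord (plo Q) i /\
        coord (phi Q) i <= coord (corner I (subcell I x t k) (t / N%:R)) i,
      forall Q Q', Q \in p.1 -> Q' \in p.1 -> Q' != Q -> apart (plo Q) (phi Q) (plo Q') (phi Q'),
      (size p.2)%:R <= w k * M%:R ^+ m &
      forall y, cell I (subcell I x t k) (t / N%:R) y ->
       pocket_core (ell * t / N%:R) Q0 y \/
      (exists2 Q, Q \in p.1 & pocket_core (ell * (t / N%:R) / N%:R ^+ m) Q y) \/
      (exists2 c, c \in p.2 & cell I c (t / N%:R / N%:R ^+ m) y)].
  move=> k; rewrite /w; have [kG|kG] := boolP (k \in G).
    exists ([::], [::]); split => //=; first by rewrite mul0r.
    by move=> y /(coreG k kG); left.
  have [kT|kT] := boolP (k \in T).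
    have [cs h1 h2] := grid_cover m (subcell I x t k) tN0.
    exists ([::], cs); split => //=; first by rewrite h1 mul1r natrX.
    by move=> y /h2; right; right.
  have [s [cs [h1 h2 h3 h4]]] := ih _ _ (introT andP (conj tN0 tN1)) (subin k).
  by exists (s, cs); split => // y /h4; right.
exists (Q0 :: flatten [seq (f k).1 | k <- enum {: {ffun 'I_n.+1 -> 'I_N}}]),
  (flatten [seq (f k).2 | k <- enum {: {ffun 'I_n.+1 -> 'I_N}}]).
have memf Q : Q \in flatten [seq (f k).1 | k <- enum {: {ffun 'I_n.+1 -> 'I_N}}] ->
    exists k, Q \in (f k).1.
  by move=> /flattenP[s /mapP[k _ ->] Qs]; exists k.
split.
- move=> Q; rewrite inE => /predU1P[->//|/memf[k Qk]].
  have [_ /(_ Q Qk)[vQ Qsub] _ _ _] := hf k; split => // i.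
  have [h1 h2] := Qsub i; have [h3 h4] := @subcell_in _ _ I _ N0 x t k t0 i.
  by split; [exact: le_trans h3 h1|exact: le_trans h2 h4].
- have ap0 Q k : Q \in (f k).1 -> apart (plo Q0) (phi Q0) (plo Q) (phi Q).
    move=> Qk; have [kT /(_ Q Qk)[vQ Qsub] _ _ _] := hf k.
    apply: apart_sub Qsub; apply: apT; apply/negP => /kT fk.
    by rewrite fk in Qk.
  move=> Q Q'; rewrite !inE => /predU1P[->|/memf[k Qk]] /predU1P[->|/memf[k' Qk']] nQ.
  + by rewrite eqxx in nQ.
  + exact: ap0 Qk'.
  + exact/apart_sym/(ap0 _ _ Qk).
  + have [_ hk apk _ _] := hf k; have [kk'|kk'] := eqVneq k k'.
      by apply: apk => //; rewrite kk'.
    have [_ /(_ _ Qk')[_ Qsub'] _ _ _] := hf k'; have [_ Qsub] := hk _ Qk.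
    apply: apart_sub Qsub'; apply: apart_sym; apply: apart_sub Qsub; apply: apart_sym.
    exact: subcell_apart.
- rewrite size_flatten_map natr_sum.
  apply: (@le_trans _ _ (\sum_k w k * M%:R ^+ m)).
    by apply: ler_sum => k _; have [_ _ _] := hf k.
  rewrite -mulr_suml exprS mulrA ler_wpM2r ?exprn_ge0//.
  have M0 : (M%:R : R) != 0 by rewrite pnatr_eq0 -lt0n expn_gt0 N0.
  have -> : ((cT%:R - cG%:R) / M%:R + (1 - cT%:R / M%:R) * v) * M%:R =
      cT%:R - cG%:R + (M%:R - cT%:R) * v by field.
  have sumI (A : {set {ffun 'I_n.+1 -> 'I_N}}) : \sum_k (k \in A)%:R = #|A|%:R :> R.
    rewrite -sum1_card natr_sum [RHS]big_mkcond/=; apply: eq_bigr => k _.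
    by case: (k \in A).
  rewrite -cTE -cGE -!sumI -cardM -sum1_card natr_sum -!sumrB mulr_suml -big_split/=.
  rewrite le_eqVlt; apply/orP; left; apply/eqP; apply: eq_bigr => k _; rewrite /w.
  have := fintype.subsetP GT k; case: (k \in G) => [/(_ isT) ->|_]; first by rewrite subrr mul0r addr0.
  by case: (k \in T); rewrite !subr0 ?subrr ?mul0r ?addr0// add0r mul1r.
- move=> y /(subcell_cover N0 t0)[k ky]; have [_ _ _ _ /(_ y ky)] := hf k.
  have NS : N%:R ^+ m.+1 = N%:R * N%:R ^+ m :> R by rewrite exprS.
  move=> [[core0 corei]|[[Q Qk cQ]|[c ck cy]]].
  + left; exists Q0; first by rewrite inE eqxx.
    have le : ell * t / N%:R ^+ m.+1 <= ell * t / N%:R.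
      rewrite ler_wpM2l// ?mulr_ge0 ?(ltW t0) ?(ltW ell0)//.
      rewrite lef_pV2 ?posrE ?exprn_gt0// NS; apply: ler_peMr; first exact: ltW.
      by apply: exprn_ege1; rewrite ler1n.
    move: le; set e1 := _ / _; set e2 := _ / _ => le; split.
      by move: core0; rewrite -/e2 => /andP[? ?]; apply/andP; split; lra.
    by move=> i /corei; rewrite -/e2 => /andP[? ?]; apply/andP; split; lra.
  + left; exists Q; last by move: cQ; rewrite NS invfM !mulrA.
    rewrite inE; apply/orP; right; apply/flattenP; exists (f k).1 => //.
    by apply/mapP; exists k => //; rewrite mem_enum.
  + right; exists c; last by move: cy; rewrite NS invfM !mulrA.
    apply/flattenP; exists (f k).2 => //.
    by apply/mapP; exists k => //; rewrite mem_enum.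
Qed.

Lemma pocket_cover_le v v' m x t : v <= v' -> pocket_cover v m x t -> pocket_cover v' m x t.
Proof.
move=> vv' [s [cs [h1 h2 h3 h4]]]; exists s, cs; split => //.
by apply: (le_trans h3); rewrite ler_wpM2r// exprn_ge0.
Qed.

(** The proportion tau of each pocket is lost along its boundary; the part that
    no pocket has touched decreases geometrically with the depth. *)
Lemma pocket_cover_iter (tau : R) m x t : 0 <= tau -> (0 < cT <= M)%N ->
  cT%:R - cG%:R <= tau * cT%:R -> 0 < t <= 1 -> cell_in I x t ->
  pocket_cover (tau + (1 - cT%:R / M%:R) ^+ m) m x t.
Proof.
move=> tau0 /andP[cT0 cTM] ctau; elim: m x t => [|m ih] x t t01 xt.
  by apply: pocket_cover_le (pocket_cover0 x t); rewrite expr0 lerDr.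
have M0 : (0 : R) < M%:R by rewrite ltr0n (leq_trans cT0).
have th1 : 0 <= 1 - cT%:R / M%:R :> R.
  by rewrite subr_ge0 ler_pdivrMr// mul1r ler_nat.
apply: pocket_cover_le (pocket_coverS (v := tau + (1 - cT%:R / M%:R) ^+ m) _ t01 xt ih); last first.
  by rewrite addr_ge0// exprn_ge0.
have : (cT%:R - cG%:R) / M%:R <= tau * (cT%:R / M%:R).
  by rewrite mulrA ler_pM2r ?invr_gt0.
rewrite exprS; set th := cT%:R / M%:R; set q := (1 - th) ^+ m.
have -> : (1 - th) * (tau + q) = tau - tau * th + (1 - th) * q by ring.
by lra.
Qed.

End Recursion.

Section ExistsPockets.
Context {R : realType} {n : nat} {I : box R n}.
Variable S : slit_seq I.
Local Notation E := (euclid R n.+1).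
Local Notation pocket := (pocket R n).

Let L (i : 'I_n.+1) : R := coord (box_hi I) i - coord (box_lo I) i.

Let L_gt0 i : 0 < L i.
Proof. by rewrite subr_gt0 box_lt. Qed.

Lemma bernoulli_ratio (r m : nat) :
  1 - m%:R / r.+1%:R <= (r%:R / r.+1%:R) ^+ m :> R.
Proof.
set x : R := r.+1%:R^-1; have x0 : 0 <= x by rewrite invr_ge0.
have x1 : x <= 1 by rewrite invf_le1// ler1n.
have -> : r%:R / r.+1%:R = 1 - x :> R.
  by rewrite /x -natr1; field; rewrite natr1 pnatr_eq0.
elim: m => [|m ih]; first by rewrite mul0r subr0 expr0.
rewrite exprS -natr1; apply: (@le_trans _ _ ((1 - x) * (1 - m%:R * x))).
  have : 0 <= m%:R * x * x by rewrite !mulr_ge0.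
  by rewrite -/x; nra.
by rewrite ler_wpM2l// subr_ge0.
Qed.

Lemma natr_ge_ex (a : R) : exists2 k : nat, (0 < k)%N & a <= k%:R.
Proof. by exists (Num.truncn a).+1 => //; exact/ltW/truncnS_gt. Qed.

(** The loss along the boundaries of the pockets can be made an arbitrarily
    small proportion, and the part not yet touched tends to 0 with the depth. *)
Lemma exists_pockets (loc : all_locations_and_scales S) (ell eps : R) :
  0 < ell -> (forall i, ell <= L i) -> 0 < eps ->
  exists (s : seq pocket) (cs : seq E) (t : R), [/\ 0 < t <= eps,
    forall Q, Q \in s -> valid_pocket S eps Q,
    forall Q Q', Q \in s -> Q' \in s -> Q' != Q -> apart (plo Q) (phi Q) (plo Q') (phi Q'),
    (size cs)%:R * t ^+ n.+1 <= eps &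
    forall y, cell I (box_lo I) 1 y ->
      (exists2 Q, Q \in s & pocket_core (ell * t) Q y) \/
      (exists2 c, c \in cs & cell I c t y)].
Proof.
move=> ell0 hell eps0.
have [lam lam0 hlam] := slit_in_cell loc.
have [Lam _ hLam] := @box_size_bound _ _ I.
(* The width W of a pocket, counted in grid cells, is chosen first; then d, so
   that the width is small relative to play; then K, so that the lateral layers
   are a small part of the cross-section; and last the fineness N. *)
have [r0 r00 hr0] := natr_ge_ex (n.+1%:R / (eps / 2)).
pose r := r0; pose W := (3 * r + 2)%N.
have e2 : 0 < eps / 2 by rewrite divr_gt0.
have tau_le : n.+1%:R / r.+1%:R <= eps / 2 :> R.
  rewrite ler_pdivrMr// mulrC -ler_pdivrMr//; apply: (le_trans hr0).
  by rewrite ler_nat.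
have [d d0 hd] := natr_ge_ex (W.+1%:R * L ord0 / (eps * ell)).
pose K := ((2 * d + 2) * r.+1)%N.
have [N1 N10 hN1] := natr_ge_ex (W.+1%:R * L ord0 / eps).
have [N2 N20 hN2] := natr_ge_ex (K.+2%:R * Lam / lam).
pose N := (4 * W + N1 + N2 + K)%N.
have N0 : (0 < N)%N by rewrite /N; move: N10; clear; lia.
pose cT := (W.+1 * K ^ n)%N.
pose cG := ((W - 2) * (K - (2 * d + 2)) ^ n)%N.
have step (x : E) (t : R) : 0 < t <= 1 -> cell_in I x t ->
  exists Q (T G : {set {ffun 'I_n.+1 -> 'I_N}}), [/\ valid_pocket S eps Q,
    forall i, coord x i <= coord (plo Q) i /\ coord (phi Q) i <= coord (corner I x t) i,
    G \subset T /\ #|T| = cT /\ #|G| = cG,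
    forall k, k \in G -> cell I (subcell I x t k) (t / N%:R) `<=` pocket_core (ell * t / N%:R) Q &
    forall k, k \notin T -> apart (plo Q) (phi Q) (subcell I x t k)
      (corner I (subcell I x t k) (t / N%:R))].
  move=> t01 xt; have t0 : 0 < t by case/andP: t01.
  apply: (@pocket_in_cell _ _ _ _ N N0 eps lam ell Lam W K d) => //.
  - by move=> i; rewrite hell hLam.
  - by rewrite /N; clear; lia.
  - by rewrite /W addn2.
  - by rewrite /K leq_pmulr.
  - by move: hd; rewrite ler_pdivrMr ?mulr_gt0// => /le_trans; apply; rewrite mulrCA mulrA.
  - move: hN1; rewrite ler_pdivrMr// => /le_trans; apply.
    by rewrite mulrC ler_pM2l// ler_nat /N; clear; lia.
  - move: hN2; rewrite ler_pdivrMr// => /le_trans; apply.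
    by rewrite mulrC ler_pM2l// ler_nat /N; clear; lia.
  - exact: hlam.
pose M := (N ^ n.+1)%N.
have cTM : (0 < cT <= M)%N.
  rewrite /cT /M expnS muln_gt0 /= expn_gt0 leq_mul//.
  + by apply/andP; split=> //; apply/orP; left; rewrite /K muln_gt0 addn2.
  + by rewrite /N /W; clear; lia.
  + have KN : (K <= N)%N by rewrite /N; clear; lia.
    by elim: (n) => // e ih; rewrite !expnS leq_mul.
have M0 : (0 : R) < M%:R by rewrite ltr0n expn_gt0 N0.
pose tau : R := n.+1%:R / r.+1%:R.
have ctau : cT%:R - cG%:R <= tau * cT%:R.
  have : (1 - tau) * cT%:R <= cG%:R; last by lra.
  have -> : cG%:R = (r%:R / r.+1%:R) ^+ n.+1 * cT%:R :> R.
    have -> : cG = ((3 * (2 * d + 2) ^ n) * r ^ n.+1)%N.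
      rewrite /cG /W addnK /K mulnS addKn expnMn expnS; ring.
    have -> : cT = ((3 * (2 * d + 2) ^ n) * r.+1 ^ n.+1)%N.
      rewrite /cT /W /K expnMn expnS; ring.
    rewrite natrM [in RHS]natrM !natrX expr_div_n.
    have : r.+1%:R ^+ n.+1 != 0 :> R by rewrite expf_neq0.
    by move=> u0; field.
  by rewrite ler_wpM2r// bernoulli_ratio.
have tau0 : 0 <= tau by rewrite divr_ge0.
have cov m := @pocket_cover_iter _ _ _ S N eps ell cT cG N0 ell0 step tau m
  (box_lo I) 1 tau0 cTM ctau.
pose q : R := 1 - cT%:R / M%:R.
have q0 : 0 <= q by rewrite subr_ge0 ler_pdivrMr// mul1r ler_nat; case/andP: cTM.
have q1 : q < 1 by rewrite /q gtrBl divr_gt0// ltr0n; case/andP: cTM.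
have qcv : (fun m => q ^+ m) @ \oo --> (0 : R) by apply: cvg_expr; rewrite ger0_norm.
have NR0 : (0 : R) < N%:R by rewrite ltr0n.
have NR1 : (1 : R) < N%:R by rewrite ltr1n /N /W; clear; lia.
have ncv : (fun m => (N%:R^-1) ^+ m) @ \oo --> (0 : R).
  by apply: cvg_expr; rewrite ger0_norm ?invr_ge0 ?ltW// invf_lt1.
have [m1 _ hm1] := @cvgr0_norm_le _ _ _ _ _ _ qcv _ e2.
have [m2 _ hm2] := @cvgr0_norm_le _ _ _ _ _ _ ncv _ eps0.
pose m := maxn m1 m2.
have qm : q ^+ m <= eps / 2.
  by apply: (le_trans (ler_norm _)); apply: hm1; rewrite /= leq_maxl.
have nm : (N%:R^-1) ^+ m <= eps.
  by apply: (le_trans (ler_norm _)); apply: hm2; rewrite /= leq_maxr.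
have [s [cs [h1 h2 h3 h4]]] : pocket_cover S N eps ell eps m (box_lo I) 1.
  apply: pocket_cover_le (cov m _ _).
  - by apply: (le_trans (lerD tau_le qm)); lra.
  - by rewrite ltr01 lexx.
  - by move=> i; rewrite coord_corner mul1r addrC subrK.
exists s, cs, (N%:R ^+ m)^-1; split.
- by rewrite invr_gt0 exprn_gt0//= -exprVn.
- by move=> Q /h1[].
- exact: h2.
- rewrite exprVn ler_pdivrMr ?exprn_gt0//; apply: (le_trans h3).
  by rewrite natrX -!exprM mulnC.
- by move=> y /h4; rewrite mulr1 mul1r.
Qed.

End ExistsPockets.

(** * Points of the slit space *)

Section ErealLimits.
Context {R : realType}.
Implicit Types u : nat -> \bar R.

Lemma limn_lt_near u (r : \bar R) : cvgn u -> (limn u < r)%E ->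
  exists N, forall k, (N <= k)%N -> (u k < r)%E.
Proof.
move=> cu ur; have : \forall x \near limn u, (x < r)%E by exact: open_ereal_lt'.
by move=> /cu[N _ hN]; exists N.
Qed.

Lemma limn_le_near u (r : \bar R) N : cvgn u ->
  (forall k, (N <= k)%N -> (u k <= r)%E) -> (limn u <= r)%E.
Proof. by move=> cu h; apply: lime_le => //; exists N. Qed.

Lemma limn_ge_near u (r : \bar R) N : cvgn u ->
  (forall k, (N <= k)%N -> (r <= u k)%E) -> (r <= limn u)%E.
Proof. by move=> cu h; apply: lime_ge => //; exists N. Qed.

End ErealLimits.

Section SlitSpace.
Context {R : realType} {n : nat} {I : box R n}.
Variable S : slit_seq I.
Local Notation E := (euclid R n.+1).
Local Notation M := (slit_space S).
Local Notation dom := (slit_domain S).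
Implicit Types (p q : M) (i k : nat).

(** A Cauchy sequence of points of the i-th domain in the class that is the i-th
    component of p. *)
Definition rep p i k : E := sval (sval (repr (sval p i : completion _)) k).

Lemma rep_dom p i k : dom i (rep p i k).
Proof. exact: svalP (sval (repr (sval p i : completion _)) k). Qed.

Lemma edist_stageE p q i :
  edist (sval p i, sval q i) = limn (fun k => inner_dist (dom i) (rep p i k) (rep q i k)).
Proof.
rewrite edist_completionE /completion_dist /cauchy_dist; congr (limn _).
by apply/funext => k; rewrite edist_innerE.
Qed.

Lemma is_cvg_inner_rep p q i :
  cvgn (fun k => inner_dist (dom i) (rep p i k) (rep q i k)).
Proof.
have := @is_cvg_cauchy_dist _ _ (repr (sval p i : completion _)) (repr (sval q i : completion _)).
rewrite (_ : (fun k => edist _) = (fun k => inner_dist (dom i) (rep p i k) (rep q i k)))//.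
by apply/funext => k; rewrite edist_innerE.
Qed.

Lemma rep_cauchy p i (e : R) : 0 < e -> exists N, forall k l, (N <= k)%N -> (N <= l)%N ->
  (inner_dist (dom i) (rep p i k) (rep p i l) <= e%:E)%E.
Proof.
move=> e0; have [N hN] := (cauchy_seqP _).1 (svalP (repr (sval p i : completion _))) e e0.
by exists N => k l Nk Nl; have := hN k l Nk Nl; rewrite edist_innerE.
Qed.

Lemma equiv_seq_cvg (A : set E) (u v : cauchy_seqs (inner_space A)) (l : E) :
  cauchy_dist u v = 0%E -> (fun k => sval (sval u k)) @ \oo --> l ->
  (fun k => sval (sval v k)) @ \oo --> l.
Proof.
move=> d0 /euclid_cvg cu; apply/cvg_ballP => e e0; have e2 : 0 < e / 2 by rewrite divr_gt0.
have [N1 hN1] := cu _ e2.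
have [|N2 hN2] := @limn_lt_near _ _ (e / 2)%:E (@is_cvg_cauchy_dist _ _ u v).
  by rewrite -/(cauchy_dist _ _) d0 lte_fin.
exists (maxn N1 N2) => // k /=; rewrite geq_max => /andP[k1 k2]; apply/ball_euclid.
have uv : euclid_dist (sval (sval u k)) (sval (sval v k)) < e / 2.
  rewrite -lte_fin; apply: le_lt_trans (hN2 k k2).
  by rewrite edist_innerE; exact: euclid_le_inner_dist.
apply: (le_lt_trans (euclid_dist_triangle (sval (sval u k)) _ _)).
by have := hN1 k k1; rewrite euclid_dist_sym => ul; lra.
Qed.

(** The maps between the stages do not change the Euclidean limit of a sequence. *)
Lemma rep_cvg p i : rep p i @ \oo --> tau0 S p.
Proof.
have cv0 : rep p 0 @ \oo --> tau0 S p.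
  apply: (@euclid_cauchy_cvg _ _ (rep p 0)) => e e0; have [N hN] := rep_cauchy p 0 e0.
  exists N => k l Nk Nl; rewrite -lee_fin.
  exact: le_trans (euclid_le_inner_dist _ _ _) (hN k l Nk Nl).
have /eqmodP : (map_seq (nonexpansive_inner_incl (@slit_domainS _ _ _ S _ _ (leq0n i)))
    (repr (sval p i : completion _)) =
    repr (sval p 0%N : completion _) %[mod completion (inner_space (dom 0))])%qT.
  by rewrite reprK; exact: (svalP p _ _ (leq0n i)).
by rewrite /= /cauchy_equiv => /eqP; rewrite cauchy_dist_sym => /equiv_seq_cvg; apply.
Qed.

Lemma edist_stage_le p q i : (edist (sval p i, sval q i) <= edist (p, q))%E.
Proof.
rewrite edist_slit_spaceE.
have nd : {homo (fun i => edist (sval p i, sval q i)) : i j / (i <= j)%N >-> (i <= j)%E}.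
  move=> j l jl; rewrite -(svalP p _ _ jl) -(svalP q _ _ jl).
  exact: nonexpansive_tau.
rewrite (cvg_lim _ (ereal_nondecreasing_cvgn nd))//.
by apply: ereal_sup_ubound; exists i.
Qed.

Lemma edist_slit_space_le p q (r : \bar R) :
  (forall i, (edist (sval p i, sval q i) <= r)%E) -> (edist (p, q) <= r)%E.
Proof.
move=> h; rewrite edist_slit_spaceE; apply: lime_le; last exact: nearW.
exact: (is_cvg_limit_dist (@nonexpansive_tau _ _ _ S)).
Qed.

Lemma tau0_le p q : ((euclid_dist (tau0 S p) (tau0 S q))%:E <= edist (p, q))%E.
Proof.
apply: le_trans (edist_stage_le p q 0); rewrite edist_stageE.
apply/lee_addgt0Pr => e e0; rewrite -leeBlDr//.
have e2 : 0 < e / 2 by rewrite divr_gt0.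
have [N1 hN1] := euclid_cvg (@rep_cvg p 0) e2.
have [N2 hN2] := euclid_cvg (@rep_cvg q 0) e2.
apply: (@limn_ge_near _ _ _ (maxn N1 N2) (@is_cvg_inner_rep p q 0)) => k.
rewrite geq_max => /andP[k1 k2]; apply: le_trans (euclid_le_inner_dist _ _ _).
rewrite -EFinB lee_fin.
have t1 := euclid_dist_triangle (rep p 0 k) (tau0 S p) (tau0 S q).
have t2 := euclid_dist_triangle (rep q 0 k) (rep p 0 k) (tau0 S q).
have := hN1 k k1; have := hN2 k k2; rewrite (euclid_dist_sym (rep p 0 k)); lra.
Qed.

Lemma coord_tau0_le p q j :
  (`|coord (tau0 S p) j - coord (tau0 S q) j|%:E <= edist (p, q))%E.
Proof. by apply: (le_trans _ (tau0_le p q)); rewrite lee_fin coord_dist. Qed.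

Lemma tau0_cell p : cell I (box_lo I) 1 (tau0 S p).
Proof.
move=> j; rewrite coord_corner mul1r addrC subrK.
have cv := @coord_cvg _ _ _ _ j (@rep_cvg p 0).
have rI k : coord (box_lo I) j < coord (rep p 0 k) j < coord (box_hi I) j.
  by have [h _] := rep_dom p 0 k; exact: h.
have ccv : cvgn (fun k => coord (rep p 0 k) j) by apply/cvg_ex; eexists; exact: cv.
rewrite -(cvg_lim _ cv)//; apply/andP; split.
  by apply: limr_ge => //; apply: nearW => k; have /andP[/ltW] := rI k.
by apply: limr_le => //; apply: nearW => k; have /andP[_ /ltW] := rI k.
Qed.

Section Extension.
Variables (f : E -> R) (i : nat) (m K : R).
Hypothesis K0 : 0 <= K.
Hypothesis m0 : 0 < m.
Hypothesis f_lip : forall x y, dom i x -> dom i y ->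
  (inner_dist (dom i) x y < m%:E)%E -> `|f x - f y| <= K * euclid_dist x y.

(** Representing sequences are Cauchy for the inner distance, so a Lipschitz
    condition at small inner distance makes the values along them converge. *)
Definition extension p : R := limn (fun k => f (rep p i k)).

Lemma extension_cvg p : (fun k => f (rep p i k)) @ \oo --> extension p.
Proof.
apply/cauchy_cvgP/cauchy_exP => e e0.
have d0 : 0 < Num.min (m / 2) (e / 2 / (K + 1)).
  by rewrite lt_min !divr_gt0// ltr_wpDl.
have [N hN] := rep_cauchy p i d0.
exists (f (rep p i N)); exists N => // k /= Nk; rewrite /ball/=.
have h := hN N k (leqnn N) Nk.
have h1 : `|f (rep p i N) - f (rep p i k)| <= K * euclid_dist (rep p i N) (rep p i k).
  apply: f_lip; [exact: rep_dom..|].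
  apply: (le_lt_trans h); rewrite lte_fin gt_min; apply/orP; left.
  by rewrite gtr_pMr// invf_lt1// ltr1n.
have h2 : euclid_dist (rep p i N) (rep p i k) <= e / 2 / (K + 1).
  rewrite -lee_fin; apply: (le_trans (euclid_le_inner_dist (dom i) _ _)).
  by apply: (le_trans h); rewrite lee_fin ge_min lexx orbT.
apply: (le_lt_trans h1); apply: (@le_lt_trans _ _ ((K + 1) * (e / 2 / (K + 1)))).
  by apply: ler_pM => //; [exact: euclid_dist_ge0|rewrite lerDl].
by rewrite mulrC divfK ?gt_eqF ?ltr_wpDl//; lra.
Qed.

Lemma extension_lip p q : (edist (p, q) < m%:E)%E ->
  `|extension p - extension q| <= K * euclid_dist (tau0 S p) (tau0 S q).
Proof.
move=> pq; have pqi := le_lt_trans (edist_stage_le p q i) pq.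
rewrite edist_stageE in pqi.
have [N hN] := limn_lt_near (@is_cvg_inner_rep p q i) pqi.
apply/ler_addgt0Pr => e e0.
pose d := e / (2 + 2 * K); have dK : 0 < 2 + 2 * K by rewrite ltr_wpDr// mulr_ge0.
have d0 : 0 < d by rewrite divr_gt0.
have [N1 hN1] := euclid_cvg (@rep_cvg p i) d0.
have [N2 hN2] := euclid_cvg (@rep_cvg q i) d0.
have /cvgrPdist_lt/(_ _ d0)[N3 _ hN3] := @extension_cvg p.
have /cvgrPdist_lt/(_ _ d0)[N4 _ hN4] := @extension_cvg q.
pose k := maxn N (maxn (maxn N1 N2) (maxn N3 N4)).
have kN : (N <= k)%N by rewrite /k leq_maxl.
have kN1 : (N1 <= k)%N by rewrite /k !leq_max leqnn !orbT.
have kN2 : (N2 <= k)%N by rewrite /k !leq_max leqnn !orbT.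
have kN3 : (N3 <= k)%N by rewrite /k !leq_max leqnn !orbT.
have kN4 : (N4 <= k)%N by rewrite /k !leq_max leqnn !orbT.
have h1 := f_lip (rep_dom p i k) (rep_dom q i k) (hN k kN).
have h2 := hN1 k kN1; have h3 := hN2 k kN2.
have h4 := hN3 k kN3; have h5 := hN4 k kN4; rewrite /= in h4 h5.
have h6 : euclid_dist (rep p i k) (rep q i k) <= euclid_dist (tau0 S p) (tau0 S q) + 2 * d.
  have t1 := euclid_dist_triangle (tau0 S p) (rep p i k) (rep q i k).
  have t2 := euclid_dist_triangle (tau0 S q) (tau0 S p) (rep q i k).
  rewrite (euclid_dist_sym (tau0 S q)) in t2; lra.
have h7 := ler_wpM2l K0 h6.
have -> : e = 2 * d + K * (2 * d) by rewrite /d; field; rewrite gt_eqF.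
have -> : extension p - extension q = (extension p - f (rep p i k)) +
   (f (rep p i k) - f (rep q i k)) - (extension q - f (rep q i k)) by ring.
apply: (le_trans (ler_normB _ _)).
have := ler_normD (extension p - f (rep p i k)) (f (rep p i k) - f (rep q i k)); lra.
Qed.

End Extension.

End SlitSpace.

(** * The flattened coordinate along a curve *)

Lemma closed_coord_box (R : realType) n (a b : 'I_n -> R) :
  closed [set x : euclid R n | forall i, a i <= coord x i <= b i].
Proof.
rewrite -[X in closed X]setCK closedC; apply: open_edist_nbhd => x /= /existsNP[i].
move/negP; rewrite negb_and -!ltNge => /orP[h|h].
- exists (a i - coord x i); rewrite ?subr_gt0// => y; rewrite edist_euclidE lte_fin => xy.
  move=> /(_ i)/andP[h1 _]; have := le_lt_trans (coord_dist x y i) xy.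
  by rewrite ltr_norml => /andP[? ?]; lra.
- exists (coord x i - b i); rewrite ?subr_gt0// => y; rewrite edist_euclidE lte_fin => xy.
  move=> /(_ i)/andP[_ h1]; have := le_lt_trans (coord_dist x y i) xy.
  by rewrite ltr_norml => /andP[? ?]; lra.
Qed.

HB.instance Definition _ (R : realType) (n : nat) := gen_choiceMixin (pocket R n).

Section SidedCutoffs.
Context {R : realType} {n : nat} {I : box R n}.
Variable S : slit_seq I.
Local Notation E := (euclid R n.+1).
Local Notation pocket := (pocket R n).
Implicit Types (Q : pocket) (x y z : E) (s : seq pocket).

Definition off_cores (eta : R) s : set E := [set x | forall Q, Q \in s -> ~ pocket_core eta Q x].

Lemma open_off_cores eta s : open (off_cores eta s).
Proof.
have -> : off_cores eta s = ~` \bigcup_(Q in [set` s]) pocket_core eta Q.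
  apply/seteqP; split => [x h [Q Qs Qx]|x h Q Qs Qx]; first exact: (h Q).
  by apply: h; exists Q.
apply: closed_openC; apply: closed_bigcup => [|Q _]; first exact: finite_seq.
pose a (i : 'I_n.+1) := if i == ord0 then coord (plo Q) i + eta else coord (plo Q) i + play Q + eta.
pose b (i : 'I_n.+1) := if i == ord0 then coord (phi Q) i - eta else coord (phi Q) i - play Q - eta.
have -> : pocket_core eta Q = [set x | forall i, a i <= coord x i <= b i].
  apply/seteqP; split => [x [h0 hi] i|x h].
    by rewrite /a /b; case: (eqVneq i ord0) => [->//|/hi].
  split; first by have := h ord0; rewrite /a /b eqxx.
  by move=> i /negbTE i0; have := h i; rewrite /a /b i0.
exact: closed_coord_box.
Qed.

(** The value of the cutoff of Q at a point above z is the geometric one in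
    front of the slit and 0 beyond it; on the hyperplane of the slit it depends
    on the side from which the point is approached. *)
Definition sided_cutoff Q (c : R) z : Prop :=
  [/\ 0 <= c <= cutoff Q z,
      coord z ord0 < coord (phi Q) ord0 -> c = cutoff Q z &
      c != 0 -> coord z ord0 <= coord (phi Q) ord0].

Lemma sided_side_cutoff Q z : sided_cutoff Q (side_cutoff Q z) z.
Proof.
rewrite /side_cutoff; split.
- by case: ifP => _; rewrite ?cutoff_ge0 !lexx.
- by move=> ->.
- by case: ifP => [/ltW//|_]; rewrite eqxx.
Qed.

Lemma sided_cutoff_le1 Q c z : sided_cutoff Q c z -> 0 <= c <= 1.
Proof. by move=> [/andP[-> /le_trans->]//]; exact: cutoff_le1. Qed.

(** A curve of length less than m in the N-th domain that starts in such a pocket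
    cannot pass through its right face. *)
Definition walled (N : nat) (m : R) Q : Prop := 0 < play Q /\
  forall v, coord v ord0 = coord (phi Q) ord0 ->
    (forall i, i != ord0 -> coord (plo Q) i - m <= coord v i <= coord (phi Q) i + m) ->
    ~ slit_domain S N v.

Lemma walledW N N' m m' Q : (N <= N')%N -> m' <= m -> walled N m Q -> walled N' m' Q.
Proof.
move=> NN mm [p0 h]; split => // v v0 hv /(slit_domainS NN); apply: h => // i /hv /andP[? ?].
by apply/andP; split; lra.
Qed.

Lemma valid_pocket_walled (eps : R) Q : valid_pocket S eps Q ->
  exists N, exists2 m : R, 0 < m & walled N m Q.
Proof.
move=> [p0 _ _ [j [m m0 hj]]]; exists j.+1, m => //; split => // v v0 hv [_]; apply.
by exists j => /=; [exact: ltnSn|exact: hj].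
Qed.

Lemma valid_pockets_walled (eps : R) s : (forall Q, Q \in s -> valid_pocket S eps Q) ->
  exists N, exists2 m : R, 0 < m & forall Q, Q \in s -> walled N m Q.
Proof.
elim: s => [_|Q s ih hs]; first by exists 0; exists 1.
have [|N [m m0 hN]] := ih; first by move=> Q' Qs; apply: hs; rewrite inE Qs orbT.
have [N' [m' m'0 hN']] := valid_pocket_walled (hs Q (mem_head _ _)).
exists (maxn N N'); exists (Num.min m m'); first by rewrite lt_min m0.
move=> Q'; rewrite inE => /predU1P[->|/hN]; last by apply: walledW; rewrite ?leq_maxl// ge_min lexx.
by apply: walledW hN'; rewrite ?leq_maxr// ge_min lexx orbT.
Qed.

Lemma walled_side_cutoff_lip N m Q : walled N m Q -> forall x y,
  slit_domain S N x -> slit_domain S N y -> (inner_dist (slit_domain S N) x y < m%:E)%E ->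
  `|side_cutoff Q x - side_cutoff Q y| <= (play Q)^-1 * euclid_dist x y.
Proof.
move=> [p0 wall] x y Ax Ay xy; rewrite mulrC.
by apply: (@side_cutoff_lip _ _ (slit_domain S N) _ m) => //.
Qed.

End SidedCutoffs.

Section FlatCurve.
Context {R : realType} {n : nat} {I : box R n} {X : pseudoMetricType R}.
Variable S : slit_seq I.
Local Notation E := (euclid R n.+1).
Local Notation pocket := (pocket R n).
Variables (s : seq pocket) (eps eta h : R).
Variables (g : R -> X) (y : R -> E) (chi : pocket -> R -> R) (xi : R -> R).
Hypothesis eps0 : 0 < eps.
Hypothesis sV : forall Q, Q \in s -> valid_pocket S eps Q.
Hypothesis s_apart : forall Q Q', Q \in s -> Q' \in s -> Q' != Q ->
  apart (plo Q) (phi Q) (plo Q') (phi Q').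
Hypothesis gy : forall u v, ((euclid_dist (y u) (y v))%:E <= edist (g u, g v))%E.
Hypothesis chi_sided : forall Q u, Q \in s -> sided_cutoff Q (chi Q u) (y u).
Hypothesis xi_bounds : forall u, coord (y u) ord0 - h <= xi u <= coord (y u) ord0.

Definition flat_curve u : R := flat_coord s (chi^~ u) (xi u).

Lemma flat_curve_close u : `|flat_curve u - coord (y u) ord0| <= eps + h.
Proof.
have : `|flat_curve u - xi u| <= eps.
  apply: flat_coord_close => [|Q Qs]; first exact: ltW.
  have [_ w _ _] := sV Qs; split => //; first exact: sided_cutoff_le1 (chi_sided u Qs).
  have [_ _ h'] := chi_sided u Qs; move=> /h'; apply: le_trans.
  by have /andP[] := xi_bounds u.
have /andP[? ?] := xi_bounds u; rewrite !ler_norml => /andP[? ?].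
by apply/andP; split; lra.
Qed.

Definition cutoffs_slope_near t : Prop := exists2 e : R, 0 < e &
  forall Q u v, Q \in s -> `|u - t| < e -> `|v - t| < e ->
    `|chi Q u - chi Q v| <= euclid_dist (y u) (y v) / play Q.

Lemma flat_curve_slope (c t : R) : 0 <= c -> cutoffs_slope_near t ->
  slope_near g xi c t -> slope_near g flat_curve (2 * c + eps) t.
Proof.
move=> c0 [e e0 he] [e' e'0 he']; exists (Num.min e e'); first by rewrite lt_min e0.
move=> u v; rewrite !lt_min => /andP[u1 u2] /andP[v1 v2].
have D0 := euclid_dist_ge0 (y v) (y u).
have : `|flat_curve v - flat_curve u| <= 2 * `|xi v - xi u| + eps * euclid_dist (y v) (y u).
  apply: flat_coord_lip => // [|Q Qs]; first exact: ltW.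
  have [p0 /andP[w0 w1] w2 _] := sV Qs.
  have [_ _ sv] := chi_sided v Qs; have [_ _ su] := chi_sided u Qs.
  split => //.
  - by rewrite (sided_cutoff_le1 (chi_sided v Qs)) (sided_cutoff_le1 (chi_sided u Qs)).
  - by move=> /sv; apply: le_trans; have /andP[] := xi_bounds v.
  - by move=> /su; apply: le_trans; have /andP[] := xi_bounds u.
  - apply: (le_trans (ler_wpM2l w0 (he Q v u Qs v1 u1))).
    apply: (le_trans (ler_wpM2r _ w2)); first by rewrite divr_ge0 ?euclid_dist_ge0 ?(ltW p0).
    by rewrite -mulrA [play Q * _]mulrC divfK ?gt_eqF.
have := he' u v u2 v2; have := gy u v; rewrite euclid_dist_sym.
case: (edist (g u, g v)) (edist_ge0 (g u, g v)) => [d| |]// d0; last first.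
  by move=> _ _ _; rewrite gt0_muley ?leey// lte_fin ltr_wpDl// mulr_ge0.
rewrite -!EFinM !lee_fin => h1 h2 h3; apply: (le_trans h3).
have -> : (2 * c + eps) * d = 2 * (c * d) + eps * d by ring.
have := ler_wpM2l (ltW eps0) h1; lra.
Qed.

(** Nearby points lie in the same pocket, where its cutoff is 1, and in no other
    one; since h is at most half the margin, xi stays beyond the left face. *)
Lemma flat_curve_cst t (e : R) : 0 < e -> 2 * h <= eta -> 0 < eta ->
  (forall u, `|u - t| < e -> (edist (g t, g u) <= (eta / 4)%:E)%E) ->
  ~ off_cores eta s (y t) -> slope_near g flat_curve 0 t.
Proof.
move=> e0 h_eta eta0 he yt.
have [Q Qs Qy] : exists2 Q, Q \in s & pocket_core eta Q (y t).
  by apply: contrapT => hn; apply: yt => Q Qs Qy; apply: hn; exists Q.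
suff cst u : `|u - t| < e -> flat_curve u = coord (plo Q) ord0.
  by exists e => // u v ut vt; rewrite !cst// subrr normr0 mul0e.
move=> ut; have [p0 _ _ _] := sV Qs.
have tu : euclid_dist (y t) (y u) <= eta / 4.
  by rewrite -lee_fin (le_trans (gy t u))// he.
have [|/andP[y1 y2] cQ far] := near_pocket_core p0 Qy (y := y u); first lra.
have /andP[x1 x2] := xi_bounds u.
have [/andP[q1 q2] _] := Qy.
have lox : coord (plo Q) ord0 <= xi u.
  have := le_trans (coord_dist (y t) (y u) ord0) tu.
  by rewrite ler_norml => /andP[? ?]; lra.
apply: (flat_coord_cst Qs) => //.
  by have [_ -> //] := chi_sided u Qs.
move=> Q' Qs' nQ lox'; have [p0' _ _ _] := sV Qs'.
have [/andP[c0 c1] _ c2] := chi_sided u Qs'.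
have [//|/c2 yu] := eqVneq (chi Q' u) 0.
have c' : cutoff Q' (y u) = 0.
  by apply: far => //; [exact: s_apart|rewrite yu andbT (lt_le_trans lox')].
by apply/eqP; rewrite eq_le c0 -c' c1.
Qed.

End FlatCurve.

(** * A staircase below a Lipschitz function *)

Section Staircase.
Context {R : realType} {X : pseudoMetricType R}.
Variables (f : X -> R) (lo h : R).
Hypothesis f_lip : forall p q, (`|f p - f q|%:E <= edist (p, q))%E.
Hypothesis f_lo : forall p, lo <= f p.
Hypothesis h0 : 0 < h.
Implicit Types (p q u v : X) (A : set X) (j : nat).

Let edistxx p : edist (p, p) = 0%E.
Proof. by apply/edist_closeP. Qed.

(** The distance to A cut off at h; with h in the set the infimum is finite even
    if A is empty. *)
Definition clip A p : R :=
  fine (ereal_inf ([set h%:E] `|` [set edist (p, q) | q in A])).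

Let clip_bounds A p :
  (0 <= ereal_inf ([set h%:E] `|` [set edist (p, q) | q in A]) <= h%:E)%E.
Proof.
apply/andP; split; last by apply: ereal_inf_lbound; left.
by apply: le_ereal_inf_tmp => _ [->|[q _ <-]]; rewrite ?lee_fin ?(ltW h0) ?edist_ge0.
Qed.

Lemma clipE A p :
  (clip A p)%:E = ereal_inf ([set h%:E] `|` [set edist (p, q) | q in A]).
Proof.
by rewrite /clip; have := clip_bounds A p; case: (ereal_inf _) => [r| |]//=; rewrite ?leye_eq// andbC.
Qed.

Lemma clip_ge0 A p : 0 <= clip A p.
Proof. by rewrite -lee_fin clipE; have /andP[] := clip_bounds A p. Qed.

Lemma clip_le A p : clip A p <= h.
Proof. by rewrite -lee_fin clipE; have /andP[] := clip_bounds A p. Qed.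

Lemma clip_ge A p (r : R) : r <= h -> (forall q, A q -> (r%:E <= edist (p, q))%E) ->
  r <= clip A p.
Proof.
move=> rh hA; rewrite -lee_fin clipE.
by apply: le_ereal_inf_tmp => _ [->|[q Aq <-]]; rewrite ?lee_fin//; exact: hA.
Qed.

Lemma clip_eq0 A p : A p -> clip A p = 0.
Proof.
move=> Ap; apply/eqP; rewrite eq_le clip_ge0 andbT -lee_fin clipE.
by apply: ereal_inf_lbound; right; exists p => //; rewrite edistxx.
Qed.

Lemma clip_eqh A p : (forall q, A q -> (h%:E <= edist (p, q))%E) -> clip A p = h.
Proof. by move=> hA; apply/eqP; rewrite eq_le clip_le/= clip_ge. Qed.

Lemma clip_lip A p q : (`|clip A p - clip A q|%:E <= edist (p, q))%E.
Proof.
suff H u v : ((clip A u)%:E <= (clip A v)%:E + edist (u, v))%E.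
  have := H p q; have := H q p; rewrite (edist_sym q p).
  case: (edist (p, q)) (edist_ge0 (p, q)) => [d| |]// _; rewrite ?leey//.
  rewrite -!EFinD !lee_fin => ? ?; rewrite ler_norml; apply/andP; split; lra.
have uv0 := edist_ge0 (u, v).
case E : (edist (u, v)) uv0 => [d| |]// _; last by rewrite addey ?leey.
rewrite -leeBlDr// -EFinB [X in (_ <= X)%E]clipE.
apply: le_ereal_inf_tmp => _ [->|[z Az <-]].
  rewrite lee_fin; have := clip_le A u.
  have : 0 <= d by rewrite -lee_fin -E edist_ge0.
  lra.
rewrite EFinB leeBlDr// [X in (X <= _)%E]clipE.
apply: (@le_trans _ _ (edist (u, z))); first by apply: ereal_inf_lbound; right; exists z.
by rewrite addeC -E edist_triangle.
Qed.

Definition level j : R := lo + j%:R * h.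

Definition level_index p : nat := Num.truncn ((f p - lo) / h).

Definition above j : set X := [set p | level j <= f p].

Lemma levelS j : level j.+1 = level j + h.
Proof. by rewrite /level -natr1 mulrDl mul1r addrA. Qed.

Lemma level_le i j : (i <= j)%N -> level i <= level j.
Proof. by move=> ij; rewrite /level lerD2l ler_wpM2r ?ler_nat// ltW. Qed.

Lemma level_indexP p : level (level_index p) <= f p < level (level_index p).+1.
Proof.
have x0 : 0 <= (f p - lo) / h by rewrite divr_ge0 ?subr_ge0// ltW.
have /andP[h1 h2] := truncn_itv x0.
move: h1 h2; rewrite ler_pdivlMr// ltr_pdivrMr// -/(level_index p) /level => h1 h2.
by apply/andP; split; lra.
Qed.

Lemma level_index_eq p j : level j <= f p < level j.+1 -> level_index p = j.
Proof.
have /andP[h1 h2] := level_indexP p; move=> /andP[h3 h4].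
apply/eqP; rewrite eqn_leq; apply/andP; split; rewrite leqNgt; apply/negP => /level_le; lra.
Qed.

(** A substitute for f that is constant at points with no level set nearby: it
    lags behind f by at most h and climbs each step within distance h of the
    set where f has reached the next level. *)
Definition staircase p : R :=
  level (level_index p).+1 - clip (above (level_index p).+1) p.

Lemma staircase_bounds p : f p - h <= staircase p <= f p.
Proof.
have /andP[h1 h2] := level_indexP p; rewrite /staircase.
have c1 := clip_le (above (level_index p).+1) p.
apply/andP; split; first lra.
rewrite lerBlDr -lerBlDl; apply: clip_ge => [|q].
  by rewrite levelS in h2 *; lra.
move=> Aq; apply: (le_trans _ (f_lip p q)); rewrite lee_fin.
by rewrite distrC (le_trans _ (ler_norm _))// lerD2r.
Qed.

(** Near p a single formula holds on both sides of level j: above that level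
    the first clipped distance is 0, below it the second one is h. *)
Lemma staircaseE p : exists j, exists2 r : R, 0 < r & forall q, (edist (p, q) < r%:E)%E ->
  staircase q = level j.+1 - clip (above j) q - clip (above j.+1) q /\ level j <= f p < level j.+1.
Proof.
exists (level_index p); have /andP[h1 h2] := level_indexP p.
move: (level_index p) h1 h2 => j h1 h2.
exists (Num.min h (level j.+1 - f p)); first by rewrite lt_min h0 subr_gt0.
move=> q pq; rewrite h1 h2; split => //.
have : `|f p - f q| < Num.min h (level j.+1 - f p).
  by rewrite -lte_fin (le_lt_trans (f_lip p q)).
rewrite lt_min !ltr_norml => /andP[/andP[b1 b2] /andP[b3 b4]].
have [jq|qj] := leP (level j) (f q).
  rewrite /staircase (@level_index_eq q j); last by rewrite jq; lra.
  by rewrite (@clip_eq0 (above j))// subr0.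
case: j h1 h2 pq qj b3 b4 => [|j] h1 h2 pq qj b3 b4.
  by have := f_lo q; rewrite /level mul0r addr0 in qj; lra.
have qj' : level j <= f q by rewrite levelS in h1; lra.
rewrite /staircase (@level_index_eq q j); last by rewrite qj'.
rewrite (@clip_eqh (above j.+2)); first by rewrite (levelS j.+1); ring.
move=> z Az; apply: (le_trans _ (f_lip q z)); rewrite lee_fin distrC.
rewrite (le_trans _ (ler_norm _))//; move: Az; rewrite /above/= (levelS j.+1); lra.
Qed.

Lemma staircase_slope (g : R -> X) t : curve g -> 0 < t < 1 ->
  slope_near g (staircase \o g) 2 t.
Proof.
move=> cg t01; have [j [r r0 hr]] := staircaseE (g t).
have r2 : 0 < r / 2 by rewrite divr_gt0.
have [e e0 he] := curve_near_edist cg t01 r2.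
have near (u : R) : `|u - t| < e -> (edist (g t, g u) < r%:E)%E.
  by move=> /he /le_lt_trans; apply; rewrite lte_fin; lra.
exists e => // u v /near/hr[eu _] /near/hr[ev _]; rewrite /= eu ev.
set a := clip _ _; set b := clip _ _; set c := clip _ _; set d := clip _ _.
have h1 : (`|b - d|%:E <= edist (g u, g v))%E by rewrite edist_sym; exact: clip_lip.
have h2 : (`|a - c|%:E <= edist (g u, g v))%E by rewrite edist_sym; exact: clip_lip.
have -> : level j.+1 - a - b - (level j.+1 - c - d) = - ((a - c) + (b - d)) by ring.
rewrite normrN; apply: (@le_trans _ _ (`|a - c|%:E + `|b - d|%:E)%E).
  by rewrite -EFinD lee_fin ler_normD.
have := edist_ge0 (g u, g v); move: h1 h2; case: (edist _) => [x| |]// h1 h2 x0.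
  by rewrite -EFinM -EFinD lee_fin mulr_natl mulr2n; rewrite !lee_fin in h1 h2; exact: lerD.
by rewrite gt0_muley ?leey// lte_fin.
Qed.

(** The zone outside which the staircase does not climb to level j: there, either
    all points nearby are above the level, or none is. *)
Definition climb j : set X := [set p |
  (exists q, (edist (p, q) < h%:E)%E /\ f q < level j) /\
  (exists q, (edist (p, q) < (2 * h)%:E)%E /\ above j q)].

Lemma open_climb j : open (climb j).
Proof.
have H (P : set X) (r : R) : open [set p | exists q, (edist (p, q) < r%:E)%E /\ P q].
  apply: open_edist_nbhd => p [q [pq Pq]].
  have f1 : edist (p, q) \is a fin_num.
    by rewrite ge0_fin_numE ?edist_ge0// (lt_trans pq)// ltry.
  exists (r - fine (edist (p, q))); first by rewrite subr_gt0 -lte_fin fineK.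
  move=> y py; exists q; split => //; apply: (le_lt_trans (edist_triangle _ p _)).
  by rewrite (edist_sym y p) -lteBrDr// -[X in (_ - X)%E](fineK f1) -EFinB.
apply: openI; exact: H.
Qed.

Lemma staircase_cst (g : R -> X) t : curve g -> 0 < t < 1 ->
  ~ (\bigcup_j climb j) (g t) -> slope_near g (staircase \o g) 0 t.
Proof.
move=> cg t01 hW; have [j [r r0 hr]] := staircaseE (g t).
have rh : 0 < Num.min r h / 2 by rewrite divr_gt0// lt_min r0.
have [e e0 he] := curve_near_edist cg t01 rh.
suff cst (u : R) : `|u - t| < e -> staircase (g u) = level j.+1 - h.
  by exists e => // u v /cst eu /cst ev; rewrite /= eu ev subrr normr0 mul0e.
move=> /he tu.
have [m1 m2] : Num.min r h <= r /\ Num.min r h <= h by rewrite !ge_min !lexx orbT.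
have [|-> /andP[h1 h2]] := hr (g u); first by rewrite (le_lt_trans tu)// lte_fin; lra.
have tuh : (edist (g t, g u) < h%:E)%E by rewrite (le_lt_trans tu)// lte_fin; lra.
rewrite (@clip_eq0 (above j)) ?subr0.
  rewrite clip_eqh// => q Aq; rewrite leNgt; apply/negP => uq; apply: hW.
  exists j.+1 => //; split; first by exists (g t); rewrite edistxx lte_fin.
  exists q; split => //; apply: (le_lt_trans (edist_triangle _ (g u) _)).
  by rewrite mulr_natl mulr2n EFinD lteD.
rewrite /above/= leNgt; apply/negP => uj; apply: hW; exists j => //; split.
  by exists (g u).
by exists (g t); split => //; rewrite edistxx lte_fin mulr_gt0.
Qed.

End Staircase.

(** * The climbing zones in the slit space *)

Lemma convex_between (R : realType) (a b x y t : R) : a < x < b -> a < y < b ->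
  0 <= t <= 1 -> a < (1 - t) * x + t * y < b.
Proof.
move=> /andP[x1 x2] /andP[y1 y2] /andP[]; rewrite le_eqVlt => /predU1P[<- _|t0 t1].
  by rewrite subr0 mul1r mul0r addr0 x1.
have : 0 <= 1 - t by rewrite subr_ge0.
have ya : 0 < y - a by rewrite subr_gt0.
have yb : 0 < b - y by rewrite subr_gt0.
have h1 := mulr_gt0 t0 ya; have h2 := mulr_gt0 t0 yb.
by move=> t1'; apply/andP; split; nra.
Qed.

Section SlitSpaceLevels.
Context {R : realType} {n : nat} {I : box R n}.
Variable S : slit_seq I.
Local Notation E := (euclid R n.+1).
Local Notation M := (slit_space S).
Local Notation dom := (slit_domain S).
Implicit Types (p q : M) (i k : nat).

Definition height p : R := coord (tau0 S p) ord0.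

Lemma height_lip p q : (`|height p - height q|%:E <= edist (p, q))%E.
Proof. exact: coord_tau0_le. Qed.

Lemma height_lo p : coord (box_lo I) ord0 <= height p.
Proof. by have /andP[] := @tau0_cell _ _ _ S p ord0. Qed.

(** All but countably many hyperplanes orthogonal to the first axis miss the
    slits. *)
Lemma slit_free_level (a b : R) : a < b ->
  exists2 c : R, a < c < b & forall j x, S j x -> coord x ord0 <> c.
Proof.
move=> ab; have /choice[c hc] : forall i, exists c : R, forall x, S i x -> coord x ord0 = c.
  move=> i; have [c [l [_ -> _]]] := slitP S i.
  by exists (coord c ord0) => x [].
apply: contrapT => h.
have Tc : `]a, b[%classic `<=` range c.
  move=> t; rewrite /= in_itv/= => tab; apply: contrapT => ct; apply: h; exists t => //.
  by move=> j x /hc -> cj; apply: ct; exists j.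
have cT : countable (`]a, b[%classic : set R).
  by apply: (sub_countable (subset_card_le Tc)); exact: card_image_le.
have := countable_lebesgue_measure0 cT.
by rewrite lebesgue_measure_itv/= lte_fin ab -EFinB => -[] /eqP; rewrite subr_eq0 gt_eqF.
Qed.

Lemma inner_dist_level i (c : R) (x y : E) : (forall j v, S j v -> coord v ord0 <> c) ->
  dom i x -> dom i y -> coord x ord0 = c -> coord y ord0 = c ->
  (inner_dist (dom i) x y <= (euclid_dist x y)%:E)%E.
Proof.
move=> hc [Ix _] [Iy _] xc yc; apply: inner_dist_segment => t /andP[t0 t1]; split.
  by move=> j; rewrite coord_segment; apply: convex_between (Ix j) (Iy j) _; rewrite t0.
by move=> [j _ /hc]; rewrite coord_segment xc yc; apply; ring.
Qed.

Lemma cross_level p q i (c r : R) : height p < c -> c < height q ->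
  (edist (p, q) < r%:E)%E -> exists K, forall k, (K <= k)%N -> exists v,
    [/\ dom i v, coord v ord0 = c & (inner_dist (dom i) (rep p i k) v < r%:E)%E].
Proof.
move=> pc cq /(le_lt_trans (edist_stage_le p q i)).
rewrite edist_stageE => /(limn_lt_near (@is_cvg_inner_rep _ _ _ _ p q i))[N hN].
have pc0 : 0 < c - height p by rewrite subr_gt0.
have cq0 : 0 < height q - c by rewrite subr_gt0.
have [N1 hN1] := euclid_cvg (@rep_cvg _ _ _ _ p i) pc0.
have [N2 hN2] := euclid_cvg (@rep_cvg _ _ _ _ q i) cq0.
exists (maxn N (maxn N1 N2)) => k; rewrite !geq_max => /and3P[k0 k1 k2].
apply: (inner_dist_crossing _ (hN k k0)); first exact: rep_dom.
have := le_lt_trans (coord_dist _ _ ord0) (hN1 k k1).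
have := le_lt_trans (coord_dist _ _ ord0) (hN2 k k2).
rewrite -!/(height _) !ltr_norml => /andP[? ?] /andP[? ?].
by rewrite ge_min le_max; apply/andP; split; apply/orP; [left|right]; lra.
Qed.

(** In every finite stage, curves that join points near p1 and p2 to points
    beyond level j cross a common slit-free hyperplane, inside which the inner
    distance is Euclidean. Hence two points of the zone are almost as close as
    their images in the box, whatever slits lie between them. *)
Lemma climb_dist (h : R) j p1 p2 : 0 < h ->
  climb height (coord (box_lo I) ord0) h j p1 -> climb height (coord (box_lo I) ord0) h j p2 ->
  (edist (p1, p2) <= (16 * h + euclid_dist (tau0 S p1) (tau0 S p2))%:E)%E.
Proof.
move=> h0 [[a1 [pa1 az1]] [b1 [pb1 bz1]]] [[a2 [pa2 az2]] [b2 [pb2 bz2]]].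
rewrite /above/= in bz1 bz2; move: (level _ _ j) az1 az2 bz1 bz2 => z az1 az2 bz1 bz2.
have [c /andP[c1 c2] hc] : exists2 c : R, Num.max (height a1) (height a2) < c < z &
    forall j x, S j x -> coord x ord0 <> c.
  by apply: slit_free_level; rewrite gt_max az1.
move: c1; rewrite gt_max => /andP[ac1 ac2].
have ab a b p : (edist (p, a) < h%:E)%E -> (edist (p, b) < (2 * h)%:E)%E ->
    (edist (a, b) < (3 * h)%:E)%E.
  move=> pa pb; apply: (le_lt_trans (edist_triangle _ p _)); rewrite (edist_sym a p).
  by rewrite (_ : 3 * h = h + 2 * h) ?EFinD ?lteD//; ring.
have tauc (p a : M) : (edist (p, a) < h%:E)%E -> euclid_dist (tau0 S p) (tau0 S a) < h.
  by move=> pa; rewrite -lte_fin; apply: le_lt_trans pa; exact: tau0_le.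
have a12 : (edist (a1, a2) <= (14 * h + euclid_dist (tau0 S p1) (tau0 S p2))%:E)%E.
  apply: edist_slit_space_le => i; rewrite edist_stageE.
  apply/lee_addgt0Pr => e e0; have e2 : 0 < e / 2 by rewrite divr_gt0.
  have [K1 hK1] := @cross_level a1 b1 i c _ ac1 (lt_le_trans c2 bz1) (ab _ _ _ pa1 pb1).
  have [K2 hK2] := @cross_level a2 b2 i c _ ac2 (lt_le_trans c2 bz2) (ab _ _ _ pa2 pb2).
  have [N1 hN1] := euclid_cvg (@rep_cvg _ _ _ _ a1 i) e2.
  have [N2 hN2] := euclid_cvg (@rep_cvg _ _ _ _ a2 i) e2.
  apply: (@limn_le_near _ _ _ (maxn (maxn K1 K2) (maxn N1 N2)) (@is_cvg_inner_rep _ _ _ _ a1 a2 i)) => k.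
  rewrite !geq_max => /andP[/andP[k1 k2] /andP[k3 k4]].
  have [v1 [dv1 v1c d1]] := hK1 k k1; have [v2 [dv2 v2c d2]] := hK2 k k2.
  apply: (le_trans (inner_dist_triangle _ v1 _ _)).
  apply: (le_trans (leeD (ltW d1) (inner_dist_triangle _ v2 _ _))).
  rewrite inner_dist_sym in d2.
  apply: (le_trans (leeD2l _ (leeD (inner_dist_level hc dv1 dv2 v1c v2c) (ltW d2)))).
  rewrite -!EFinD lee_fin.
  have e1 : euclid_dist (rep a1 i k) v1 < 3 * h.
    by rewrite -lte_fin (le_lt_trans (euclid_le_inner_dist _ _ _) d1).
  have e3 : euclid_dist v2 (rep a2 i k) < 3 * h.
    by rewrite -lte_fin; apply: le_lt_trans d2; exact: euclid_le_inner_dist.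
  have ta1 := tauc _ _ pa1; have ta2 := tauc _ _ pa2.
  have n1 := hN1 k k3; have n2 := hN2 k k4.
  rewrite euclid_dist_sym in e1; rewrite euclid_dist_sym in ta1.
  rewrite euclid_dist_sym in n2.
  have t1 := euclid_dist_triangle (rep a1 i k) v1 v2.
  have t2 := euclid_dist_triangle (tau0 S a1) (rep a1 i k) v2.
  have t3 := euclid_dist_triangle (tau0 S p1) (tau0 S a1) v2.
  have t4 := euclid_dist_triangle (tau0 S p2) (tau0 S p1) v2.
  have t5 := euclid_dist_triangle (rep a2 i k) (tau0 S a2) v2.
  have t6 := euclid_dist_triangle (tau0 S a2) (tau0 S p2) v2.
  rewrite euclid_dist_sym in e3.
  move: (euclid_dist v1 v2) e1 e3 ta1 ta2 n1 n2 t1 t2 t3 t4 t5 t6 => D; lra.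
apply: (le_trans (edist_triangle _ a1 _)).
apply: (le_trans (leeD (ltW pa1) (edist_triangle _ a2 _))).
rewrite (edist_sym a2 p2).
apply: (le_trans (leeD2l _ (leeD a12 (ltW pa2)))).
by rewrite -!EFinD lee_fin; lra.
Qed.

End SlitSpaceLevels.

(** * The sets where the flattened coordinate varies *)

Lemma open_nonexpansive_preimage (R : realType) (X Y : pseudoMetricType R) (phi : X -> Y)
    (V : set Y) : (forall x y, (edist (phi x, phi y) <= edist (x, y))%E) ->
  open V -> open (phi @^-1` V).
Proof.
move=> phi1 oV; apply: open_edist_nbhd => x /= /(open_edist_nbhdP oV)[e e0 he].
by exists e => // y xy; apply: he; exact: le_lt_trans xy.
Qed.

Section Layers.
Context {R : realType} {n : nat} {I : box R n}.
Variable S : slit_seq I.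
Local Notation E := (euclid R n.+1).
Local Notation M := (slit_space S).
Local Notation pocket := (pocket R n).

Let L (i : 'I_n.+1) : R := coord (box_hi I) i - coord (box_lo I) i.

Let L_gt0 i : 0 < L i.
Proof. by rewrite subr_gt0 box_lt. Qed.

Let L_bound : exists2 Lam : R, 0 < Lam & forall i, L i <= Lam.
Proof. exact: box_size_bound. Qed.

(** The data of one approximation, at precision eps. *)
Definition layer (ell eps : R) (s : seq pocket) (cs : seq E) (t : R) : Prop :=
  [/\ 0 < t <= eps,
    forall Q, Q \in s -> valid_pocket S eps Q,
    forall Q Q', Q \in s -> Q' \in s -> Q' != Q -> apart (plo Q) (phi Q) (plo Q') (phi Q'),
    (size cs)%:R * t ^+ n.+1 <= eps &
    forall y, cell I (box_lo I) 1 y ->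
      (exists2 Q, Q \in s & pocket_core (ell * t) Q y) \/
      (exists2 c, c \in cs & cell I c t y)].

Lemma exists_layers : all_locations_and_scales S -> exists2 ell : R, 0 < ell &
  exists s cs t, forall k, layer ell (4 ^+ k)^-1 (s k) (cs k) (t k).
Proof.
move=> loc; have [ell ell0 hell] := finite_lower_bound L_gt0; exists ell => //.
have : forall k, exists d : seq pocket * seq E * R, layer ell (4 ^+ k)^-1 d.1.1 d.1.2 d.2.
  move=> k; have eps0 : 0 < (4 ^+ k)^-1 :> R by rewrite invr_gt0 exprn_gt0.
  by have [s [cs [t h]]] := exists_pockets loc ell0 hell eps0; exists (s, cs, t).
by move=> /choice[d hd]; exists (fun k => (d k).1.1), (fun k => (d k).1.2), (fun k => (d k).2).
Qed.

Lemma cell_dist (Lam t : R) (c x y : E) : 0 <= t -> 0 <= Lam -> (forall i, L i <= Lam) ->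
  cell I c t x -> cell I c t y -> euclid_dist x y <= n.+1%:R * Lam * t.
Proof.
move=> t0 Lam0 hL cx cy; rewrite -mulrA; apply: euclid_dist_le => [|i].
  by rewrite mulr_ge0.
have := ler_wpM2l t0 (hL i); rewrite -/(L i).
have /andP[] := cx i; have /andP[] := cy i; rewrite coord_corner -/(L i) => ? ? ? ? ?.
by rewrite ler_norml; apply/andP; split; lra.
Qed.

Lemma closed_cell c t : closed (cell I c t).
Proof. exact: closed_coord_box. Qed.

Lemma inv4_le (e : R) : 0 < e -> exists k0, forall k, (k0 <= k)%N -> (4 ^+ k)^-1 <= e.
Proof.
move=> e0; exists (Num.truncn e^-1).+1 => k hk.
rewrite -[e]invrK lef_pV2 ?posrE ?exprn_gt0 ?invr_gt0//.
apply: (le_trans (ltW (truncnS_gt _))); apply: (@le_trans _ _ k%:R); first by rewrite ler_nat.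
by rewrite -natrX ler_nat; apply: ltnW; exact: ltn_expl.
Qed.

Lemma inv4_cvg (C : R) : (fun k => C / 4 ^+ k) @ \oo --> 0.
Proof.
rewrite -[X in _ --> X](mulr0 C); apply: cvgMr; apply/cvgrPdist_le => e /inv4_le[k0 hk].
by exists k0 => // k /= /hk; rewrite sub0r normrN ger0_norm// invr_ge0 exprn_ge0.
Qed.

Section NullSets.
Variables (ell : R) (s : nat -> seq pocket) (cs : nat -> seq E) (t : nat -> R).
Hypothesis ell0 : 0 < ell.
Hypothesis sct : forall k, layer ell (4 ^+ k)^-1 (s k) (cs k) (t k).

Let t_gt0 k : 0 < t k.
Proof. by have [/andP[]] := sct k. Qed.

Let t_le k : t k <= (4 ^+ k)^-1.
Proof. by have [/andP[]] := sct k. Qed.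

Let card_le k : (size (cs k))%:R * t k ^+ n.+1 <= (4 ^+ k)^-1.
Proof. by have [] := sct k. Qed.

Let off_cell k y : cell I (box_lo I) 1 y -> off_cores (ell * t k) (s k) y ->
  exists2 i, (i < size (cs k))%N & cell I (nth (box_lo I) (cs k) i) (t k) y.
Proof.
move=> Iy hy; have [_ _ _ _ /(_ y Iy)[[Q Qs Qy]|[c cc cy]]] := sct k.
  by have := hy Q Qs.
by exists (index c (cs k)); rewrite ?index_mem// nth_index.
Qed.

Lemma null_off_cores : hausdorff n.+1
  (lim_sup_set (fun k => off_cores (ell * t k) (s k)) `&` cell I (box_lo I) 1) = 0%E.
Proof.
have [Lam Lam0 hL] := L_bound; pose C := n.+1%:R * Lam.
have C0 : 0 < C by rewrite mulr_gt0.
apply: (@hausdorff_lim_sup_eq0 _ _ _ _ _ (fun k => size (cs k)) (fun k => C * t k)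
   (fun k i => cell I (nth (box_lo I) (cs k) i) (t k)) (C ^+ n.+1)).
- by move=> k y [/= hy Iy]; have [i ik iy] := off_cell Iy hy; exists i.
- move=> k i _; apply: diam_le => [|x y cx cy]; first by rewrite mulr_ge0 ?ltW.
  by rewrite edist_euclidE lee_fin (cell_dist _ _ hL cx cy)// ltW.
- move=> k; rewrite exprMn mulrCA ler_wpM2l ?exprn_ge0 ?card_le//.
  exact: ltW.
- move=> e e0; have [k0 hk] := inv4_le (divr_gt0 e0 C0); exists k0 => k /hk h.
  by rewrite mulrC -ler_pdivlMr// (le_trans (t_le k)).
Qed.

Section Sheets.
Variables (X : pseudoMetricType R) (fold : X -> M) (sheet : X -> bool).
Hypothesis fold_le : forall x y, (edist (fold x, fold y) <= edist (x, y))%E.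
Hypothesis sheet_le : forall x y, sheet x = sheet y ->
  (edist (x, y) <= edist (fold x, fold y))%E.

Let lo : R := coord (box_lo I) ord0.
Let step k : R := ell * t k / 2.

(** Off this set the flattened staircase has small slope: it is constant above
    the cores, and elsewhere only the cutoffs vary. *)
Definition active k : set X := [set x | off_cores (ell * t k) (s k) (tau0 S (fold x)) /\
  (\bigcup_j climb (height (S := S)) lo (step k) j) (fold x)].

Lemma open_active k : open (active k).
Proof.
apply: openI.
  apply: (@open_nonexpansive_preimage _ _ _ (fun x => tau0 S (fold x))); last exact: open_off_cores.
  by move=> x y; rewrite edist_euclidE; exact: le_trans (tau0_le _ _) (fold_le x y).
apply: (open_nonexpansive_preimage fold_le); apply: bigcup_open => j _; exact: open_climb.
Qed.

Let step_gt0 k : 0 < step k.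
Proof. by rewrite divr_gt0// mulr_gt0. Qed.

(** Over one cell only boundedly many of the climbing zones are met, since both
    the width of the zones and the size of the cells are proportional to t. *)
Lemma climb_index : exists2 J : nat, (0 < J)%N & forall k (c : E), exists b : nat,
  forall (p : M) j, cell I c (t k) (tau0 S p) -> climb (height (S := S)) lo (step k) j p ->
  (b <= j < b + J)%N.
Proof.
have [Lam Lam0 hL] := L_bound; pose J0 := Num.truncn (2 * Lam / ell).
exists (J0.+1 + 3)%N => // k c; have h0 := step_gt0 k.
pose a := Num.max 0 ((coord c ord0 - lo) / step k).
have /truncn_itv/andP[] : 0 <= a by rewrite le_max lexx.
set b := Num.truncn a => b1 b2; exists b => p j /(_ ord0)/andP[].
rewrite coord_corner -!/(height p) -/(L ord0) => p1 p2 [[q [pq qj]] [q' [pq' qj']]].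
have := le_lt_trans (height_lip p q) pq; rewrite lte_fin ltr_norml => /andP[_ d1].
have := le_lt_trans (height_lip p q') pq'; rewrite lte_fin ltr_norml => /andP[d2 _].
rewrite /above/= in qj'; rewrite /level in qj qj'.
have tL : t k * L ord0 <= 2 * Lam / ell * step k.
  rewrite /step (_ : 2 * Lam / ell * _ = t k * Lam); last by field; rewrite gt_eqF.
  by rewrite ler_wpM2l// ltW.
have J1 : 2 * Lam / ell < J0.+1%:R by exact: truncnS_gt.
apply/andP; split.
  rewrite -ltnS -(ltr_nat R) -natr1; apply: (le_lt_trans b1).
  rewrite /a gt_max ltr_wpDl//= ltr_pdivrMr// mulrDl mul1r; lra.
have aj : (coord c ord0 - lo) <= a * step k.
  by rewrite -ler_pdivrMr// /a le_max lexx orbT.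
rewrite -(ltr_nat R) !natrD; rewrite -(ltr_pM2r h0) in b2; rewrite -(ltr_pM2r h0) in J1.
rewrite -natr1 mulrDl mul1r in b2.
rewrite -(ltr_pM2r h0) !mulrDl; lra.
Qed.

Lemma null_active : hausdorff n.+1 (lim_sup_set active `&` setT) = 0%E.
Proof.
have [Lam Lam0 hL] := L_bound; have [J J0 hJ] := climb_index.
have /choice[b hb] : forall kc : nat * E, exists b : nat, forall (p : M) j,
    cell I kc.2 (t kc.1) (tau0 S p) -> climb (height (S := S)) lo (step kc.1) j p ->
    (b <= j < b + J)%N by move=> [k c]; exact: hJ.
pose C := 8 * ell + n.+1%:R * Lam.
have C0 : 0 < C by rewrite addr_gt0 ?mulr_gt0.
pose c k i := nth (box_lo I) (cs k) (i./2 %/ J).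
(* The index i encodes a sheet, a cell and the rank of a climbing zone over it. *)
apply: (@hausdorff_lim_sup_eq0 _ _ _ _ _ (fun k => (size (cs k) * J).*2) (fun k => C * t k)
   (fun k i => [set x | [/\ sheet x = odd i, cell I (c k i) (t k) (tau0 S (fold x)) &
      climb (height (S := S)) lo (step k) (b (k, c k i) + i./2 %% J)%N (fold x)]])
   (2 * J%:R * C ^+ n.+1)).
- move=> k x [[/= hx [j _ jx]] _]; have [i ik ix] := off_cell (tau0_cell (fold x)) hx.
  have /andP[b1 b2] := hb (k, nth (box_lo I) (cs k) i) _ _ ix jx.
  set b0 := b _ in b1 b2; pose o := (j - b0)%N.
  have oJ : (o < J)%N by rewrite ltn_subLR.
  have iE : (sheet x + (i * J + o).*2)./2 = (i * J + o)%N by rewrite half_bit_double.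
  have cE : c k (sheet x + (i * J + o).*2)%N = nth (box_lo I) (cs k) i.
    by rewrite /c iE divnMDl// divn_small ?addn0.
  exists (sheet x + (i * J + o).*2)%N => /=.
    have : (i * J + o < size (cs k) * J)%N.
      by apply: (@leq_trans (i.+1 * J)%N); rewrite ?leq_mul2r ?ik ?orbT// mulSn addnC ltn_add2r.
    by rewrite -leq_double doubleS; apply: leq_trans; case: (sheet x); rewrite ?add1n ?add0n.
  rewrite cE iE modnMDl (modn_small oJ) -/b0 subnKC//; split => //.
  by rewrite oddD odd_double addbF; case: (sheet x).
- move=> k i _; apply: diam_le => [|x y [sx cx wx] [sy cy wy]].
    by rewrite mulr_ge0 ?ltW.
  apply: (le_trans (sheet_le _)); first by rewrite sx sy.
  apply: (le_trans (climb_dist (step_gt0 k) wx wy)); rewrite lee_fin.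
  have := cell_dist (ltW (t_gt0 k)) (ltW Lam0) hL cx cy.
  rewrite /step /C; lra.
- move=> k; rewrite exprMn -muln2 !natrM.
  have -> : (size (cs k))%:R * J%:R * 2%:R * (C ^+ n.+1 * t k ^+ n.+1) =
     (2 * J%:R * C ^+ n.+1) * ((size (cs k))%:R * t k ^+ n.+1) by ring.
  by rewrite ler_wpM2l ?card_le// !mulr_ge0// exprn_ge0// ltW.
- move=> e e0; have [k0 hk] := inv4_le (divr_gt0 e0 C0); exists k0 => k /hk h.
  by rewrite mulrC -ler_pdivlMr// (le_trans (t_le k)).
Qed.

End Sheets.
End NullSets.
End Layers.

(** * Curves and cutoffs *)

Section CurvesUnderMaps.
Context {R : realType} {X Y : pseudoMetricType R} (phi : X -> Y).
Hypothesis phi_le : forall x y, (edist (phi x, phi y) <= edist (x, y))%E.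
Implicit Types (g : R -> X) (w : R -> R).

Lemma curve_nonexpansive g : curve g -> curve (phi \o g).
Proof.
have o01 : open (`]0, 1[%classic : set R) by exact: itv_open.
rewrite /curve !(continuous_open_subspace _ o01) => cg t t01.
have phic : continuous phi.
  by apply/continuousP => V oV; exact: open_nonexpansive_preimage.
by apply: continuous_comp; [exact: cg|exact: phic].
Qed.

Lemma slope_near_nonexpansive g w (c t : R) : 0 <= c ->
  slope_near (phi \o g) w c t -> slope_near g w c t.
Proof.
move=> c0 [e e0 he]; exists e => // u v ut vt; apply: (le_trans (he u v ut vt)).
by apply: lee_wpmul2l; [rewrite lee_fin|exact: phi_le].
Qed.

Lemma slope_near_le g w (c d t : R) : c <= d -> slope_near g w c t -> slope_near g w d t.
Proof.
move=> cd [e e0 he]; exists e => // u v ut vt; apply: (le_trans (he u v ut vt)).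
by apply: lee_wpmul2r; rewrite ?edist_ge0 ?lee_fin.
Qed.

End CurvesUnderMaps.

Section ExtendedCutoffs.
Context {R : realType} {n : nat} {I : box R n}.
Variable S : slit_seq I.
Local Notation E := (euclid R n.+1).
Local Notation M := (slit_space S).
Local Notation pocket := (pocket R n).
Variables (N : nat) (m : R).
Hypothesis m0 : 0 < m.
Implicit Types (Q : pocket) (s : seq pocket) (p q : M).

(** On the slit space the cutoff distinguishes the two sides of the slit. *)
Definition space_cutoff Q p : R := extension (side_cutoff Q) N p.

Lemma space_cutoff_cvg Q p : walled S N m Q ->
  (fun k => side_cutoff Q (rep p N k)) @ \oo --> space_cutoff Q p.
Proof.
move=> wQ; have [p0 _] := wQ.
apply: (@extension_cvg _ _ _ S _ N m (play Q)^-1) => //; first by rewrite invr_ge0 ltW.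
exact: walled_side_cutoff_lip.
Qed.

Lemma cutoff_rep_cvg Q p : 0 < play Q ->
  (fun k => cutoff Q (rep p N k)) @ \oo --> cutoff Q (tau0 S p).
Proof.
move=> p0; apply/cvgrPdist_lt => e e0.
have [K hK] := euclid_cvg (@rep_cvg _ _ _ _ p N) (mulr_gt0 e0 p0).
exists K => // k /= Kk; rewrite distrC (le_lt_trans (cutoff_lip _ _ p0))//.
by rewrite ltr_pdivrMr// hK.
Qed.

Lemma sided_space_cutoff Q p : walled S N m Q -> sided_cutoff Q (space_cutoff Q p) (tau0 S p).
Proof.
move=> wQ; have [p0 _] := wQ.
have cv := @space_cutoff_cvg Q p wQ; have cvc := @cutoff_rep_cvg Q p p0.
have ccv : cvgn (fun k => side_cutoff Q (rep p N k)) by apply/cvg_ex; eexists; exact: cv.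
have ccvc : cvgn (fun k => cutoff Q (rep p N k)) by apply/cvg_ex; eexists; exact: cvc.
have side k := @sided_side_cutoff _ _ Q (rep p N k).
have cv0 := @coord_cvg _ _ _ _ ord0 (@rep_cvg _ _ _ _ p N).
split.
- rewrite -(cvg_lim _ cv)//; apply/andP; split.
    by apply: limr_ge => //; apply: nearW => k; have [/andP[]] := side k.
  rewrite -(cvg_lim _ cvc)//; apply: ler_lim => //; apply: nearW => k.
  by have [/andP[]] := side k.
- move=> lt0; rewrite -(cvg_lim _ cv)//; apply: cvg_lim => //.
  apply: cvg_trans cvc; apply: near_eq_cvg.
  have : \forall k \near \oo, coord (rep p N k) ord0 < coord (phi Q) ord0.
    exact: (cvgr_lt _ cv0).
  by apply: filterS => k; have [_ + _] := side k => /[apply] ->.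
- move=> nz; rewrite leNgt; apply/negP => gt0; move/eqP: nz; apply.
  rewrite -(cvg_lim _ cv)//; apply: cvg_lim => //.
  apply: cvg_trans (@cvg_cst _ 0 _ \oo _); apply: near_eq_cvg.
  have : \forall k \near \oo, coord (phi Q) ord0 < coord (rep p N k) ord0.
    exact: (cvgr_gt _ cv0).
  by apply: filterS => k; rewrite /side_cutoff => /ltW; rewrite leNgt => /negbTE ->.
Qed.

Lemma space_cutoff_slope (g : R -> M) s (t : R) : curve g -> 0 < t < 1 ->
  (forall Q, Q \in s -> walled S N m Q) ->
  cutoffs_slope_near s (tau0 S \o g) (fun Q u => space_cutoff Q (g u)) t.
Proof.
move=> cg t01 hs; have m4 : 0 < m / 4 by rewrite divr_gt0.
have [e e0 he] := curve_near_edist cg t01 m4; exists e => // Q u v Qs ut vt.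
have [p0 _] := hs Q Qs; rewrite mulrC.
apply: (extension_lip _ m0 (walled_side_cutoff_lip (hs Q Qs))); first by rewrite invr_ge0 ltW.
apply: (le_lt_trans (edist_triangle _ (g t) _)); rewrite (edist_sym (g u)).
apply: (le_lt_trans (leeD (he u ut) (he v vt))); rewrite -EFinD lte_fin; lra.
Qed.

End ExtendedCutoffs.

Section ModulusZero.
Context {R : realType} {n : nat} {I : box R n}.
Variable S : slit_seq I.
Hypothesis loc : all_locations_and_scales S.
Variable p : R.
Hypothesis p1 : 1 <= p.
Local Notation E := (euclid R n.+1).
Local Notation M := (slit_space S).
Local Notation pocket := (pocket R n).

Let eps k : R := (4 ^+ k)^-1.

Let eps_gt0 k : 0 < eps k.
Proof. by rewrite invr_gt0 exprn_gt0. Qed.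

Let eps_cvg : eps @ \oo --> 0.
Proof. by have := @inv4_cvg R 1; rewrite (_ : (fun k => 1 / 4 ^+ k) = eps)//; apply/funext => k; rewrite mul1r. Qed.

Let eps_le1 k : eps k <= 1.
Proof. by rewrite invf_le1 ?exprn_gt0// exprn_ege1// ler1n. Qed.

(** Cutoffs along the curve rather than functions on the box: on which side of a
    slit a curve runs is known to the curve only, if it is the image of a curve
    in the slit space. *)
Definition has_cutoffs (g : R -> E) : Prop := forall (s : seq pocket) N (m : R), 0 < m ->
  (forall Q, Q \in s -> walled S N m Q) -> exists chi,
    (forall Q u, Q \in s -> sided_cutoff Q (chi Q u) (g u)) /\
    (forall t : R, 0 < t < 1 -> cutoffs_slope_near s g chi t).

Lemma modulus_euclid_eq0 (G : set (R -> E)) : (forall g, G g -> [/\ curve g,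
    forall t : R, 0 < t < 1 -> cell I (box_lo I) 1 (g t),
    exists s t : R, [/\ 0 < s < 1, 0 < t < 1 & coord (g s) ord0 <> coord (g t) ord0] &
    has_cutoffs g]) ->
  modulus n.+1 p G = 0%E.
Proof.
move=> hG; have [ell ell0 [s [cs [t sct]]]] := exists_layers loc.
have null := null_off_cores sct.
apply: (@modulus_nonconstant_eq0 R _ n p (fun x : E => coord x ord0) _ _ G 5
  eps (fun k => eps k + eps k) p1 _ _ _ null) => //.
- by move=> x y; exact: coord_edist.
- by move=> k; exact: open_off_cores.
- exact: closed_cell.
- by move=> k; exact: ltW.
- by rewrite -[X in _ --> X](addr0 0); exact: cvgD.
move=> g /hG[cg Ig ncst cut]; split => // k.
have [/andP[t0 te] sV sA _ _] := sct k.
have [N [m m0 hs]] := valid_pockets_walled sV; have [chi [chiS chiL]] := cut _ _ _ m0 hs.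
have gy u v : ((euclid_dist (g u) (g v))%:E <= edist (g u, g v))%E by rewrite edist_euclidE.
have xi_b u : coord (g u) ord0 - 0 <= coord (g u) ord0 <= coord (g u) ord0 by rewrite subr0 lexx.
have xi_s u : slope_near g (fun u => coord (g u) ord0) 1 u.
  by exists 1 => // v w _ _; rewrite mul1e edist_sym; exact: coord_edist.
exists (flat_curve (s k) chi (fun u => coord (g u) ord0)); split.
- move=> u _; apply: (le_trans (flat_curve_close (eps_gt0 k) sV chiS xi_b u)).
  by rewrite addr0 /= lerDl ltW.
- move=> u u01; have := flat_curve_slope (eps_gt0 k) sV gy chiS xi_b ler01 (chiL u u01) (xi_s u).
  by apply: slope_near_le; have := eps_le1 k; lra.
- move=> u u01 hu; have eta0 : 0 < ell * t k by rewrite mulr_gt0.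
  have [|e e0 he] := curve_near_edist cg u01 (d := ell * t k / 4); first by rewrite divr_gt0.
  apply: (@slope_near_le _ _ _ _ 0); first exact: ltW.
  apply: (flat_curve_cst sV sA gy chiS xi_b e0 _ eta0 he hu).
  by rewrite mulr0 ltW.
Qed.

Section Nonvertical.
Variables (X : pseudoPMetricType R) (fold : X -> M) (sheet : X -> bool).
Hypothesis fold_le : forall x y, (edist (fold x, fold y) <= edist (x, y))%E.
Hypothesis sheet_le : forall x y, sheet x = sheet y ->
  (edist (x, y) <= edist (fold x, fold y))%E.

(** The map fold identifies the sheets of X, which is the slit space or its
    double. With the staircase in place of the first coordinate, only the
    climbing zones have to be covered, where points above one cell are close to
    one another. *)
Lemma modulus_nonvertical_eq0 :
  modulus n.+1 p [set g : R -> X | curve g /\ ~ vertical (tau0 S \o fold) g] = 0%E.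
Proof.
have [ell ell0 [s [cs [t sct]]]] := exists_layers loc.
have null := null_active ell0 sct sheet_le.
pose f (x : X) := height (fold x).
have f_le x y : (`|f x - f y|%:E <= edist (x, y))%E.
  exact: le_trans (height_lip _ _) (fold_le x y).
pose lo := coord (box_lo I) ord0.
apply: (@modulus_nonconstant_eq0 R _ n p f _ _ _ 5
  eps (fun k => (1 + ell) / 4 ^+ k) p1 f_le _ _ null) => //.
- by move=> k; exact: open_active.
- by move=> k; exact: ltW.
- exact: inv4_cvg.
move=> g [cg nv]; split => //.
  apply: contrapT => hn; apply: nv; pose c : R := 2^-1; exists (f (g c)).
  have h01 : 0 < c < 1 by rewrite invr_gt0 ltr0n invf_lt1 ?ltr1n.
  apply/seteqP; split => [_ [u + <-]|_ ->].
    rewrite /= in_itv/= => u01; apply: contrapT => ne; apply: hn; exists u, c.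
    by split.
  by exists c => //; rewrite /= in_itv.
move=> k; have [/andP[t0 te] sV sA _ _] := sct k.
have [N [m m0 hs]] := valid_pockets_walled sV.
have cfg := curve_nonexpansive fold_le cg.
pose y u := tau0 S (fold (g u)); pose h := ell * t k / 2.
have eta0 : 0 < ell * t k by rewrite mulr_gt0.
have h0 : 0 < h by rewrite divr_gt0.
have gy u v : ((euclid_dist (y u) (y v))%:E <= edist (g u, g v))%E.
  exact: le_trans (tau0_le _ _) (fold_le _ _).
pose chi Q u := space_cutoff N Q (fold (g u)).
have chiS Q u : Q \in s k -> sided_cutoff Q (chi Q u) (y u).
  by move=> Qs; exact: (sided_space_cutoff m0 _ (hs Q Qs)).
have chiL u : 0 < u < 1 -> cutoffs_slope_near (s k) y chi u.
  by move=> u01; exact: (space_cutoff_slope m0 cfg u01 hs).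
pose st := staircase (height (S := S)) lo h.
pose xi u := st (fold (g u)).
have xi_b u : coord (y u) ord0 - h <= xi u <= coord (y u) ord0.
  exact: (staircase_bounds (@height_lip _ _ _ S) (@height_lo _ _ _ S) h0).
exists (flat_curve (s k) chi xi); split.
- move=> u _; apply: (le_trans (flat_curve_close (eps_gt0 k) sV chiS xi_b u)).
  rewrite /h /eps mulrDl mul1r lerD2l -mulrA ler_wpM2l ?(ltW ell0)//.
  by apply: le_trans te; rewrite ler_pdivrMr// mulr_natr mulr2n lerDl ltW.
- move=> u u01; have xs : slope_near g xi 2 u.
    apply: (slope_near_nonexpansive fold_le) => //.
    exact: (staircase_slope (@height_lip _ _ _ S) (@height_lo _ _ _ S) h0 cfg u01).
  have := flat_curve_slope (eps_gt0 k) sV gy chiS xi_b (ler0n R 2) (chiL u u01) xs.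
  by apply: slope_near_le; have := eps_le1 k; lra.
- move=> u u01 hu.
  have [yu|nyu] := pselect (off_cores (ell * t k) (s k) (y u)).
    have xs : slope_near g xi 0 u.
      apply: (slope_near_nonexpansive fold_le) => //.
      apply: (staircase_cst (@height_lip _ _ _ S) (@height_lo _ _ _ S) h0 cfg u01) => W.
      by apply: hu; split.
    have := flat_curve_slope (eps_gt0 k) sV gy chiS xi_b (lexx 0) (chiL u u01) xs.
    by rewrite mulr0 add0r.
  have [|e e0 he] := curve_near_edist cg u01 (d := ell * t k / 4); first by rewrite divr_gt0.
  apply: (@slope_near_le _ _ _ _ 0); first exact: ltW.
  apply: (flat_curve_cst sV sA gy chiS xi_b e0 _ eta0 he nyu).
  by rewrite /h mulrC divfK.
Qed.

End Nonvertical.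

End ModulusZero.

(** * The four families of curves *)

Section OpenDomains.
Context {R : realType} {n : nat} {I : box R n}.
Variable S : slit_seq I.
Local Notation E := (euclid R n.+1).
Local Notation dom := (slit_domain S).

Lemma open_open_box : open (open_box I).
Proof.
apply: open_edist_nbhd => x Ix.
have [|m m0 hm] := @finite_lower_bound R _ (fun i =>
    Num.min (coord x i - coord (box_lo I) i) (coord (box_hi I) i - coord x i)).
  by move=> i; rewrite lt_min !subr_gt0; exact: Ix.
exists m => // y; rewrite edist_euclidE lte_fin => xy i.
have := le_lt_trans (coord_dist x y i) xy; rewrite ltr_norml => /andP[? ?].
by have := hm i; rewrite le_min => /andP[? ?]; apply/andP; split; lra.
Qed.

Lemma closed_slit j : closed (S j).
Proof.
have [c [l [l0 -> _]]] := slitP S j.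
pose b (i : 'I_n.+1) := if i == ord0 then coord c i else coord c i + l.
have -> : [set x : E | coord x ord0 = coord c ord0 /\
    forall i, i != ord0 -> coord c i <= coord x i <= coord c i + l] =
    [set x : E | forall i, coord c i <= coord x i <= b i].
  apply/seteqP; split => [x [x0 xi] i|x h].
    by rewrite /b; case: (eqVneq i ord0) => [->|/xi//]; rewrite x0 lexx.
  split; first by have := h ord0; rewrite /b eqxx -eq_le => /eqP.
  by move=> i /negbTE i0; have := h i; rewrite /b i0.
exact: closed_coord_box.
Qed.

Lemma open_slit_domain i : open (dom i).
Proof.
rewrite /slit_domain setDE; apply: openI; first exact: open_open_box.
by apply/closed_openC/closed_bigcup => [|j _]; [exact: finite_II|exact: closed_slit].
Qed.

Lemma open_box_cell x : open_box I x -> cell I (box_lo I) 1 x.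
Proof.
by move=> Ix i; rewrite coord_corner mul1r addrC subrK; have /andP[/ltW -> /ltW ->] := Ix i.
Qed.

(** Inside an open domain the inner distance is locally the Euclidean one. *)
Lemma side_cutoff_slope (g : R -> E) (s : seq (pocket R n)) N (m t : R) : 0 < m ->
  (forall Q, Q \in s -> walled S N m Q) -> curve g -> 0 < t < 1 -> dom N (g t) ->
  cutoffs_slope_near s g (fun Q u => side_cutoff Q (g u)) t.
Proof.
move=> m0 hs cg t01 dt; have [r r0 hr] := open_edist_nbhdP (@open_slit_domain N) dt.
have d0 : 0 < Num.min r m / 4 by rewrite divr_gt0// lt_min r0.
have [m1 m2] : Num.min r m <= r /\ Num.min r m <= m by rewrite !ge_min !lexx orbT.
have [e e0 he] := curve_near_edist cg t01 d0; exists e => // Q u v Qs ut vt.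
have [p0 wall] := hs Q Qs; have ru := he u ut; have rv := he v vt.
rewrite !edist_euclidE !lee_fin in ru rv.
move: (Num.min r m) m1 m2 d0 ru rv => d m1 m2 d0 ru rv.
have uv : euclid_dist (g u) (g v) <= d / 2.
  by have := euclid_dist_triangle (g t) (g u) (g v); rewrite (euclid_dist_sym (g u) (g t)); lra.
have near x : euclid_dist (g t) x < r -> dom N x.
  by move=> tx; apply: hr; rewrite edist_euclidE lte_fin.
rewrite mulrC; apply: (walled_side_cutoff_lip (hs Q Qs)).
- by apply: near; lra.
- by apply: near; lra.
apply: (@le_lt_trans _ _ (euclid_dist (g u) (g v))%:E); last by rewrite lte_fin; lra.
apply: inner_dist_segment => a /andP[a0 a1]; apply: near.
apply: (le_lt_trans (euclid_dist_triangle (g u) _ _)).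
have seg0 : segment (g u) (g v) 0 = g u.
  by apply/rowP => i; rewrite mxE subr0 mul1r mul0r addr0.
have := segment_dist (g u) (g v) 0 a; rewrite seg0 sub0r normrN ger0_norm// => ->.
have : a * euclid_dist (g u) (g v) <= euclid_dist (g u) (g v).
  by rewrite ler_piMl// euclid_dist_ge0.
lra.
Qed.

End OpenDomains.

Section Nonconstant.
Context {R : realType} {X : pseudoMetricType R}.

(** The values of f on a connected set fill an interval, while they would
    be confined to a, b and one further value. *)
Lemma connects_nonconstant (f : X -> R) (A B : set X) (g : R -> X) (a b : R) :
  (forall x y, (`|f x - f y|%:E <= edist (x, y))%E) -> a < b ->
  A !=set0 -> B !=set0 -> (forall x, A x -> f x = a) -> (forall x, B x -> f x = b) ->
  connects A B g -> exists s t : R, [/\ 0 < s < 1, 0 < t < 1 & f (g s) <> f (g t)].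
Proof.
move=> f_le ab [a0 Aa0] [b0 Bb0] fA fB con; apply: contrapT => hn.
have fc : continuous f.
  move=> x; apply/cvgrPdist_lt => e e0; apply/nbhs_ballP; exists (e / 2) => /=.
    by rewrite divr_gt0.
  move=> y xy; rewrite -lte_fin; apply: (le_lt_trans (f_le x y)).
  by apply: (@le_lt_trans _ _ (e / 2)%:E); [apply: edist_fin => //; rewrite divr_gt0|rewrite lte_fin; lra].
pose c := f (g 2^-1).
have clc : closure (g @` `]0, 1[) `<=` f @^-1` [set c].
  have /closure_id -> : closed (f @^-1` [set c]).
    by apply: closed_comp => [x _|]; [exact: fc|exact: closed_eq].
  apply: closure_subset => _ [u + <-]; rewrite /= in_itv/= => u01.
  apply: contrapT => ne; apply: hn; exists u, 2^-1; split => //.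
  by rewrite invr_gt0 ltr0n invf_lt1 ?ltr1n.
have := connected_continuous_connected con (continuous_subspaceT fc).
move/connected_intervalP => itv.
have val z : a <= z <= b -> [\/ z = a, z = b | z = c].
  move=> zab; have [x [[Ax|Bx]|cx] <-] := itv a b (ex_intro2 _ _ a0 (or_introl (or_introl Aa0)) (fA _ Aa0))
    (ex_intro2 _ _ b0 (or_introl (or_intror Bb0)) (fB _ Bb0)) z zab.
  - by constructor 1; exact: fA.
  - by constructor 2; exact: fB.
  - by constructor 3; exact: clc.
have z1 : a <= a + (b - a) / 3 <= b by apply/andP; split; lra.
have z2 : a <= a + (b - a) / 2 <= b by apply/andP; split; lra.
by case: (val _ z1) => e1; case: (val _ z2) => e2; lra.
Qed.

End Nonconstant.

Section Faces.
Context {R : realType} {n : nat} {I : box R n}.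
Variable S : slit_seq I.
Local Notation E := (euclid R n.+1).
Local Notation M := (slit_space S).
Local Notation dom := (slit_domain S).

Lemma slit_space_point (x : nat -> E) (l : E) : (forall i k, dom i (x k)) ->
  (forall i (e : R), 0 < e -> exists N, forall k k', (N <= k)%N -> (N <= k')%N ->
    (inner_dist (dom i) (x k) (x k') <= e%:E)%E) ->
  x @ \oo --> l -> exists p : M, tau0 S p = l.
Proof.
move=> dx cx xl; pose y i k : inner_space (dom i) := exist _ (x k) (dx i k).
have cy i : cauchy (y i @ \oo).
  apply/cauchy_seqP => e e0; have [N hN] := cx i e e0.
  by exists N => k k' Nk Nk'; rewrite edist_innerE; exact: hN.
pose u i : cauchy_seqs (inner_space (dom i)) := exist _ (y i) (cy i).
pose p i : stage S i := (\pi_(completion (inner_space (dom i))) (u i))%qT.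
have compat i j (ij : (i <= j)%N) : tau S ij (p j) = p i.
  rewrite /tau /p completion_map_pi; congr (\pi_(completion _) _)%qT.
  by apply: eq_exist; apply/funext => k; exact: eq_exist.
exists (exist _ p compat); apply: cvg_lim; first exact: metric_hausdorff.
apply: (@equiv_seq_cvg _ _ (dom 0) (u 0%N)); last exact: xl.
by rewrite cauchy_dist_sym; exact: cauchy_dist_repr.
Qed.

Lemma slit_domain_near_face (z : R) i : ~ (coord (box_lo I) ord0 < z < coord (box_hi I) ord0) ->
  exists2 e : R, 0 < e & forall x, open_box I x -> `|coord x ord0 - z| < e -> dom i x.
Proof.
move=> hz; elim: i => [|i [e e0 he]].
  by exists 1 => // x Ix _; split => // -[j].
have [c [l [l0 SE SI]]] := slitP S i.
have cz : coord c ord0 != z.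
  apply/eqP => cz; apply: hz; rewrite -cz; apply: SI; rewrite SE; split => // j _.
  by rewrite lexx lerDl ltW.
exists (Num.min e `|coord c ord0 - z|); first by rewrite lt_min e0 normr_gt0 subr_eq0.
move=> x Ix; rewrite lt_min => /andP[xe xc]; split => // -[j /= ji Sx].
move: ji; rewrite ltnS leq_eqVlt => /predU1P[ji|ji].
  by move: Sx xc; rewrite ji SE => -[-> _]; rewrite ltxx.
by have [_] := he x Ix xe; apply; exists j.
Qed.

(** The slits of a finite stage stay away from the faces, so a sequence tending
    to a point of a face along slit-free hyperplanes is Cauchy in every stage. *)
Lemma face_point (z : R) : z = coord (box_lo I) ord0 \/ z = coord (box_hi I) ord0 ->
  exists p : M, coord (tau0 S p) ord0 = z /\ forall i, i != ord0 ->
    coord (box_lo I) i < coord (tau0 S p) i < coord (box_hi I) i.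
Proof.
move=> zE; pose lo := coord (box_lo I); pose hi := coord (box_hi I).
have lohi i : lo i < hi i := box_lt I i.
have z01 : lo ord0 <= z <= hi ord0.
  by case: zE => ->; rewrite -/(lo _) -/(hi _) lexx ?ltW.
have zout : ~ (lo ord0 < z < hi ord0).
  by case: zE => ->; rewrite /lo /hi ltxx ?andbF.
have /choice[c hc] : forall k, exists c : R, [/\ lo ord0 < c < hi ord0,
    `|c - z| < k.+1%:R^-1 & forall j x, S j x -> coord x ord0 <> c].
  move=> k; have r0 : 0 < k.+1%:R^-1 :> R by rewrite invr_gt0.
  move: (k.+1%:R^-1) r0 => r r0; have := lohi ord0 => lh; have /andP[z0 z1] := z01.
  have [|c /andP[]] := @slit_free_level _ _ _ S (Num.max (lo ord0) (z - r)) (Num.min (hi ord0) (z + r)).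
    by rewrite gt_max !lt_min; apply/andP; split; apply/andP; split; lra.
  rewrite gt_max lt_min => /andP[? ?] /andP[? ?] hc; exists c; split => //.
    by apply/andP; split; lra.
  by rewrite ltr_norml; apply/andP; split; lra.
pose x0 (a : R) : E := \row_i (if i == ord0 then a else (lo i + hi i) / 2).
have x0E a i : coord (x0 a) i = if i == ord0 then a else (lo i + hi i) / 2.
  by rewrite /coord mxE.
have mid i : lo i < (lo i + hi i) / 2 < hi i by have := lohi i; move=> ?; apply/andP; split; lra.
have x0I a : lo ord0 < a < hi ord0 -> open_box I (x0 a).
  by move=> ha i; rewrite x0E; case: (eqVneq i ord0) => [->//|_]; exact: mid.
have x0dist a b : euclid_dist (x0 a) (x0 b) <= n.+1%:R * `|a - b|.
  by apply: euclid_dist_le => // i; rewrite !x0E; case: ifP => // _; rewrite subrr normr0.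
have n0 : (0 : R) < n.+1%:R by rewrite ltr0n.
have small (e : R) : 0 < e -> exists N, forall k, (N <= k)%N -> `|c k - z| < e.
  move=> e0; exists (Num.truncn e^-1) => k Nk; have [_ h _] := hc k.
  apply: (lt_le_trans h); rewrite -[e]invrK lef_pV2 ?posrE ?invr_gt0//.
  by apply: (le_trans (ltW (truncnS_gt _))); rewrite ler_nat ltnS.
have [|i e e0||p pE] := @slit_space_point (fun k => x0 (c k)) (x0 z).
- move=> i k; have [ck _ free] := hc k; split; first exact: x0I.
  by move=> [j _ /free]; rewrite x0E eqxx.
- have [d d0 hd] := @slit_domain_near_face z i zout.
  have d'0 : 0 < Num.min d (e / n.+1%:R / 2) by rewrite lt_min d0 !divr_gt0.
  have [N hN] := small _ d'0; exists N => k k' /hN + /hN.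
  rewrite !lt_min => /andP[k1 k2] /andP[k3 k4].
  have [ck _ _] := hc k; have [ck' _ _] := hc k'.
  apply: (@le_trans _ _ (euclid_dist (x0 (c k)) (x0 (c k')))%:E).
    apply: inner_dist_segment => t t01.
    have -> : segment (x0 (c k)) (x0 (c k')) t = x0 ((1 - t) * c k + t * c k').
      apply/rowP => j; rewrite !mxE -!/(coord _ _) !x0E.
      by case: ifP => // _; ring.
    apply: hd; first by apply: x0I; exact: convex_between.
    rewrite x0E eqxx ltr_norml.
    have : z - d < (1 - t) * c k + t * c k' < z + d.
      apply: convex_between => //.
        by move: k1; rewrite ltr_norml => /andP[? ?]; apply/andP; split; lra.
      by move: k3; rewrite ltr_norml => /andP[? ?]; apply/andP; split; lra.
    by move=> /andP[? ?]; apply/andP; split; lra.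
  rewrite lee_fin; apply: (le_trans (x0dist _ _)).
  rewrite mulrC -ler_pdivlMr//.
  have -> : c k - c k' = (c k - z) - (c k' - z) by ring.
  apply: (le_trans (ler_normB _ _)).
  by move: (e / _) k2 k4 => q k2 k4; lra.
- apply/cvg_ballP => e e0; have [N hN] := small _ (divr_gt0 e0 n0).
  exists N => // k /= Nk; apply/ball_euclid; apply: (le_lt_trans (x0dist _ _)).
  by rewrite mulrC -ltr_pdivlMr// distrC hN.
exists p; rewrite pE; split; first by rewrite x0E eqxx.
by move=> i i0; rewrite x0E (negbTE i0).
Qed.

End Faces.

Section MainResult.
Context {R : realType} {n : nat} {I : box R n}.
Variable S : slit_seq I.
Hypothesis loc : all_locations_and_scales S.
Variable p : R.
Hypothesis p1 : 1 <= p.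
Local Notation E := (euclid R n.+1).
Local Notation M := (slit_space S).

Lemma tau0_edist_le (x y : M) : (edist (tau0 S x, tau0 S y) <= edist (x, y))%E.
Proof. by rewrite edist_euclidE; exact: tau0_le. Qed.

Lemma left_face_preimage : tau0 S @^-1` left_face (I := I) !=set0.
Proof. by have [q [q0 qi]] := @face_point _ _ _ S _ (or_introl erefl); exists q. Qed.

Lemma right_face_preimage : tau0 S @^-1` right_face (I := I) !=set0.
Proof. by have [q [q0 qi]] := @face_point _ _ _ S _ (or_intror erefl); exists q. Qed.

Lemma modulus_Gamma_eq0 : modulus n.+1 p (Gamma S) = 0%E.
Proof.
apply: (modulus_euclid_eq0 loc p1) => g [cg gI con].
have gdom (t : R) N : 0 < t < 1 -> slit_domain S N (g t).
  move=> t01; have [|Ig Sg] := gI (g t); first by exists t => //=; rewrite in_itv.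
  by split => // -[j _ Sj]; apply: Sg; exists j.
split => //.
- by move=> t /(gdom t 0%N)[Ig _]; exact: open_box_cell.
- have [q qL] := left_face_preimage; have [q' qR] := right_face_preimage.
  apply: (connects_nonconstant (f := fun x : E => coord x ord0) _ (box_lt I ord0) _ _ _ _ con).
  + by move=> x y; exact: coord_edist.
  + by exists (tau0 S q).
  + by exists (tau0 S q').
  + by move=> x [].
  + by move=> x [].
- move=> s N m m0 hs; exists (fun Q u => side_cutoff Q (g u)); split.
    by move=> Q u _; exact: sided_side_cutoff.
  by move=> t t01; exact: (side_cutoff_slope m0 hs cg t01 (gdom t N t01)).
Qed.

Lemma modulus_Gamma_hat_eq0 : modulus n.+1 p (Gamma_hat S) = 0%E.
Proof.
apply: (modulus_euclid_eq0 loc p1) => _ [g [cg con] <-]; split.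
- exact: (curve_nonexpansive tau0_edist_le cg).
- by move=> t _; exact: tau0_cell.
- apply: (connects_nonconstant (f := height (S := S)) _ (box_lt I ord0) left_face_preimage right_face_preimage _ _ con).
  + exact: height_lip.
  + by move=> x [].
  + by move=> x [].
- move=> s N m m0 hs; exists (fun Q u => space_cutoff N Q (g u)); split.
    by move=> Q u Qs; exact: (sided_space_cutoff m0 _ (hs Q Qs)).
  by move=> t t01; exact: (space_cutoff_slope m0 cg t01 hs).
Qed.

Lemma modulus_Gamma_nv_eq0 : modulus n.+1 p (Gamma_nv S) = 0%E.
Proof.
exact: (@modulus_nonvertical_eq0 _ _ _ S loc p p1 M id (fun=> true)).
Qed.

Lemma edist_doubleE (x y : slit_double S) :
  edist (x, y) = glue_dist (outer_boundary S) (repr (x : metric_double _)) (repr (y : metric_double _)).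
Proof.
by rewrite -{1}[x : metric_double _]reprK -{1}[y : metric_double _]reprK edist_metric_double_pi.
Qed.

(** Folding the double onto one of its copies does not increase distances and
    is an isometry on each copy. *)
Lemma modulus_double_Gamma_nv_eq0 : modulus n.+1 p (double_Gamma_nv S) = 0%E.
Proof.
apply: (@modulus_nonvertical_eq0 _ _ _ S loc p p1 (slit_double S)
   (fun x => (repr (x : metric_double _)).2) (fun x => (repr (x : metric_double _)).1)) => x y.
- rewrite edist_doubleE /glue_dist; case: ifP => // _.
  by apply: le_ereal_inf_tmp => _ [z _ <-]; exact: edist_triangle.
- by move=> xy; rewrite edist_doubleE /glue_dist xy eqxx.
Qed.

End MainResult.

Theorem lemma5p6 (R : realType) (n : nat) (hn : (2 <= n.+1)%N) (I : box R n)
    (S : slit_seq I)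
    (diam_slits : (fun i => diam (S i)) @ \oo --> 0%E)
    (dense_slits : open_box I `<=` closure (\bigcup_i S i))
    (separated_slits : uniformly_relatively_separated S)
    (slits_everywhere : all_locations_and_scales S)
    (p : R) (hp : 1 <= p) :
  [/\ modulus n.+1 p (Gamma S) = 0%E,
      modulus n.+1 p (Gamma_hat S) = 0%E,
      modulus n.+1 p (Gamma_nv S) = 0%E &
      modulus n.+1 p (double_Gamma_nv S) = 0%E].
Proof.
split.
- exact: modulus_Gamma_eq0.
- exact: modulus_Gamma_hat_eq0.
- exact: modulus_Gamma_nv_eq0.
- exact: modulus_double_Gamma_nv_eq0.
Qed.
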